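(* Let $N\ge 2$ be an integer and let $m_0:\mathbb{T}\to\mathbb{C}$ be Lipschitz, with finitely many zeros, with $R_{m_0,m_0}1=1$ and $m_0(1)=\sqrt N$. Let $C_1,\dots,C_n$ be the $m_0$-cycles. For each $i$ let $(U_{C_i},\pi_{C_i},\varphi_{C_i})$ be the triple attached to the cycle $C_i$ as defined in the context (it is the cyclic representation corresponding to $h_{m_0,C_i}$). Define $$U=U_{C_1}\oplus\dots\oplus U_{C_n},\qquad \pi=\pi_{C_1}\oplus\dots\oplus\pi_{C_n},\qquad \varphi=\varphi_{C_1}\oplus\dots\oplus\varphi_{C_n}.$$ Then $(U,\pi,\varphi)$ is the cyclic representation corresponding to the constant function $1$. Moreover each element $S$ in the commutant of this representation has the form $$S=S_{C_1}\oplus\dots\oplus S_{C_n}$$ where $S_{C_i}$ is in the commutant of $(U_{C_i},\pi_{C_i},\varphi_{C_i})$.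
   Context: $\mathbb{T}=\{z\in\mathbb{C}:|z|=1\}$, with normalized Haar measure $\mu$; functions on $\mathbb{T}$ are identified with $2\pi$-periodic functions on $\mathbb{R}$ via $z=e^{ix}$. $R_{m_0,m_0}f(z)=\frac1N\sum_{w^N=z}|m_0(w)|^2f(w)$. Inner products are linear in the second variable, and $L^2(\mathbb{R})$ carries the inner product $\langle\xi|\eta\rangle=\frac1{2\pi}\int_{\mathbb{R}}\overline{\xi}\eta\,dx$. Cyclic representation: for $h\in L^1(\mathbb{T})$, $h\ge0$, $R_{m_0,m_0}h=h$, the cyclic representation corresponding to $h$ is the triple (unique up to unitary equivalence) consisting of a unitary $U$ and a $*$-representation $\pi$ of $L^\infty(\mathbb{T})$ on a Hilbert space $\mathcal{H}$ and a vector $\varphi\in\mathcal{H}$ such that $U\pi(f)=\pi(f(z^N))U$ for $f\in L^\infty(\mathbb{T})$, $U\varphi=\pi(m_0)\varphi$, $\langle\varphi|\pi(f)\varphi\rangle=\int_{\mathbb{T}}fh\,d\mu$ for $f\in L^\infty(\mathbb{T})$, and $\varphi$ is cyclic, i.e. the span of $\{U^{-n}\pi(f)\varphi: n\ge0,\ f\in L^\infty(\mathbb{T})\}$ is dense in $\mathcal{H}$. The commutant of such a representation is the set of bounded operators commuting with $U$, $U^*$ and all $\pi(f)$, $f\in L^\infty(\mathbb{T})$. An $m_0$-cycle is a set $C=\{z_1,\dots,z_p\}\subset\mathbb{T}$ (distinct points) with $z_i^N=z_{i+1}$ for $1\le i\le p-1$, $z_p^N=z_1$, and $|m_0(z_i)|=\sqrt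 N$ for all $i$. For $\rho\in\mathbb{T}$, $\alpha_\rho(f)(z)=f(\rho z)$. $m_0^{(p)}(z)=m_0(z)m_0(z^N)\cdots m_0(z^{N^{p-1}})$. $\operatorname{Per}(f)(x)=\sum_{j\in\mathbb{Z}}f(x+2j\pi)$. On $L^2(\mathbb{R})$: $(U_1\xi)(x)=\sqrt N\xi(Nx)$ and $\pi_1(f)\xi=f\xi$ for $f\in L^\infty(\mathbb{T})$ (viewed as a $2\pi$-periodic function). Given an $m_0$-cycle $C=\{z_1,\dots,z_p\}$, write $m_0(z_k)=\sqrt Ne^{i\theta_k}$, $\theta_C=\theta_1+\dots+\theta_p$, and $$\varphi_{k,m_0,C}(x)=\prod_{l=1}^\infty\frac{e^{-i\theta_C}\alpha_{z_k}(m_0^{(p)})\left(\frac{x}{N^{lp}}\right)}{\sqrt{N^p}},\quad g_{k,m_0,C}=\alpha_{z_k^{-1}}\left(\operatorname{Per}|\varphi_{k,m_0,C}|^2\right),\quad h_{m_0,C}=\sum_{k=1}^pg_{k,m_0,C}.$$ On $L^2(\mathbb{R})^p$ define $U_C(\xi_1,\dots,\xi_p)=(e^{i\theta_1}U_1\xi_2,\dots,e^{i\theta_{p-1}}U_1\xi_p,e^{i\theta_p}U_1\xi_1)$, $\pi_C(f)(\xi_1,\dots,\xi_p)=(\pi_1(\alpha_{z_1}(f))\xi_1,\dots,\pi_1(\alpha_{z_p}(f))\xi_p)$ for $f\in L^\infty(\mathbb{T})$, and $\varphi_C=(\varphi_{1,m_0,C},\dots,\varphi_{p,m_0,C})$.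 *)

(* Defs.v *)
From HB Require Import structures.
From mathcomp Require Import all_boot all_order all_algebra.
From mathcomp Require Import all_classical all_reals all_analysis.
From mathcomp.real_closed Require Import complex.

Set Implicit Arguments.
Unset Strict Implicit.
Unset Printing Implicit Defensive.
Import Order.TTheory GRing.Theory Num.Theory.
Import numFieldNormedType.Exports.
Local Open Scope classical_set_scope.
Local Open Scope ring_scope.
Local Open Scope quotient_scope.

Notation "x %:C" := (real_complex _ x) : ring_scope.
Local Notation Re := complex.Re.
Local Notation Im := complex.Im.

Section Circle.
Variable R : realType.

Definition circle := {z : R[i] | `|z| == 1}.
HB.instance Definition _ := Choice.on circle.

Definition Circle (z : R[i]) (z1 : `|z| == 1) : circle := exist _ z z1.

Lemma circle_one_subproof : `|1 : R[i]| == 1.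
Proof. by rewrite normr1. Qed.
Lemma circle_mul_subproof (z w : circle) : `|val z * val w| == 1.
Proof. by rewrite normrM (eqP (valP z)) (eqP (valP w)) mulr1. Qed.
Lemma circle_inv_subproof (z : circle) : `|(val z)^-1| == 1.
Proof. by rewrite normfV (eqP (valP z)) invr1. Qed.

Definition circle_one := Circle circle_one_subproof.
Definition circle_mul z w := Circle (circle_mul_subproof z w).
Definition circle_inv z := Circle (circle_inv_subproof z).

Lemma circle_mulA : associative circle_mul.
Proof. by move=> z w t; apply: val_inj; rewrite /= mulrA. Qed.
Lemma circle_mul1 : left_id circle_one circle_mul.
Proof. by move=> z; apply: val_inj; rewrite /= mul1r. Qed.
Lemma circle_mulr1 : right_id circle_one circle_mul.
Proof. by move=> z; apply: val_inj; rewrite /= mulr1. Qed.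
Lemma circle_val_neq0 (z : circle) : val z != 0.
Proof. by rewrite -normr_eq0 (eqP (valP z)) oner_neq0. Qed.
Lemma circle_mulV : left_inverse circle_one circle_inv circle_mul.
Proof. by move=> z; apply: val_inj; rewrite /= mulVf ?circle_val_neq0. Qed.
Lemma circle_mulrV : right_inverse circle_one circle_inv circle_mul.
Proof. by move=> z; apply: val_inj; rewrite /= mulfV ?circle_val_neq0. Qed.

HB.instance Definition _ := isGroup.Build circle
  circle_mulA circle_mul1 circle_mulr1 circle_mulV circle_mulrV.

Lemma expi_subproof (x : R) : `|Complex (cos x) (sin x)| == 1.
Proof. by rewrite normc_def /= cos2Dsin2 sqrtr1. Qed.

(* e^(ix) *)
Definition expi (x : R) : circle := Circle (expi_subproof x).

End Circle.

Section Functions.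
Variable R : realType.
Local Notation C := R[i].
Local Notation mu := (@lebesgue_measure R).

Definition cmeasurable (f : R -> C) : Prop :=
  measurable_fun [set: R] (fun x => Re (f x)) /\
  measurable_fun [set: R] (fun x => Im (f x)).

Definition cintegral (D : set R) (f : R -> C) : C :=
  Complex (\int[mu]_(x in D) Re (f x)) (\int[mu]_(x in D) Im (f x)).

(* Integral against the normalized Haar measure, transported by x |-> e^(ix). *)
Definition haar_integral (f : circle R -> C) : C :=
  ((2 * pi)^-1)%:C * cintegral `[0, 2 * pi] (fun x => f (expi x)).

(* L^oo of the circle is handled through representatives; operators depending
   on f in L^oo are required to respect [circle_ae_eq]. Null sets of the circle
   are the null sets of its 2 pi-periodic lift to the line. *)
Definition circle_ae_eq (f g : circle R -> C) : Prop :=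
  {ae mu, forall x, f (expi x) = g (expi x)}.

Definition Linfty (f : circle R -> C) : Prop :=
  cmeasurable (fun x => f (expi x)) /\
  exists M : R, {ae mu, forall x, `|f (expi x)| <= M%:C}.

Definition alpha (rho : circle R) (f : circle R -> C) : circle R -> C :=
  fun z => f (rho * z)%g.

(* R_{m0,m0} *)
Definition ruelle (N : nat) (m0 f : circle R -> C) (z : circle R) : C :=
  N%:R^-1 * \sum_(w \in [set w : circle R | (w ^+ N)%g = z]) `|m0 w| ^+ 2 * f w.

(* m0^(p) *)
Definition miter (N p : nat) (m0 : circle R -> C) (z : circle R) : C :=
  \prod_(j < p) m0 (z ^+ (N ^ j)%N)%g.

Definition lipschitz_circle (f : circle R -> C) : Prop :=
  exists K : R, forall z w, `|f z - f w| <= K%:C * `|val z - val w|.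

(* The product starts at index 1. *)
Definition infinite_prod (a : nat -> C) : C :=
  limn (fun n => \prod_(1 <= l < n.+1) a l : C^o).

End Functions.

(* A complex vector space with a form [inner], to be linear in its second
   argument; the axioms and completeness are stated by [hilbert]. *)
Record ipspace (R : realType) := IPSpace {
  ipcarrier :> lmodType R[i];
  inner : ipcarrier -> ipcarrier -> R[i] }.

Section Hilbert.
Variables (R : realType) (H : ipspace R).
Local Notation C := R[i].

Definition hnorm (x : H) : R := Num.sqrt (Re (inner x x)).

Definition hilbert : Prop :=
  [/\ forall (x : H) (a : C) (y z : H),
        inner x (a *: y + z) = a * inner x y + inner x z,
      forall x y : H, inner y x = (inner x y)^*,
      forall x : H, 0 <= inner x x,
      forall x : H, inner x x = 0 -> x = 0
    & forall u : nat -> H,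
        (forall e : R, 0 < e -> exists M, forall m n,
          (M <= m)%N -> (M <= n)%N -> hnorm (u m - u n) < e) ->
        exists l, (fun n => hnorm (u n - l)) @ \oo --> (0 : R)].

Definition bounded_op (S : H -> H) : Prop :=
  linear S /\ exists M : R, forall x, hnorm (S x) <= M * hnorm x.

Definition adjoint (S T : H -> H) : Prop :=
  forall x y, inner (S x) y = inner x (T y).

Definition unitary (U : H -> H) : Prop :=
  [/\ linear U, forall x y, inner (U x) (U y) = inner x y
    & forall y, exists x, U x = y].

Definition span (A : set H) : set H :=
  [set x | exists k (c : 'I_k -> C) (v : 'I_k -> H),
     (forall j, A (v j)) /\ x = \sum_j c j *: v j].

Definition hdense (A : set H) : Prop :=
  forall x (e : R), 0 < e -> exists2 y, A y & hnorm (x - y) < e.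

Definition star_representation (rep : (circle R -> C) -> H -> H) : Prop :=
  [/\ forall f, Linfty f -> bounded_op (rep f),
      forall f g, Linfty f -> Linfty g -> circle_ae_eq f g ->
        forall x, rep f x = rep g x,
      forall (a : C) f g, Linfty f -> Linfty g ->
        forall x, rep (fun z => a * f z + g z) x = a *: rep f x + rep g x,
      forall f g, Linfty f -> Linfty g ->
        forall x, rep (fun z => f z * g z) x = rep f (rep g x)
    & (forall x, rep (fun=> 1) x = x) /\
      forall f, Linfty f -> adjoint (rep f) (rep (fun z => (f z)^*))].

(* Meant for h >= 0 integrable with R_{m0,m0} h = h. The vectors U^{-n} pi(f) phi
   are described as the v with U^n v = pi(f) phi. *)
Definition cyclic_representation (N : nat) (m0 : circle R -> C)
    (h : circle R -> R) (U : H -> H) (rep : (circle R -> C) -> H -> H)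
    (phi : H) : Prop :=
  [/\ hilbert, unitary U, star_representation rep,
      forall f, Linfty f ->
        forall x, U (rep f x) = rep (fun z => f (z ^+ N)%g) (U x)
    & [/\ U phi = rep m0 phi,
      forall f, Linfty f ->
        inner phi (rep f phi) = haar_integral (fun z => f z * (h z)%:C)
    & hdense (span [set v | exists n f, Linfty f /\ iter n U v = rep f phi])]].

Definition commutant (U : H -> H) (rep : (circle R -> C) -> H -> H) :
    set (H -> H) :=
  [set S | [/\ bounded_op S,
     forall x, S (U x) = U (S x),
     forall V, adjoint U V -> forall x, S (V x) = V (S x)
   & forall f, Linfty f -> forall x, S (rep f x) = rep f (S x)]].

End Hilbert.

Section DirectSum.
Variables (R : realType) (I : finType) (H : I -> ipspace R).
Local Notation C := R[i].

Definition dsum_carrier := forall i, H i.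
HB.instance Definition _ := gen_eqMixin dsum_carrier.
HB.instance Definition _ := gen_choiceMixin dsum_carrier.

Definition dsum_add (x y : dsum_carrier) : dsum_carrier := fun i => x i + y i.
Definition dsum_opp (x : dsum_carrier) : dsum_carrier := fun i => - x i.
Definition dsum_zero : dsum_carrier := fun i => 0.
Definition dsum_scale (a : C) (x : dsum_carrier) : dsum_carrier :=
  fun i => a *: x i.

Lemma dsum_addA : associative dsum_add.
Proof. by move=> x y z; apply: functional_extensionality_dep => i;
exact: addrA. Qed.
Lemma dsum_addC : commutative dsum_add.
Proof. by move=> x y; apply: functional_extensionality_dep => i;
exact: addrC. Qed.
Lemma dsum_add0 : left_id dsum_zero dsum_add.
Proof. by move=> x; apply: functional_extensionality_dep => i;
exact: add0r. Qed.
Lemma dsum_addN : left_inverse dsum_zero dsum_opp dsum_add.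
Proof. by move=> x; apply: functional_extensionality_dep => i;
exact: addNr. Qed.

HB.instance Definition _ :=
  GRing.isZmodule.Build dsum_carrier dsum_addA dsum_addC dsum_add0 dsum_addN.

Lemma dsum_scaleA a b (x : dsum_carrier) :
  dsum_scale a (dsum_scale b x) = dsum_scale (a * b) x.
Proof. by apply: functional_extensionality_dep => i;
exact: scalerA. Qed.
Lemma dsum_scale1 : left_id 1 dsum_scale.
Proof. by move=> x; apply: functional_extensionality_dep => i;
exact: scale1r. Qed.
Lemma dsum_scaleDr : right_distributive dsum_scale +%R.
Proof.
by move=> a x y; apply: functional_extensionality_dep => i;
exact: scalerDr.
Qed.
Lemma dsum_scaleDl (x : dsum_carrier) : {morph dsum_scale^~ x : a b / a + b}.
Proof.
by move=> a b; apply: functional_extensionality_dep => i;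
exact: scalerDl.
Qed.

HB.instance Definition _ := GRing.Zmodule_isLmodule.Build C dsum_carrier
  dsum_scaleA dsum_scale1 dsum_scaleDr dsum_scaleDl.

Definition dsum : ipspace R :=
  @IPSpace R dsum_carrier (fun x y => \sum_i inner (x i) (y i)).

Definition dsum_op (S : forall i, H i -> H i) : dsum -> dsum :=
  fun x i => S i (x i).

End DirectSum.

Section L2.
Variable R : realType.
Local Notation C := R[i].
Local Notation mu := (@lebesgue_measure R).

Definition square_integrable : {pred R -> C} :=
  [pred f | ((fun x => Re (f x)) \in Lfun mu 2%:E) &&
            ((fun x => Im (f x)) \in Lfun mu 2%:E)].

Lemma complex_ReD (x y : C) : Re (x + y) = Re x + Re y.
Proof. by case: x y => ? ? []. Qed.
Lemma complex_ImD (x y : C) : Im (x + y) = Im x + Im y.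
Proof. by case: x y => ? ? []. Qed.

Lemma le1_2 : (1 <= 2%:E :> \bar R)%E. Proof. by rewrite lee_fin ler1n. Qed.

Lemma Lfun2_linear (a b : R) (f g : R -> R) :
  f \in Lfun mu 2%:E -> g \in Lfun mu 2%:E ->
  (fun x => a * f x + b * g x) \in Lfun mu 2%:E.
Proof.
move=> hf hg; have [h0 hD] := Lfun_submod_closed mu le1_2.
have hbg : b *: (g : R -> R) \in Lfun mu 2%:E.
  by have := hD b g 0 hg h0; rewrite addr0.
exact: hD.
Qed.

Lemma square_integrable_submod_closed : submod_closed square_integrable.
Proof.
have [h0 _] := Lfun_submod_closed mu le1_2.
split; first by apply/andP; split; exact: h0.
move=> [a b] f g /andP[fr fi] /andP[gr gi]; apply/andP; split.
  have -> : (fun x => Re ((Complex a b *: f + g) x)) =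
      (fun x => 1 * (a * Re (f x) + (- b) * Im (f x)) + 1 * Re (g x)).
    apply/funext => x; rewrite !mul1r complex_ReD mulNr; congr (_ + _).
    by rewrite /GRing.scale /= /GRing.scale /=; case: (f x).
  by apply: Lfun2_linear => //; apply: Lfun2_linear.
have -> : (fun x => Im ((Complex a b *: f + g) x)) =
    (fun x => 1 * (a * Im (f x) + b * Re (f x)) + 1 * Im (g x)).
  apply/funext => x; rewrite !mul1r complex_ImD; congr (_ + _).
  by rewrite /GRing.scale /= /GRing.scale /=; case: (f x).
by apply: Lfun2_linear => //; apply: Lfun2_linear.
Qed.

HB.instance Definition _ := GRing.isSubmodClosed.Build C (R -> C)
  square_integrable square_integrable_submod_closed.

Record L2fun := L2Fun {
  L2fun_val :> R -> C;
  _ : L2fun_val \in square_integrable }.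
HB.instance Definition _ := [isSub for L2fun_val].
HB.instance Definition _ := [Choice of L2fun by <:].
HB.instance Definition _ := [SubChoice_isSubLmodule of L2fun by <:].

Definition ae_null : {pred L2fun} :=
  [pred f | `[< {ae mu, forall x, (f : L2fun) x = 0} >]].

Lemma ae_null_submod_closed : submod_closed ae_null.
Proof.
split; first by apply/asboolP; exact: aeW.
move=> a f g /asboolP hf /asboolP hg; apply/asboolP.
move: hf hg; apply: (@filterS2 _ _ (ae_filter_ringOfSetsType mu)) => x fx gx.
change (a * f x + g x = 0).
by rewrite fx gx mulr0 addr0.
Qed.

HB.instance Definition _ := GRing.isSubmodClosed.Build C L2fun
  ae_null ae_null_submod_closed.

Definition L2 := Quotient.quot ae_null.
HB.instance Definition _ := Choice.on L2.
HB.instance Definition _ := EqQuotient.on L2.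
HB.instance Definition _ := GRing.Zmodule.on L2.

Definition L2scale (a : C) (x : L2) : L2 := \pi_L2 (a *: repr x).

Lemma pi_L2scale a (f : L2fun) : \pi_L2 (a *: f) = L2scale a (\pi_L2 f).
Proof.
apply/eqP; rewrite -Quotient.idealrBE -scalerBr rpredZ//.
by rewrite Quotient.idealrBE reprK.
Qed.

Lemma pi_L2add (f g : L2fun) : \pi_L2 (f + g) = \pi_L2 f + \pi_L2 g.
Proof. exact: Quotient.pi_add. Qed.

Lemma L2scaleA a b (x : L2) : L2scale a (L2scale b x) = L2scale (a * b) x.
Proof. by rewrite -[x]reprK -!pi_L2scale scalerA reprK. Qed.
Lemma L2scale1 : left_id 1 L2scale.
Proof. by move=> x; rewrite -[x]reprK -pi_L2scale scale1r. Qed.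
Lemma L2scaleDr : right_distributive L2scale +%R.
Proof.
move=> a x y; rewrite -[x]reprK -[y]reprK -pi_L2add -!pi_L2scale.
by rewrite scalerDr pi_L2add.
Qed.
Lemma L2scaleDl (x : L2) : {morph L2scale^~ x : a b / a + b}.
Proof.
by move=> a b; rewrite -[x]reprK -!pi_L2scale scalerDl pi_L2add.
Qed.

HB.instance Definition _ := GRing.Zmodule_isLmodule.Build C L2
  L2scaleA L2scale1 L2scaleDr L2scaleDl.

Definition fun_of_L2 (x : L2) : R -> C := repr x.
Coercion fun_of_L2 : L2 >-> Funclass.

(* Junk value 0 when [f] is not square integrable. *)
Definition toL2 (f : R -> C) : L2 := \pi_L2 (insubd (0 : L2fun) f).

Definition L2space : ipspace R := @IPSpace R L2 (fun x y : L2 =>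
  ((2 * pi)^-1)%:C * cintegral [set: R] (fun t => (x t)^* * y t)).

Definition U1 (N : nat) (x : L2space) : L2space :=
  toL2 (fun t => (Num.sqrt N%:R)%:C * (x : L2) (N%:R * t)).

Definition pi1 (f : circle R -> C) (x : L2space) : L2space :=
  toL2 (fun t => f (expi t) * (x : L2) t).

End L2.

Section Cycle.
Variables (R : realType) (N : nat) (m0 : circle R -> R[i]).
Variables (p : nat) (z : 'I_p -> circle R).
Local Notation C := R[i].

(* Indices run over 0, ..., p-1 and [ordS] is the cyclic successor. *)
Definition is_cycle : Prop :=
  [/\ (0 < p)%N, injective z, forall k, (z k ^+ N)%g = z (ordS k)
    & forall k, `|m0 (z k)| = (Num.sqrt N%:R)%:C].

Variable theta : 'I_p -> R.

Definition cycle_angles : Prop :=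
  forall k, m0 (z k) = (Num.sqrt N%:R)%:C * val (expi (theta k)).

Definition scaling_fun (k : 'I_p) (x : R) : C :=
  infinite_prod (fun l => val (expi (- \sum_j theta j)) *
    alpha (z k) (miter N p m0) (expi (x / N%:R ^+ (l * p))) /
    (Num.sqrt (N%:R ^+ p))%:C).

Definition cycle_space : ipspace R := dsum (fun _ : 'I_p => L2space R).

Definition cycle_U (x : cycle_space) : cycle_space :=
  fun k => val (expi (theta k)) *: U1 N (x (ordS k)).

Definition cycle_rep (f : circle R -> C) (x : cycle_space) : cycle_space :=
  fun k => pi1 (alpha (z k) f) (x k).

Definition cycle_phi : cycle_space := fun k => toL2 (scaling_fun k).

End Cycle.

(* Main.v *)
Require Import Defs.
From HB Require Import structures.
From mathcomp Require Import all_boot all_order all_algebra.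
From mathcomp Require Import all_classical all_reals all_analysis.
From mathcomp Require Import measurable_realfun.
From mathcomp.real_closed Require Import complex.
From mathcomp Require Import ring lra zify.


(** The proof rests on one identity: the squared scaling functions of all cycle
    points, periodized, add up to the constant [1].

    Call [Z u] the cycle points and [f u] their scaling functions.  Shifting the
    infinite product by one factor of [m0] gives the refinement equation
    [m0 (Z u e^(it)) * f u t = m0 (Z u) * f (su) (N t)], where [su] is the next
    point of the cycle ([scaling_refine]).  Let [h] be the sum of [|f u t|^2] over
    all lifts [(u, t)] of a point [w], that is, over all pairs with
    [w = Z u e^(it)].  Since [(u, t) |-> (su, N t)] is a bijection from the lifts
    of the [N]-th roots of [w] onto the lifts of [w], the refinement equation says
    that [h] is harmonic for the transfer operator ([lift_sum_transfer]).  Only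
    one lift lies in a small window around [0], where its value is at most [1];
    the operator is an average, so the bound [h <= 1] passes from a window to the
    [N] times larger one, hence to all lifts ([lift_sum_le1]).  Also
    [h (Z u) >= 1] because [f u 0 = 1].

    To prove [h = 1], use that [h] is lower semicontinuous, so that it attains
    its minimum on a closed set [M], and that by harmonicity every [N]-th root of
    a point of [M] at which [m0] does not vanish belongs to [M].  If [M] contains
    a point which is not periodic, its backward orbit meets the finitely many
    zeros of [m0] only finitely often, so some point of [M] has its whole
    backward orbit in [M]; such an orbit is dense and [M] is the circle.
    Otherwise every point of [M] is periodic; as the periodic [N]-th root of a
    periodic point is unique, [m0] vanishes at its other roots, hence
    [|m0|^2 = N] along the orbit, which is a cycle.  In both cases [M] contains a cycle point
    ([backward_closed_meets]), where [h >= 1] ([harm1]).  The cycle [{1}] is what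
    guarantees that there is a cycle point at all.

    The moments [<phi | pi(g) phi>] follow by unfolding integrals over the line
    ([periodization], [inner_phi_rep]).  For cyclicity it suffices to approximate
    a bounded compactly supported function placed in one component
    ([hsq_trunc], [sum_embed]).  A power of [U] moves it to a function carried by
    a tiny interval around [0] in a single component, where the scaling function
    is close to [1]: there it is almost of the form [pi(g) phi], with [g]
    supported in a small arc around one cycle point ([local_approximation],
    [embed_approx]).

    For the commutant, apply a high power of [U] to a vector of the [i]-th
    summand.  It becomes concentrated near the [i]-th cycle, so that the indicator
    of a neighbourhood of this cycle nearly fixes it, whereas it nearly kills
    the vectors of any other summand.  An operator which commutes with [U] and
    with this indicator therefore has no component from the [i]-th summand to
    another one ([commutant_block]), and its diagonal blocks are in the
    commutants of the summands. *)

Set Implicit Arguments.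
Unset Strict Implicit.
Unset Printing Implicit Defensive.
Import Order.TTheory GRing.Theory Num.Theory.
Import numFieldNormedType.Exports.
Local Open Scope classical_set_scope.
Local Open Scope ring_scope.

(** * Affine changes of variables for Lebesgue measure *)

Section AffineChange.
Variable R : realType.
Local Notation mu := (@lebesgue_measure R).
Local Open Scope ereal_scope.

Lemma measurable_affine (a b : R) :
  measurable_fun [set: R] (fun x : R => a * x + b : R)%R.
Proof.
exact: measurable_funD.
Qed.

Lemma preimage_affine_itv (a b x y : R) : (0 < a)%R ->
  (fun t : R => a * t + b : R)%R @^-1` `]x, y]%classic =
  `](x - b) / a, (y - b) / a]%classic%R.
Proof.
move=> a0; apply/seteqP; split => t /=; rewrite !in_itv/= => /andP[h1 h2].
  apply/andP; split; first by rewrite ltr_pdivrMr//; lra.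
  by rewrite ler_pdivlMr//; lra.
move: h1 h2; rewrite ltr_pdivrMr// ler_pdivlMr// => h1 h2.
by apply/andP; split; lra.
Qed.

(** The pushforward of Lebesgue measure under the affine map, rescaled by [a],
    agrees with Lebesgue measure on half-open intervals, and these determine it. *)
Lemma lebesgue_measure_affine (a b : R) (A : set R) : (0 < a)%R ->
  measurable A ->
  mu A = a%:E * mu ((fun t : R => a * t + b : R)%R @^-1` A).
Proof.
move=> a0 mA.
pose f : measurableTypeR R -> measurableTypeR R := fun t => (a * t + b)%R.
have mf : measurable_fun setT f by exact: measurable_affine.
pose a' : {nonneg R} := NngNum (ltW a0).
pose nu : {measure set (measurableTypeR R) -> \bar R} :=
  mscale a' (pushforward mu f).
suff : mu A = nu mf A by move=> ->; rewrite /nu /= /mscale/= /pushforward.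
apply: lebesgue_measure_unique => // X [[x y] _ <-].
rewrite /nu /= /mscale/= /pushforward preimage_affine_itv//.
rewrite !lebesgue_measure_itv/= !lte_fin.
have -> : (((x - b) / a < (y - b) / a) = (x < y))%R.
  by rewrite ltr_pM2r ?invr_gt0// ltrD2r.
case: ifPn => _; last by rewrite mule0.
rewrite -!EFinB -EFinM; congr EFin; field; exact: lt0r_neq0.
Qed.

Lemma ge0_integral_affine (a b : R) (g : R -> \bar R) : (0 < a)%R ->
  measurable_fun setT g -> (forall x, 0 <= g x) ->
  \int[mu]_x g x = a%:E * \int[mu]_x g (a * x + b)%R.
Proof.
move=> a0 mg g0.
pose f : measurableTypeR R -> measurableTypeR R := fun t => (a * t + b)%R.
have mf : measurable_fun setT f by exact: measurable_affine.
pose a' : {nonneg R} := NngNum (ltW a0).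
pose nu : {measure set (measurableTypeR R) -> \bar R} :=
  mscale a' (pushforward mu f).
rewrite (@eq_measure_integral _ _ _ setT (nu mf)); last first.
  by move=> A mA _; exact: (lebesgue_measure_affine b a0 mA).
rewrite /nu ge0_integral_mscale//; congr (_ * _).
by rewrite (@ge0_integral_pushforward _ _ _ _ _ f).
Qed.

Lemma ae_affine (a b : R) (P : R -> Prop) : (0 < a)%R ->
  {ae mu, forall x, P x} -> {ae mu, forall x, P (a * x + b)%R}.
Proof.
move=> a0 [A [mA A0 PA]].
pose f : measurableTypeR R -> measurableTypeR R := fun t => (a * t + b)%R.
have mf : measurable_fun setT f by exact: measurable_affine.
exists (f @^-1` A); split.
- by rewrite -[X in measurable X]setTI; exact: mf.
- have := lebesgue_measure_affine b a0 mA; rewrite A0 => /esym/eqP.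
  by rewrite mule_eq0 eqe gt_eqF//= => /eqP.
- by move=> x /= nP; apply: PA.
Qed.

End AffineChange.

(** * The circle and its parametrization *)

(** An enumeration of the integers, so that sums over translates by multiples of
   the period are ordinary series. *)
Definition zenum (n : nat) : int := if odd n then Negz n./2 else Posz n./2.

Definition zrank (j : int) : nat :=
  match j with Posz k => k.*2 | Negz k => k.*2.+1 end.

Lemma zrankK : cancel zrank zenum.
Proof.
by case=> k /=; rewrite /zenum/= ?odd_double/= ?doubleK// uphalf_double.
Qed.

Lemma zenumK : cancel zenum zrank.
Proof.
move=> n; rewrite /zenum; case: ifPn => /= on.
  by rewrite -[RHS]odd_double_half on add1n.
by rewrite -[RHS]odd_double_half (negbTE on).
Qed.

Section CircleFacts.
Variable R : realType.
Local Notation T := (circle R).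
Implicit Types (x y t : R) (z w : T).

Lemma circle_valM z w : val (z * w)%g = val z * val w.
Proof. by []. Qed.

Lemma circle_val1 : val (1%g : T) = 1.
Proof. by []. Qed.

Lemma circle_norm z : `|val z| = 1.
Proof. exact/eqP/(valP z). Qed.

Lemma circle_valX z n : val (z ^+ n)%g = val z ^+ n.
Proof.
elim: n => [|n IH]; first by rewrite expg0 expr0.
by rewrite expgS exprS circle_valM IH.
Qed.

Lemma circle_expgMn z w n : ((z * w) ^+ n = z ^+ n * w ^+ n)%g.
Proof. by apply: val_inj; rewrite /= !circle_valX/= exprMn. Qed.

Lemma circle_mulgI z : injective (fun w => (z * w)%g).
Proof.
move=> w w' /(congr1 val); rewrite !circle_valM => /mulfI.
by move/(_ (circle_val_neq0 z)) => /val_inj.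
Qed.

Lemma expi0 : expi 0 = 1%g :> T.
Proof. by apply: val_inj; rewrite /= cos0 sin0. Qed.

Lemma expiD x y : expi (x + y) = (expi x * expi y)%g.
Proof.
apply: val_inj; rewrite /= cosD sinD; congr Complex.
by rewrite addrC.
Qed.

Lemma expiMn x n : expi (n%:R * x) = (expi x ^+ n)%g.
Proof.
elim: n => [|n IH]; first by rewrite mul0r expi0 expg0.
by rewrite -natr1 mulrDl mul1r expiD IH expgSr.
Qed.

Lemma expi_2pi x : expi (x + 2 * pi) = expi x.
Proof.
by apply: val_inj; rewrite /= mulr_natl (cosD2pi x) (sinD2pi x).
Qed.

Lemma expi_periodic x (j : int) : expi (x + 2 * pi * j%:~R) = expi x.
Proof.
have H (n : nat) y : expi (y + 2 * pi * n%:R) = expi y.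
  elim: n y => [|n IH] y; first by rewrite mulr0 addr0.
  by rewrite -[n.+1]addn1 natrD mulrDr mulr1 addrA expi_2pi.
case: j => n; first exact: H.
by rewrite NegzE mulrNz mulrN -[LHS](H n.+1) -addrA addNr addr0.
Qed.

Lemma twopi_gt0 : 0 < 2 * pi :> R.
Proof. by rewrite mulr_gt0// pi_gt0. Qed.

Lemma expi_eq1 x : expi x = 1%g -> exists j : int, x = 2 * pi * j%:~R.
Proof.
move=> e.
have p0 := twopi_gt0.
pose j := Num.floor (x / (2 * pi)).
pose y := x - 2 * pi * j%:~R.
have ey : expi y = 1%g.
  by rewrite /y -mulrN -mulrNz expi_periodic.
have /andP[y0 y2] : 0 <= y < 2 * pi.
  have /andP[] := floor_itv (x / (2 * pi)).
  rewrite ler_pdivlMr// ltr_pdivrMr// intrD -/j => h1 h2.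
  by rewrite /y; apply/andP; split; lra.
exists j; apply/eqP; rewrite -subr_eq0 -/y; apply/eqP.
have c1 : cos y = 1 by move: ey => /(congr1 val)[].
have [ypi|ypi] := leP y pi.
  apply: cos_inj; rewrite ?in_itv/= ?y0 ?ypi ?lexx ?pi_ge0//.
  by rewrite cos0.
have : y - pi = pi.
  apply: cos_inj; rewrite ?in_itv/= ?lexx ?pi_ge0 ?andbT//.
    by apply/andP; split; lra.
  by rewrite cospi -c1 -[y in RHS](subrK pi) cosDpi opprK.
by move=> h; move: y2; rewrite -(subrK pi y) h mulr_natl mulr2n ltxx.
Qed.

Lemma expi_inj_lift x y : expi x = expi y -> exists j : int, x = y + 2 * pi * j%:~R.
Proof.
move=> e; have : expi (x - y) = 1%g.
  apply: (@circle_mulgI (expi y)); rewrite -expiD mulg1 addrC subrK.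
  exact: e.
by move=> /expi_eq1[j hj]; exists j; lra.
Qed.

Lemma expi_surj z : exists x, expi x = z.
Proof.
case: z => [[c s] cs1].
have cs : c ^+ 2 + s ^+ 2 = 1.
  move: (cs1); rewrite normc_def /= => /eqP/complexI h.
  by rewrite -[LHS]sqr_sqrtr ?addr_ge0 ?sqr_ge0// h expr1n.
have c1 : -1 <= c <= 1.
  by have s2 := sqr_ge0 s; apply/andP; split; nra.
have ec : cos (acos c) = c by rewrite acosK// in_itv.
have es : sin (acos c) = `|s|.
  by rewrite sin_acos// -sqrtr_sqr -cs addrC addKr.
have [s0|s0] := leP 0 s.
  exists (acos c); apply: val_inj; rewrite /= ec es ger0_norm//.
exists (- acos c); apply: val_inj; rewrite /= cosN sinN ec es ltr0_norm// opprK//.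
Qed.

(** The mean value theorem, as [|cos| <= 1]. *)
Lemma sin_norm_le x : `|sin x| <= `|x|.
Proof.
wlog x0 : x / 0 <= x => [H|].
  have [|/ltW x0] := leP 0 x; first exact: H.
  by rewrite -normrN -sinN -[leRHS]normrN; apply: H; rewrite oppr_ge0.
have sc : {within `[0, x], continuous (@sin R)}.
  by apply: continuous_subspaceT => t; exact: continuous_sin.
have [c _] := MVT_segment x0 (fun t _ => is_derive_sin t) sc.
rewrite sin0 !subr0 => ->.
by rewrite normrM ler_piMl// cos_max.
Qed.

(** A chord is shorter than its arc: the chord of angle [2u] has squared length
    [4 (sin u)^2]. *)
Lemma expi_lip x y : `|val (expi x) - val (expi y)| <= `|x - y|%:C.
Proof.
rewrite normc_def /= lecR -[leRHS]sqrtr_sqr ler_sqrt ?sqr_ge0//.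
have -> : (cos x - cos y) ^+ 2 + (sin x - sin y) ^+ 2 = 2 * (1 - cos (x - y)).
  have := cos2Dsin2 x; have := cos2Dsin2 y; rewrite cosB => h1 h2.
  apply/eqP; rewrite -subr_eq0; apply/eqP.
  transitivity ((cos x ^+ 2 + sin x ^+ 2) + (cos y ^+ 2 + sin y ^+ 2) - 2).
    by ring.
  by rewrite h1 h2; ring.
pose u := (x - y) / 2.
have -> : x - y = u *+ 2 by rewrite /u -mulr_natr mulfVK.
rewrite cos_mulr2n cos2sin2.
have : sin u ^+ 2 <= u ^+ 2.
  by rewrite -[leLHS]real_normK ?num_real// -[leRHS]real_normK ?num_real//
     lerXn2r ?nnegrE// sin_norm_le.
by rewrite !mulr2n; lra.
Qed.

End CircleFacts.

(** * Unfolding an integral over the line into an integral over a period *)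

Section Unfold.
Variable R : realType.
Local Notation mu := (@lebesgue_measure R).
Local Open Scope ereal_scope.

Lemma measurable_fun_affine d (T : measurableType d) (g : R -> T) (a b : R) :
  measurable_fun [set: R] g -> measurable_fun [set: R] (fun x : R => g (a * x + b)%R).
Proof.
move=> mg; exact: (measurableT_comp mg (measurable_affine a b)).
Qed.

Lemma ge0_integral_shift (b : R) (g : R -> \bar R) :
  measurable_fun setT g -> (forall x, 0 <= g x) ->
  \int[mu]_x g x = \int[mu]_x g (x + b)%R.
Proof.
move=> mg g0; rewrite (ge0_integral_affine b ltr01 mg g0) mul1e.
by apply: eq_integral => x _; rewrite mul1r.
Qed.

Lemma measurable_fun_shift d (T : measurableType d) (g : R -> T) (b : R) :
  measurable_fun [set: R] g -> measurable_fun [set: R] (fun x : R => g (x + b)%R).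
Proof.
move=> /(measurable_fun_affine 1 b) h.
congr (measurable_fun _ _) : h.
by apply/funext => x; rewrite mul1r.
Qed.

Definition period (j : int) : set R :=
  `[2 * pi * j%:~R, 2 * pi * (j + 1)%:~R[%classic%R.

Lemma period_shift (j : int) (x : R) :
  period j (x + 2 * pi * j%:~R)%R <-> `[0, 2 * pi[%classic%R x.
Proof.
rewrite /period/= !in_itv/= intrD.
by split=> /andP[h1 h2]; apply/andP; split; lra.
Qed.

Lemma period_floor (x : R) : period (Num.floor (x / (2 * pi))) x.
Proof.
have p0 := twopi_gt0 R.
rewrite /period/= in_itv/=.
have /andP[] := floor_itv (x / (2 * pi))%R.
by rewrite ler_pdivlMr// ltr_pdivrMr// !(mulrC (2 * pi)%R) => -> ->.
Qed.

Lemma period_inj (i j : int) x : period i x -> period j x -> i = j.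
Proof.
have p0 := twopi_gt0 R.
rewrite /period/= !in_itv/= => /andP[h1 h2] /andP[h3 h4].
have H (a b : int) : (2 * pi * a%:~R <= x)%R -> (x < 2 * pi * (b + 1)%:~R)%R ->
    (a <= b)%R.
  move=> ha hb; rewrite -ltzD1 -(ltr_int R) -(ltr_pM2l p0).
  exact: le_lt_trans ha hb.
by apply/eqP; rewrite eq_le !H.
Qed.

(** The line is the disjoint union of the translates of a period; translating
    each piece back turns the integral into that of the periodization. *)
Lemma ge0_integral_unfold (g : R -> \bar R) :
  measurable_fun setT g -> (forall x, 0 <= g x) ->
  \int[mu]_x g x =
  \int[mu]_(x in `[0%R, (2 * pi)%R])
    \sum_(n <oo) g (x + 2 * pi * (zenum n)%:~R)%R.
Proof.
move=> mg g0.
have mp j : measurable (period j) by exact: measurable_itv.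
have UT : \bigcup_n period (zenum n) = [set: R].
  apply/seteqP; split=> // x _; exists (zrank (Num.floor (x / (2 * pi)))) => //.
  by rewrite zrankK; exact: period_floor.
have ms n : measurable_fun [set: R]
    (fun x : R => g (x + 2 * pi * (zenum n)%:~R)%R).
  exact: measurable_fun_shift.
have tI : trivIset setT (fun n => period (zenum n)).
  by move=> i j _ _ [x [/= hi hj]]; rewrite -(zenumK i) (period_inj hi hj) zenumK.
rewrite -{1}UT ge0_integral_bigcup ?UT//; last by move=> k; exact: mp.
rewrite -integral_itv_bndo_bndc; last first.
  apply: measurable_funTS.
  exact: ge0_emeasurable_sum.
transitivity (\sum_(n <oo) \int[mu]_(x in `[0%R, (2 * pi)%R[)
    g (x + 2 * pi * (zenum n)%:~R)%R); last first.
  apply/esym/integral_nneseries => //.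
  by move=> n; exact: measurable_funTS (ms n).
apply: eq_eseriesr => n _.
rewrite integral_mkcond [RHS]integral_mkcond.
rewrite (ge0_integral_shift (2 * pi * (zenum n)%:~R)%R); last 2 first.
- by apply/(measurable_restrictT _ _).1 => //; apply: measurable_funTS.
- by move=> x; rewrite /patch; case: ifP.
apply: eq_integral => x _; rewrite /patch.
suff -> : ((x + 2 * pi * (zenum n)%:~R)%R \in period (zenum n)) =
  (x \in `[0, (2 * pi)%R[%classic%R) by [].
by apply/idP/idP; rewrite !inE => /period_shift.
Qed.

End Unfold.

(** * Square-integrable complex functions *)

Section ComplexFacts.
Variable R : realType.
Local Notation C := R[i].
Implicit Types (a b c : C).
Local Notation Re := complex.Re.
Local Notation Im := complex.Im.

(** The squared modulus as a real number; it is better behaved under integrals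
   than the modulus, which takes its values in the complex numbers. *)
Definition sqmod (a : C) : R := Re a ^+ 2 + Im a ^+ 2.

Lemma sqmod_ge0 a : 0 <= sqmod a.
Proof. by rewrite addr_ge0// sqr_ge0. Qed.

Lemma ReM a b : Re (a * b) = Re a * Re b - Im a * Im b.
Proof. by case: a b => ? ? []. Qed.

Lemma ImM a b : Im (a * b) = Re a * Im b + Im a * Re b.
Proof. by case: a b => ? ? []. Qed.

Lemma ReN a : Re (- a) = - Re a. Proof. by case: a. Qed.
Lemma ImN a : Im (- a) = - Im a. Proof. by case: a. Qed.
Lemma ReJ a : Re a^* = Re a. Proof. by case: a. Qed.
Lemma ImJ a : Im a^* = - Im a. Proof. by case: a. Qed.

Lemma complex_eq a b : Re a = Re b -> Im a = Im b -> a = b.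
Proof. by case: a b => ? ? [? ?] /= -> ->. Qed.

Lemma ReR (r : R) : Re r%:C = r. Proof. by []. Qed.
Lemma ImR (r : R) : Im r%:C = 0. Proof. by []. Qed.

Definition ReImE := (@complex_ReD R, @complex_ImD R, ReM, ImM, ReN, ImN, ReJ, ImJ,
  ReR, ImR).

Lemma ReZ (r : R) a : Re (r%:C * a) = r * Re a.
Proof. by rewrite !ReImE mul0r subr0. Qed.

Lemma ImZ (r : R) a : Im (r%:C * a) = r * Im a.
Proof. by rewrite !ReImE mul0r addr0. Qed.

Lemma cjD a b : (a + b)^* = a^* + b^*.
Proof. by apply: complex_eq; rewrite !ReImE// opprD. Qed.

Lemma cjM a b : (a * b)^* = a^* * b^*.
Proof. by apply: complex_eq; rewrite !ReImE; ring. Qed.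

Lemma cjN a : (- a)^* = - a^*.
Proof. by apply: complex_eq; rewrite !ReImE. Qed.

Lemma cjR (r : R) : (r%:C)^* = r%:C.
Proof. by apply: complex_eq; rewrite !ReImE// oppr0. Qed.

Lemma cj0 : (0 : C)^* = 0.
Proof. exact: (cjR 0). Qed.

Lemma sqmodM a b : sqmod (a * b) = sqmod a * sqmod b.
Proof. by rewrite /sqmod !ReImE; ring. Qed.

Lemma sqmodJ a : sqmod a^* = sqmod a.
Proof. by rewrite /sqmod !ReImE sqrrN. Qed.

Lemma sqmodN a : sqmod (- a) = sqmod a.
Proof. by rewrite /sqmod !ReImE !sqrrN. Qed.

Lemma sqmodR (r : R) : sqmod r%:C = r ^+ 2.
Proof. by rewrite /sqmod !ReImE expr0n addr0. Qed.

Lemma sqmod0 : sqmod 0 = 0.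
Proof. by rewrite /sqmod /= expr0n addr0. Qed.

Lemma sqmod1 : sqmod 1 = 1.
Proof. by rewrite /sqmod /= expr0n expr1n addr0. Qed.

Lemma sqmod_norm a : (sqmod a)%:C = `|a| ^+ 2.
Proof. exact: add_Re2_Im2. Qed.

Lemma normE_sqmod a : `|a| = (Num.sqrt (sqmod a))%:C.
Proof. exact: normc_def. Qed.

Lemma norm_le_sqmod a (M : R) : `|a| <= M%:C -> sqmod a <= M ^+ 2.
Proof.
rewrite normE_sqmod lecR => h; rewrite -[leLHS]sqr_sqrtr ?sqmod_ge0//.
by rewrite lerXn2r// ?nnegrE ?sqrtr_ge0// (le_trans _ h)// sqrtr_ge0.
Qed.

Lemma sqmod_le_norm a (M : R) : 0 <= M -> sqmod a <= M ^+ 2 -> `|a| <= M%:C.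
Proof.
move=> M0 h; rewrite normE_sqmod lecR -[leRHS]ger0_norm// -sqrtr_sqr.
by rewrite ler_sqrt// sqr_ge0.
Qed.

Lemma sqmod_eq0 a : sqmod a = 0 -> a = 0.
Proof.
move=> /eqP; rewrite paddr_eq0 ?sqr_ge0// !sqrf_eq0 => /andP[/eqP r /eqP i].
exact: complex_eq.
Qed.

Lemma sqmod_circle (z : circle R) : sqmod (val z) = 1.
Proof. by apply: complexI; rewrite sqmod_norm circle_norm expr1n. Qed.

Lemma sqmodD_le a b : sqmod (a + b) <= 2 * sqmod a + 2 * sqmod b.
Proof.
rewrite /sqmod !ReImE.
have := sqr_ge0 (Re a - Re b); have := sqr_ge0 (Im a - Im b).
rewrite !sqrrB !sqrrD !mulr2n; lra.
Qed.

Lemma conj_mulE a : a^* * a = (sqmod a)%:C.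
Proof. by apply: complex_eq; rewrite /sqmod !ReImE; ring. Qed.

Lemma Re_le_sqmod a : Re a ^+ 2 <= sqmod a.
Proof. by rewrite lerDl sqr_ge0. Qed.

Lemma Im_le_sqmod a : Im a ^+ 2 <= sqmod a.
Proof. by rewrite lerDr sqr_ge0. Qed.

End ComplexFacts.

Section AlmostEverywhere.
Variable R : realType.
Local Notation mu := (@lebesgue_measure R).
Implicit Types P Q S : R -> Prop.

Lemma aeS P Q : (forall x, P x -> Q x) ->
  {ae mu, forall x, P x} -> {ae mu, forall x, Q x}.
Proof. exact: (@filterS _ _ (ae_filter_ringOfSetsType mu)). Qed.

Lemma aeS2 P Q S : (forall x, P x -> Q x -> S x) ->
  {ae mu, forall x, P x} -> {ae mu, forall x, Q x} -> {ae mu, forall x, S x}.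
Proof. exact: (@filterS2 _ _ (ae_filter_ringOfSetsType mu)). Qed.

Lemma aeS3 P Q S (W : R -> Prop) : (forall x, P x -> Q x -> S x -> W x) ->
  {ae mu, forall x, P x} -> {ae mu, forall x, Q x} -> {ae mu, forall x, S x} ->
  {ae mu, forall x, W x}.
Proof. exact: (@filterS3 _ _ (ae_filter_ringOfSetsType mu)). Qed.

Lemma ae_and P Q : {ae mu, forall x, P x} -> {ae mu, forall x, Q x} ->
  {ae mu, forall x, P x /\ Q x}.
Proof. by apply: aeS2 => x; split. Qed.

Lemma ae_all P : (forall x, P x) -> {ae mu, forall x, P x}.
Proof. by move=> p; apply: aeW. Qed.

End AlmostEverywhere.

Section CMeasurable.
Variable R : realType.
Local Notation C := R[i].
Local Notation mu := (@lebesgue_measure R).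
Implicit Types (f g : R -> C).

Lemma cmeasurableM f g :
  cmeasurable f -> cmeasurable g -> cmeasurable (fun x => f x * g x).
Proof.
move=> [f1 f2] [g1 g2]; split.
  under eq_fun do rewrite ReM.
  by apply: measurable_funB; exact: measurable_funM.
under eq_fun do rewrite ImM.
by apply: measurable_funD; exact: measurable_funM.
Qed.

Lemma cmeasurableD f g :
  cmeasurable f -> cmeasurable g -> cmeasurable (fun x => f x + g x).
Proof.
move=> [f1 f2] [g1 g2]; split.
  under eq_fun do rewrite complex_ReD.
  exact: measurable_funD.
under eq_fun do rewrite complex_ImD.
exact: measurable_funD.
Qed.

Lemma cmeasurableJ f : cmeasurable f -> cmeasurable (fun x => (f x)^*).
Proof.
move=> [f1 f2]; split.
  by under eq_fun do rewrite ReJ.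
under eq_fun do rewrite ImJ.
exact: measurable_funN.
Qed.

Lemma cmeasurableB f g :
  cmeasurable f -> cmeasurable g -> cmeasurable (fun x => f x - g x).
Proof.
move=> [f1 f2] [g1 g2]; split.
  under eq_fun do rewrite complex_ReD ReN.
  exact: measurable_funB.
under eq_fun do rewrite complex_ImD ImN.
exact: measurable_funB.
Qed.

Lemma cmeasurable_cst (c : C) : cmeasurable (fun _ : R => c).
Proof. by split; exact: measurable_cst. Qed.

Lemma cmeasurable_affine f (a b : R) :
  cmeasurable f -> cmeasurable (fun x => f (a * x + b)).
Proof.
by move=> [f1 f2]; split;
  [exact: (measurable_fun_affine a b f1)|exact: (measurable_fun_affine a b f2)].
Qed.

Lemma measurable_sqmod f : cmeasurable f ->
  measurable_fun [set: R] (fun x => sqmod (f x)).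
Proof.
by move=> [f1 f2]; apply: measurable_funD; exact: measurable_funX.
Qed.

Lemma measurable_esqmod f : cmeasurable f ->
  measurable_fun [set: R] (fun x => (sqmod (f x))%:E).
Proof. by move=> mf; apply/measurable_EFinP; exact: measurable_sqmod. Qed.

End CMeasurable.

Section SquareIntegrable.
Variable R : realType.
Local Notation C := R[i].
Local Notation mu := (@lebesgue_measure R).
Implicit Types (f g : R -> C).
Local Notation Re := complex.Re.
Local Notation Im := complex.Im.

Lemma Lfun2E (h : R -> R) : (h \in Lfun mu 2%:E) <->
  measurable_fun [set: R] h /\ (\int[mu]_x (h x ^+ 2)%:E < +oo)%E.
Proof.
have E : (\int[mu]_x `|(EFin \o h) x| `^ 2 = \int[mu]_x (h x ^+ 2)%:E)%E.
  apply: eq_integral => x _ /=.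
  by rewrite powR_mulrn// real_normK// num_real.
split.
  move=> h2; split; first by move: h2 => /andP[/[!inE]].
  have /integrableP[_] := Lfun2_integrable_sqr h2.
  under eq_integral do rewrite /= ger0_norm ?sqr_ge0//.
  by [].
move=> [mh h2]; apply/andP; split; first by rewrite inE.
rewrite inE /= /finite_norm unlock /Lnorm E.
exact: poweR_lty.
Qed.

(** It takes values in the extended reals, so that it can be manipulated before
    square-integrability is known. *)
Definition energy f : \bar R := (\int[mu]_x (sqmod (f x))%:E)%E.

Lemma energy_ge0 f : (0 <= energy f)%E.
Proof. by apply: integral_ge0 => x _; rewrite lee_fin sqmod_ge0. Qed.

Lemma square_integrableP f :
  (f \in @square_integrable R) <-> cmeasurable f /\ (energy f < +oo)%E.
Proof.
have E : cmeasurable f -> energy f =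
    (\int[mu]_x ((Re (f x)) ^+ 2)%:E + \int[mu]_x ((Im (f x)) ^+ 2)%:E)%E.
  move=> [m1 m2]; rewrite -ge0_integralD//.
  - by move=> x _; rewrite lee_fin sqr_ge0.
  - by apply/measurable_EFinP; exact: measurable_funX.
  - by move=> x _; rewrite lee_fin sqr_ge0.
  - by apply/measurable_EFinP; exact: measurable_funX.
split.
  move=> /andP[/Lfun2E[m1 e1] /Lfun2E[m2 e2]].
  by have mf : cmeasurable f by []; split=> //; rewrite E// lte_add_pinfty.
move=> [mf]; rewrite E// => h; apply/andP; split; apply/Lfun2E; split.
- exact: mf.1.
- apply: le_lt_trans h; rewrite leeDl// integral_ge0// => x _.
  by rewrite lee_fin sqr_ge0.
- exact: mf.2.
- apply: le_lt_trans h; rewrite leeDr// integral_ge0// => x _.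
  by rewrite lee_fin sqr_ge0.
Qed.

Lemma le_energy f g (k : R) : (0 <= k) -> cmeasurable f -> cmeasurable g ->
  {ae mu, forall x, sqmod (f x) <= k * sqmod (g x)} ->
  (energy f <= k%:E * energy g)%E.
Proof.
move=> k0 mf mg fg; rewrite /energy -ge0_integralZl//.
- apply: ae_ge0_le_integral => //.
  + by move=> x _; rewrite lee_fin sqmod_ge0.
  + exact: measurable_esqmod.
  + by move=> x _; rewrite lee_fin mulr_ge0// sqmod_ge0.
  + by apply/measurable_EFinP/measurable_funM => //; exact: measurable_sqmod.
  + by apply: aeS fg => x fg _; rewrite -EFinM lee_fin.
- exact: measurable_esqmod.
- by move=> x _; rewrite lee_fin sqmod_ge0.
Qed.

Lemma ae_eq_energy f g : cmeasurable f -> cmeasurable g ->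
  {ae mu, forall x, f x = g x} -> energy f = energy g.
Proof.
move=> mf mg fg; apply: ge0_ae_eq_integral => //.
- exact: measurable_esqmod.
- exact: measurable_esqmod.
- by move=> x _; rewrite lee_fin sqmod_ge0.
- by move=> x _; rewrite lee_fin sqmod_ge0.
- by apply: aeS fg => x -> _.
Qed.

Lemma energyD_le f g : cmeasurable f -> cmeasurable g ->
  (energy (fun x => f x + g x)%R <= 2%:E * energy f + 2%:E * energy g)%E.
Proof.
move=> mf mg; rewrite /energy -!ge0_integralZl//; last 4 first.
- exact: measurable_esqmod.
- by move=> x _; rewrite lee_fin sqmod_ge0.
- exact: measurable_esqmod.
- by move=> x _; rewrite lee_fin sqmod_ge0.
rewrite -ge0_integralD//; last 4 first.
- by move=> x _; rewrite lee_fin mulr_ge0// sqmod_ge0.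
- by apply/measurable_EFinP/measurable_funM => //; exact: measurable_sqmod.
- by move=> x _; rewrite lee_fin mulr_ge0// sqmod_ge0.
- by apply/measurable_EFinP/measurable_funM => //; exact: measurable_sqmod.
apply: ge0_le_integral => //.
- by move=> x _; rewrite lee_fin sqmod_ge0.
- by apply: measurable_esqmod; exact: cmeasurableD.
- by apply: emeasurable_funD; apply/measurable_EFinP/measurable_funM => //;
    exact: measurable_sqmod.
- by move=> x _; rewrite -!EFinM -EFinD lee_fin sqmodD_le.
Qed.

Lemma energy_affine f (a b : R) : 0 < a -> cmeasurable f ->
  energy f = (a%:E * energy (fun x => f (a * x + b)%R))%E.
Proof.
move=> a0 mf; apply: (@ge0_integral_affine R a b (fun x => (sqmod (f x))%:E)) => //.
  exact: measurable_esqmod.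
by move=> x; rewrite lee_fin sqmod_ge0.
Qed.

Lemma energyZ f (c : C) : cmeasurable f ->
  energy (fun x => c * f x) = ((sqmod c)%:E * energy f)%E.
Proof.
move=> mf; rewrite /energy -ge0_integralZl ?lee_fin ?sqmod_ge0//.
- by apply: eq_integral => x _; rewrite sqmodM EFinM.
- exact: measurable_esqmod.
- by move=> x _; rewrite lee_fin sqmod_ge0.
Qed.

End SquareIntegrable.

(** * The Hilbert space of square-integrable functions *)

Section L2Elements.
Variable R : realType.
Local Open Scope quotient_scope.
Local Notation C := R[i].
Local Notation mu := (@lebesgue_measure R).
Local Notation Re := complex.Re.
Local Notation Im := complex.Im.
Implicit Types (f g : R -> C) (x y : L2 R).

Lemma L2_square_integrable x : (x : R -> C) \in @square_integrable R.
Proof. exact: (valP (repr x)). Qed.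

Lemma L2_cmeasurable x : cmeasurable x.
Proof. by have /square_integrableP[] := L2_square_integrable x. Qed.

Lemma L2_energy x : (energy x < +oo)%E.
Proof. by have /square_integrableP[] := L2_square_integrable x. Qed.

Lemma pi_L2_ae (f : L2fun R) :
  {ae mu, forall t, (\pi_(L2 R) f : L2 R) t = f t}.
Proof.
have : repr (\pi_(L2 R) f) - f \in @ae_null R.
  by rewrite Quotient.idealrBE reprK.
move=> /asboolP; apply: aeS => t.
change ((repr (\pi_(L2 R) f) : L2fun R) t - f t = 0 ->
  (repr (\pi_(L2 R) f) : L2fun R) t = f t).
by move=> /eqP; rewrite subr_eq0 => /eqP.
Qed.

Lemma toL2K f : f \in @square_integrable R ->
  {ae mu, forall t, (toL2 f : L2 R) t = f t}.
Proof.
move=> hf; have := pi_L2_ae (insubd (0 : L2fun R) f).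
by apply: aeS => t; rewrite -/(toL2 f) => ->; rewrite (insubdK _ hf).
Qed.

Lemma L2_eq x y : {ae mu, forall t, x t = y t} -> x = y.
Proof.
move=> xy; rewrite -[x]reprK -[y]reprK; apply/eqP.
rewrite -Quotient.idealrBE; apply/asboolP.
apply: aeS xy => t e.
change ((repr x : L2fun R) t - (repr y : L2fun R) t = 0).
by apply/eqP; rewrite subr_eq0; apply/eqP.
Qed.

Lemma L2D_ae x y : {ae mu, forall t, (x + y : L2 R) t = x t + y t}.
Proof.
have -> : x + y = \pi_(L2 R) (repr x + repr y) by rewrite pi_L2add !reprK.
exact: pi_L2_ae.
Qed.

Lemma L2Z_ae (a : C) x : {ae mu, forall t, (a *: x : L2 R) t = a * x t}.
Proof. exact: (pi_L2_ae (a *: repr x)). Qed.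

Lemma L2B_ae x y : {ae mu, forall t, (x - y : L2 R) t = x t - y t}.
Proof.
have := L2Z_ae (-1) y; rewrite scaleN1r => h.
by apply: aeS2 (L2D_ae x (- y)) h => t -> ->; rewrite mulN1r.
Qed.

Lemma L2_0_ae : {ae mu, forall t, (0 : L2 R) t = 0}.
Proof.
have -> : (0 : L2 R) = 0 *: 0 by rewrite scale0r.
by apply: aeS (L2Z_ae 0 0) => t ->; rewrite mul0r.
Qed.

End L2Elements.

Section L2Inner.
Variable R : realType.
Local Notation C := R[i].
Local Notation mu := (@lebesgue_measure R).
Local Notation Re := complex.Re.
Local Notation Im := complex.Im.
Implicit Types (f g : R -> C) (x y z : L2 R).

Let rintegrableD (h k : R -> R) : mu.-integrable setT (EFin \o h) ->
  mu.-integrable setT (EFin \o k) ->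
  mu.-integrable setT (EFin \o (fun t => h t + k t)).
Proof. by move=> ih ik; exact: (integrableD measurableT ih ik). Qed.

Let rintegrableB (h k : R -> R) : mu.-integrable setT (EFin \o h) ->
  mu.-integrable setT (EFin \o k) ->
  mu.-integrable setT (EFin \o (fun t => h t - k t)).
Proof. by move=> ih ik; exact: (integrableB measurableT ih ik). Qed.

Definition cintegrable f :=
  mu.-integrable setT (EFin \o (fun t => Re (f t))) /\
  mu.-integrable setT (EFin \o (fun t => Im (f t))).

Lemma cintegrable_measurable f : cintegrable f -> cmeasurable f.
Proof.
by move=> [/measurable_int/measurable_EFinP f1 /measurable_int/measurable_EFinP f2].
Qed.

Lemma cintegral_linear (a : C) f g : cintegrable f -> cintegrable g ->
  cintegral setT (fun t => a * f t + g t) =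
  a * cintegral setT f + cintegral setT g.
Proof.
move=> [f1 f2] [g1 g2].
have iZ (h : R -> R) c : mu.-integrable setT (EFin \o h) ->
    mu.-integrable setT (EFin \o (fun t => c * h t)).
  by move=> ih; have := integrableZl measurableT c ih.
apply: complex_eq; rewrite /cintegral /=.
  under eq_Rintegral do rewrite !ReImE.
  rewrite RintegralD//; last by apply: rintegrableB => //; apply: iZ.
  rewrite RintegralB//; try exact: iZ.
  by rewrite !RintegralZl//= complex_ReD ReM.
under eq_Rintegral do rewrite !ReImE.
rewrite RintegralD//; last by apply: rintegrableD => //; apply: iZ.
rewrite RintegralD//; try exact: iZ.
by rewrite !RintegralZl//= complex_ImD ImM.
Qed.

Lemma eq_cintegral f g : cmeasurable f -> cmeasurable g ->
  {ae mu, forall t, f t = g t} -> cintegral setT f = cintegral setT g.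
Proof.
move=> [f1 f2] [g1 g2] fg; rewrite /cintegral /Rintegral.
by congr Complex; congr fine; apply: ae_eq_integral => //;
  try exact/measurable_EFinP; apply: aeS fg => t -> _.
Qed.

Lemma cintegralJ f : cintegrable f ->
  cintegral setT (fun t => (f t)^*) = (cintegral setT f)^*.
Proof.
move=> [f1 f2]; apply: complex_eq; rewrite /cintegral ?ReJ ?ImJ/=.
  by under eq_Rintegral do rewrite ReJ.
under eq_Rintegral do rewrite ImJ -mulN1r.
by rewrite RintegralZl// mulN1r.
Qed.

Lemma cintegrable_mul f g : f \in @square_integrable R ->
  g \in @square_integrable R -> cintegrable (fun t => (f t)^* * g t).
Proof.
move=> /andP[f1 f2] /andP[g1 g2].
have H (h k : R -> R) : h \in Lfun mu 2%:E -> k \in Lfun mu 2%:E ->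
    mu.-integrable setT (EFin \o (fun t => h t * k t)).
  by move=> hh hk; apply/Lfun1_integrable; exact: Lfun2_mul_Lfun1.
split.
  under eq_fun do rewrite !ReImE mulNr opprK.
  by apply: rintegrableD; exact: H.
under eq_fun do rewrite !ReImE mulNr.
by apply: rintegrableB; exact: H.
Qed.

Lemma cintegral_sqmod f : f \in @square_integrable R ->
  cintegral setT (fun t => (f t)^* * f t) = (fine (energy f))%:C.
Proof.
move=> hf; apply: complex_eq; rewrite /cintegral/=.
  by under eq_Rintegral do rewrite conj_mulE ReR.
under eq_Rintegral do rewrite conj_mulE ImR.
by rewrite Rintegral_cst// mul0r.
Qed.

Lemma inner_L2E x y : @inner R (L2space R) x y =
  ((2 * pi)^-1)%:C * cintegral setT (fun t => (x t)^* * y t).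
Proof. by []. Qed.

Lemma inner_L2_sq x : @inner R (L2space R) x x = ((2 * pi)^-1 * fine (energy x))%:C.
Proof.
by rewrite inner_L2E (cintegral_sqmod (L2_square_integrable x)) -rmorphM.
Qed.

Lemma energyE x : energy x = (2 * pi * Re (@inner R (L2space R) x x))%:E.
Proof.
rewrite inner_L2_sq ReR mulrA mulfV ?mul1r; last exact/lt0r_neq0/twopi_gt0.
by rewrite fineK// ge0_fin_numE ?energy_ge0 ?L2_energy.
Qed.

Lemma inner_L2_linear x (a : C) y z :
  @inner R (L2space R) x (a *: y + z) =
  a * @inner R (L2space R) x y + @inner R (L2space R) x z.
Proof.
have sx := L2_square_integrable x; have sy := L2_square_integrable y.
have sz := L2_square_integrable z.
rewrite !inner_L2E mulrCA -mulrDr; congr (_ * _).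
rewrite -cintegral_linear; [|exact: cintegrable_mul..].
apply: eq_cintegral.
- apply/cintegrable_measurable/cintegrable_mul => //.
  exact: L2_square_integrable.
- apply: cmeasurableD; last exact/cintegrable_measurable/cintegrable_mul.
  apply: cmeasurableM; first exact: cmeasurable_cst.
  exact/cintegrable_measurable/cintegrable_mul.
- apply: aeS2 (L2D_ae (a *: y) z) (L2Z_ae a y) => t -> ->.
  by rewrite mulrDr mulrCA.
Qed.

Lemma inner_L2_sym x y :
  @inner R (L2space R) y x = (@inner R (L2space R) x y)^*.
Proof.
have sx := L2_square_integrable x; have sy := L2_square_integrable y.
rewrite !inner_L2E rmorphM; congr (_ * _).
  by apply: complex_eq; rewrite ?ReJ ?ImJ ?ImR ?oppr0.
apply: (etrans _ (cintegralJ (cintegrable_mul sx sy))).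
congr (cintegral _ _); apply/funext => t.
by apply: complex_eq; rewrite !ReImE; ring.
Qed.

Lemma energy0_eq0 x : energy x = 0%E -> x = 0.
Proof.
move=> e0; apply: L2_eq.
have := (ae_eq_integral_abs mu measurableT (measurable_esqmod (L2_cmeasurable x))).1.
have -> : (\int[mu]_(t in setT) `|(sqmod (x t))%:E|)%E = energy x.
  by apply: eq_integral => t _; rewrite gee0_abs// lee_fin sqmod_ge0.
move=> /(_ e0); rewrite /ae_eq => h.
apply: aeS2 h (L2_0_ae R) => t /(_ I) [] /sqmod_eq0 -> ->//.
Qed.

End L2Inner.

(** ** Completeness *)

Section L2Complete.
Variable R : realType.
Local Notation C := R[i].
Local Notation mu := (@lebesgue_measure R).
Local Notation Re := complex.Re.
Local Notation Im := complex.Im.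
Implicit Types (f g : R -> C) (x y z : L2 R).

Lemma geometric_cvg (v : nat -> R) (b : R) : 0 <= b ->
  (forall k, `|v k.+1 - v k| <= b * 2^-1 ^+ k) -> cvgn v.
Proof.
move=> b0 vb.
have -> : v = (fun n => v 0%N + series (telescope v) n).
  by apply/funext => n; rewrite -eq_sum_telescope.
apply: is_cvgD; first exact: is_cvg_cst.
apply: normed_cvg.
apply: (@series_le_cvg _ _ (geometric b 2^-1)).
- by move=> n; exact: normr_ge0.
- by move=> n; rewrite /= mulr_ge0// exprn_ge0// invr_ge0.
- by move=> n; exact: vb.
- by apply: is_cvg_geometric_series; rewrite ger0_norm ?invr_ge0// invf_lt1// ltr1n.
Qed.

Lemma energyB_L2 x y : energy (x - y : L2 R) = energy (fun t => x t - y t).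
Proof.
apply: ae_eq_energy (L2B_ae x y); first exact: L2_cmeasurable.
by apply: cmeasurableB; exact: L2_cmeasurable.
Qed.

Lemma fatou_energy (w : nat -> R -> C) f (e : \bar R) :
  (forall k, cmeasurable (w k)) ->
  (forall t, (fun k => Re (w k t)) @ \oo --> Re (f t)) ->
  (forall t, (fun k => Im (w k t)) @ \oo --> Im (f t)) ->
  (forall k, (energy (w k) <= e)%E) -> (energy f <= e)%E.
Proof.
move=> mw wr wi we.
have E t : ((sqmod (f t))%:E = limn_einf (fun k => (sqmod (w k t))%:E))%E.
  apply/esym; apply: (cvg_limn_einf_sup _).1; apply: cvg_EFin; first exact: nearW.
  apply: (@cvgD _ _ _ _ _ (fun k => Re (w k t) ^+ 2) (fun k => Im (w k t) ^+ 2)).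
    by under eq_fun do rewrite expr2; rewrite expr2; apply: cvgM.
  by under eq_fun do rewrite expr2; rewrite expr2; apply: cvgM.
rewrite /energy; under eq_integral do rewrite E.
have h := @fatou _ _ _ mu setT measurableT (fun k t => (sqmod (w k t))%:E)
  (fun k => measurable_esqmod (mw k)).
apply: (le_trans (h _)); first by move=> n t _; rewrite lee_fin sqmod_ge0.
rewrite limn_einf_lim; apply: lime_le; first exact: is_cvg_einfs.
apply: nearW => k; apply: (le_trans _ (we k)).
by apply: ereal_inf_lbound; exists k => /=.
Qed.

(** A subsequence whose consecutive differences [d k] have energy at most
    [8^-k] converges almost everywhere; Fatou's lemma makes its pointwise limit a
    limit in energy of the whole sequence. *)
Lemma L2_complete (u : nat -> L2 R) :
  (forall e : R, 0 < e -> exists M, forall m n, (M <= m)%N -> (M <= n)%N ->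
     (energy (fun t => (u m t - u n t)%R) <= e%:E)%E) ->
  exists l : L2 R, forall e : R, 0 < e -> exists M, forall n, (M <= n)%N ->
     (energy (fun t => (l t - u n t)%R) <= e%:E)%E.
Proof.
move=> cu.
have mB := @cmeasurableB R.
have mu_ n : cmeasurable (u n) by exact: L2_cmeasurable.
have e8 k : 0 < 8^-1 ^+ k :> R by rewrite exprn_gt0// invr_gt0.
have [M Mu] := choice (fun k => cu _ (e8 k)).
pose s k := (k + \sum_(i < k.+1) M i)%N.
have sM k : (M k <= s k)%N.
  by rewrite /s big_ord_recr/= addnA leq_addl.
have sS k : (s k <= s k.+1)%N.
  by rewrite /s [X in (_ <= _ + X)%N]big_ord_recr/= addSn leqW// addnA leq_addr.
have sk k : (k <= s k)%N by exact: leq_addr.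
pose d k t := u (s k.+1) t - u (s k) t.
have md k : cmeasurable (d k) by exact: mB.
have de k : (energy (d k) <= (8^-1 ^+ k)%:E)%E.
  by apply: Mu => //; exact: leq_trans (sM k) (sS k).
(* With energies at most [8^-k], the weights [4^k] keep the integral of [B]
   finite, and [B t < +oo] bounds [|d k t|] by a multiple of [2^-k]. *)
pose B t : \bar R := (\sum_(k <oo) (4 ^+ k * sqmod (d k t))%:E)%E.
have Bt0 k t : (0 <= (4 ^+ k * sqmod (d k t))%:E)%E.
  by rewrite lee_fin mulr_ge0// ?sqmod_ge0// exprn_ge0.
have mBk k : measurable_fun [set: R] (fun t => (4 ^+ k * sqmod (d k t))%:E).
  by apply/measurable_EFinP/measurable_funM => //; exact: measurable_sqmod.
have mBB : measurable_fun [set: R] B.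
  exact: ge0_emeasurable_sum.
have B0 t : (0 <= B t)%E by exact: nneseries_ge0.
have iB : mu.-integrable setT B.
  apply/integrableP; split=> //.
  under eq_integral do rewrite gee0_abs//.
  rewrite (@integral_nneseries _ _ _ mu setT measurableT
    (fun k t => (4 ^+ k * sqmod (d k t))%:E))//.
  apply: (@le_lt_trans _ _ (\sum_(k <oo) (2^-1 ^+ k)%:E)%E).
    apply: lee_nneseries => [k * |k *].
      by apply: integral_ge0 => t _; exact: Bt0.
    have -> : (\int[mu]_t (4 ^+ k * sqmod (d k t))%:E = (4 ^+ k)%:E * energy (d k))%E.
      rewrite -ge0_integralZl ?lee_fin ?exprn_ge0//; first exact: measurable_esqmod.
      by move=> t _; rewrite lee_fin sqmod_ge0.
    apply: (@le_trans _ _ ((4 ^+ k)%:E * (8^-1 ^+ k)%:E)%E).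
      by rewrite lee_pmul2l// lte_fin exprn_gt0.
    rewrite -EFinM lee_fin -exprMn (_ : 4 * 8^-1 = 2^-1 :> R)//.
    by field.
  have h : (fun n => (\sum_(0 <= k < n) (2^-1 ^+ k)%:E)%E) @ \oo --> (2%:E : \bar R).
    rewrite (_ : (fun n => _) = EFin \o series (geometric 1 (2^-1 : R))); last first.
      apply/funext => n; rewrite /= sumEFin /series/=; congr EFin.
      by apply: eq_bigr => i _; rewrite mul1r.
    apply: cvg_EFin; first exact: nearW.
    rewrite [X in _ --> X](_ : _ = 1 * (1 - 2^-1)^-1); last by field.
    by apply: cvg_geometric_series; rewrite ger0_norm ?invr_ge0// invf_lt1// ltr1n.
  by rewrite (cvg_lim _ h)// ltry.
have Bae := integrable_ae measurableT iB.
pose A := [set t | B t \is a fin_num].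
have mA : measurable A.
  by have := emeasurable_fin_num measurableT mBB; rewrite setTI.
have Aae : {ae mu, forall t, A t} by apply: aeS Bae => t; exact.
(* Truncating to [A] makes the sequence converge everywhere, as needed for the
   measurability of the limit. *)
pose w k t : C := (\1_A t : R)%:C * u (s k) t.
have mw k : cmeasurable (w k).
  apply: cmeasurableM => //; split; last exact: measurable_cst.
  exact: measurable_indic.
have dB t : A t -> exists2 b : R, 0 <= b &
    forall k, sqmod (d k t) <= b ^+ 2 * (2^-1 ^+ k) ^+ 2.
  move=> At; exists (Num.sqrt (fine (B t))); first exact: sqrtr_ge0.
  move=> k; rewrite sqr_sqrtr ?fine_ge0//.
  have : ((4 ^+ k * sqmod (d k t))%:E <= B t)%E.
    by rewrite /B (@nneseriesD1 _ _ k)// leeDl// nneseries_ge0.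
  rewrite -(fineK At) lee_fin => h.
  rewrite -exprM mulnC exprM (_ : 2^-1 ^+ 2 = 4^-1 :> R); last by field.
  by rewrite exprVn ler_pdivlMr ?exprn_gt0// mulrC.
have abs_le (r b c : R) : 0 <= b -> 0 <= c -> r ^+ 2 <= b ^+ 2 * c ^+ 2 -> `|r| <= b * c.
  move=> b0 c0 h; rewrite -(ger0_norm (mulr_ge0 b0 c0)) -!sqrtr_sqr.
  by rewrite ler_sqrt ?sqr_ge0// exprMn.
have cw t : cvgn (fun k => Re (w k t)) /\ cvgn (fun k => Im (w k t)).
  have [At|nAt] := pselect (A t); last first.
    rewrite /w; split; under eq_fun do rewrite indicE memNset// mul0r;
    exact: is_cvg_cst.
  have [b b0 db] := dB t At.
  rewrite /w; split; under eq_fun do rewrite indicE mem_set// mul1r.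
    apply: (@geometric_cvg _ b) => // k; apply: abs_le => //.
    apply: le_trans (db k); apply: le_trans (Re_le_sqmod _).
    by rewrite /d complex_ReD ReN.
  apply: (@geometric_cvg _ b) => // k; apply: abs_le => //.
  apply: le_trans (db k); apply: le_trans (Im_le_sqmod _).
  by rewrite /d complex_ImD ImN.
pose f t : C := Complex (limn (fun k => Re (w k t))) (limn (fun k => Im (w k t))).
have mf : cmeasurable f.
  split.
    apply: (measurable_fun_cvg (fun k => (mw k).1)) => t _; exact: (cw t).1.
  apply: (measurable_fun_cvg (fun k => (mw k).2)) => t _; exact: (cw t).2.
have fe e : 0 < e -> exists K, forall n, (K <= n)%N ->
    (energy (fun t => (f t - u n t)%R) <= e%:E)%E.
  move=> e0; have [K Ku] := cu e e0; exists K => n Kn.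
  apply: (@fatou_energy (fun k t => w (k + K)%N t - u n t)).
  - by move=> k; exact: mB.
  - move=> t; rewrite complex_ReD; under eq_fun do rewrite complex_ReD.
    apply: cvgD; last exact: cvg_cst.
    by have := (cw t).1; rewrite -(cvg_shiftn K).
  - move=> t; rewrite complex_ImD; under eq_fun do rewrite complex_ImD.
    apply: cvgD; last exact: cvg_cst.
    by have := (cw t).2; rewrite -(cvg_shiftn K).
  - move=> k; rewrite (@ae_eq_energy _ _ (fun t => u (s (k + K)%N) t - u n t)).
    + by apply: Ku => //; apply: leq_trans (sk _); rewrite leq_addl.
    + exact: mB.
    + exact: mB.
    + by apply: aeS Aae => t At; rewrite /w indicE mem_set// mul1r.
have sf : f \in @square_integrable R.
  apply/square_integrableP; split=> //.
  have [K fK] := fe 1 ltr01.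
  have -> : f = (fun t => (f t - u K t) + u K t).
    by apply/funext => t; rewrite subrK.
  apply: le_lt_trans (energyD_le (mB _ _ mf (mu_ K)) (mu_ K)) _.
  apply: lte_add_pinfty; apply: lte_mul_pinfty => //; last exact: L2_energy.
  by rewrite (le_lt_trans (fK K _))// ltry.
exists (toL2 f) => e /fe[K fK]; exists K => n Kn.
rewrite (@ae_eq_energy _ _ (fun t => f t - u n t)); first exact: fK.
- by apply: mB => //; exact: L2_cmeasurable.
- exact: mB.
- by apply: aeS (toL2K sf) => t ->.
Qed.

End L2Complete.

(** * Hilbert spaces and finite direct sums *)

Lemma linear_0 (K : nzRingType) (V V' : lmodType K) (f : V -> V') :
  linear f -> f 0 = 0.
Proof. by move=> lf; have := lf (-1) 0 0; rewrite addr0 !scaleN1r oppr0 addNr. Qed.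

Section InnerProduct.
Variables (R : realType) (H : ipspace R).
Local Notation C := R[i].
Local Notation Re := complex.Re.
Local Notation Im := complex.Im.
Implicit Types (x y z : H) (a : C).

Definition hsq x : R := Re (inner x x).

(** Squared norms are additive over direct sums and are what integrals compute,
    so completeness is handled in this form. *)
Definition sq_complete : Prop := forall u : nat -> H,
  (forall e : R, 0 < e -> exists M, forall m n, (M <= m)%N -> (M <= n)%N ->
     hsq (u m - u n) <= e) ->
  exists l, forall e : R, 0 < e -> exists M, forall n, (M <= n)%N ->
     hsq (u n - l) <= e.

Lemma hnorm_lt x (e : R) : 0 < e -> (hnorm x < e) = (hsq x < e ^+ 2).
Proof.
move=> e0; rewrite -[in LHS](ger0_norm (ltW e0)) -sqrtr_sqr /hnorm.
by rewrite ltr_sqrt// exprn_gt0.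
Qed.

Lemma sq_complete_hnorm : sq_complete -> forall u : nat -> H,
  (forall e : R, 0 < e -> exists M, forall m n,
    (M <= m)%N -> (M <= n)%N -> hnorm (u m - u n) < e) ->
  exists l, (fun n => hnorm (u n - l)) @ \oo --> (0 : R).
Proof.
move=> cH u cu; have [e e0|l hl] := cH u.
  have [|M hM] := cu (Num.sqrt e); first by rewrite sqrtr_gt0.
  exists M => m n Mm Mn; have := hM m n Mm Mn.
  by rewrite hnorm_lt ?sqrtr_gt0// sqr_sqrtr ?(ltW e0)// => /ltW.
exists l; apply/cvgrPdist_lt => e e0.
have [|M hM] := hl (e ^+ 2 / 2); first by rewrite divr_gt0// exprn_gt0.
exists M => // n /= Mn; rewrite sub0r normrN ger0_norm ?sqrtr_ge0//.
rewrite hnorm_lt//; apply: le_lt_trans (hM n Mn) _.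
by rewrite ltr_pdivrMr// ltr_pMr ?exprn_gt0// ltr1n.
Qed.

Lemma hnorm_sq_complete : (forall u : nat -> H,
    (forall e : R, 0 < e -> exists M, forall m n,
      (M <= m)%N -> (M <= n)%N -> hnorm (u m - u n) < e) ->
    exists l, (fun n => hnorm (u n - l)) @ \oo --> (0 : R)) -> sq_complete.
Proof.
move=> cH u cu; have [e e0|l /cvgrPdist_lt hl] := cH u.
  have [|M hM] := cu (e ^+ 2 / 2); first by rewrite divr_gt0// exprn_gt0.
  exists M => m n Mm Mn; rewrite hnorm_lt//; apply: le_lt_trans (hM m n Mm Mn) _.
  by rewrite ltr_pdivrMr// ltr_pMr ?exprn_gt0// ltr1n.
exists l => e e0.
have [|M _ hM] := hl (Num.sqrt e); first by rewrite sqrtr_gt0.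
exists M => n Mn; have := hM n Mn; rewrite sub0r normrN ger0_norm ?sqrtr_ge0//.
by rewrite hnorm_lt ?sqrtr_gt0// sqr_sqrtr ?(ltW e0)// => /ltW.
Qed.

Hypothesis hH : hilbert H.

Lemma innerZDr x a y z : inner x (a *: y + z) = a * inner x y + inner x z.
Proof. by case: hH. Qed.

Lemma innerC x y : inner y x = (inner x y)^*.
Proof. by case: hH. Qed.

Lemma inner0r x : inner x 0 = 0.
Proof. by apply: (@linear_0 _ H C^o) => a y z; exact: innerZDr. Qed.

Lemma innerZr x a y : inner x (a *: y) = a * inner x y.
Proof. by rewrite -[a *: y]addr0 innerZDr inner0r addr0. Qed.

Lemma innerDr x y z : inner x (y + z) = inner x y + inner x z.
Proof. by rewrite -[y]scale1r innerZDr scale1r mul1r. Qed.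

Lemma innerDl x y z : inner (y + z) x = inner y x + inner z x.
Proof. by rewrite innerC innerDr cjD -!innerC. Qed.

Lemma innerZl x a y : inner (a *: y) x = a^* * inner y x.
Proof. by rewrite innerC innerZr cjM -innerC. Qed.

Lemma innerNr x y : inner x (- y) = - inner x y.
Proof. by rewrite -scaleN1r innerZr mulN1r. Qed.

Lemma innerNl x y : inner (- y) x = - inner y x.
Proof. by rewrite innerC innerNr cjN -innerC. Qed.

Lemma inner_hsq x : inner x x = (hsq x)%:C.
Proof.
have h : 0 <= inner x x by case: hH.
by apply: complex_eq => //; rewrite ImR (ger0_Im h).
Qed.

Lemma hsq_ge0 x : 0 <= hsq x.
Proof.
have h : 0 <= inner x x by case: hH.
by rewrite -ler0c -inner_hsq.
Qed.

Lemma hsq_eq0 x : hsq x = 0 -> x = 0.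
Proof. by move=> h; case: hH => _ _ _ h0 _; apply: h0; rewrite inner_hsq h. Qed.

Lemma hsqZ a x : hsq (a *: x) = sqmod a * hsq x.
Proof.
by rewrite /hsq innerZr innerZl mulrA [a * _]mulrC conj_mulE ReZ.
Qed.

Lemma hsq0 : hsq 0 = 0.
Proof. by rewrite /hsq inner0r. Qed.

Lemma hsqN x : hsq (- x) = hsq x.
Proof. by rewrite /hsq innerNr innerNl opprK. Qed.

Lemma hsqD x y : hsq (x + y) = hsq x + hsq y + 2 * Re (inner x y).
Proof.
rewrite /hsq innerDr !innerDl [inner y x]innerC !complex_ReD ReJ; ring.
Qed.

Lemma hsqB x y : hsq (x - y) = hsq x + hsq y - 2 * Re (inner x y).
Proof. by rewrite hsqD hsqN innerNr ReN mulrN. Qed.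

Lemma hsqD_le x y : hsq (x + y) <= 2 * hsq x + 2 * hsq y.
Proof.
have := hsq_ge0 (x - y); rewrite hsqB hsqD; lra.
Qed.

Lemma hnorm_le x y (M : R) : 0 <= M -> hsq x <= M ^+ 2 * hsq y ->
  hnorm x <= M * hnorm y.
Proof.
move=> M0 h; rewrite /hnorm -{1}(ger0_norm M0) -sqrtr_sqr -sqrtrM ?sqr_ge0//.
by rewrite ler_sqrt// mulr_ge0 ?sqr_ge0 ?hsq_ge0.
Qed.

Lemma bounded_hsq (S : H -> H) : bounded_op S ->
  exists2 M : R, 0 <= M & forall x, hsq (S x) <= M * hsq x.
Proof.
move=> [_ [M hM]]; exists (M ^+ 2); first exact: sqr_ge0.
move=> x; have := hM x; rewrite /hnorm => h.
rewrite -[hsq (S x)]sqr_sqrtr ?hsq_ge0// -[X in _ * X]sqr_sqrtr ?hsq_ge0//.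
rewrite -exprMn lerXn2r// ?nnegrE ?sqrtr_ge0//.
by apply: le_trans h; rewrite sqrtr_ge0.
Qed.

Lemma inner_ext x y : (forall z, inner z x = inner z y) -> x = y.
Proof.
move=> h; apply/eqP; rewrite -subr_eq0; apply/eqP/hsq_eq0.
by rewrite /hsq innerDr innerNr h subrr.
Qed.

Lemma span_dense (A : set H) :
  (forall x (e : R), 0 < e -> exists2 y, Defs.span A y & hsq (x - y) < e) ->
  hdense (Defs.span A).
Proof.
move=> h x e e0; have [|y Ay xy] := h x (e ^+ 2); first by rewrite exprn_gt0.
by exists y => //; rewrite hnorm_lt.
Qed.

Lemma spanD (A : set H) x y : Defs.span A x -> Defs.span A y -> Defs.span A (x + y).
Proof.
move=> [k [c [v [vA ->]]]] [k' [c' [v' [vA' ->]]]].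
exists (k + k')%N.
exists (fun j => match fintype.split j with inl i => c i | inr i => c' i end).
exists (fun j => match fintype.split j with inl i => v i | inr i => v' i end).
split; first by move=> j; case: (fintype.split j).
rewrite big_split_ord/=; congr (_ + _); apply: eq_bigr => i _.
  by rewrite (unsplitK (inl i : 'I_k + 'I_k')).
by rewrite (unsplitK (inr i : 'I_k + 'I_k')).
Qed.

Lemma span0 (A : set H) : Defs.span A 0.
Proof.
by exists 0%N, (fun=> 0), (fun=> 0); split; [case|rewrite big_ord0].
Qed.

Lemma span_mem (A : set H) x : A x -> Defs.span A x.
Proof.
move=> Ax; exists 1%N, (fun=> 1), (fun=> x); split=> //.
by rewrite big_ord1 scale1r.
Qed.

End InnerProduct.

Section L2Hilbert.
Variable R : realType.

Lemma hsq_L2 (x : L2 R) : (2 * pi * @hsq R (L2space R) x)%:E = energy x.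
Proof. by rewrite energyE. Qed.

Lemma energyB_sym (x y : L2 R) :
  energy (fun t => x t - y t) = energy (fun t => y t - x t).
Proof.
by apply: eq_integral => t _; rewrite -sqmodN opprB.
Qed.

Lemma hilbert_L2 : hilbert (L2space R).
Proof.
have p0 := twopi_gt0 R.
split.
- exact: inner_L2_linear.
- exact: inner_L2_sym.
- move=> x; rewrite inner_L2_sq ler0c mulr_ge0 ?invr_ge0 ?(ltW p0)//.
  by rewrite fine_ge0// energy_ge0.
- by move=> x h; apply: energy0_eq0; rewrite energyE h mulr0.
apply: sq_complete_hnorm => u cu; have [e e0|l hl] := L2_complete (u := u).
  have [|M hM] := cu (e / (2 * pi)); first by rewrite divr_gt0.
  exists M => m n Mm Mn; have := hM m n Mm Mn.
  by rewrite -energyB_L2 -hsq_L2 lee_fin ler_pdivlMr// mulrC.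
exists l => e e0; have [|M hM] := hl (2 * pi * e); first by rewrite mulr_gt0.
exists M => n Mn; have := hM n Mn.
by rewrite energyB_sym -energyB_L2 -hsq_L2 lee_fin ler_pM2l.
Qed.

End L2Hilbert.

Lemma dependent_choice (I : Type) (X : I -> Type) (P : forall i, X i -> Prop) :
  (forall i, exists x, P i x) -> exists f : forall i, X i, forall i, P i (f i).
Proof.
by move=> h; exists (fun i => sval (cid (h i))) => i; exact: svalP (cid (h i)).
Qed.

Section DirectSumHilbert.
Variables (R : realType) (I : finType) (H : I -> ipspace R).
Local Notation Re := complex.Re.
Implicit Types x y : dsum H.

Lemma Re_sum (F : I -> R[i]) : Re (\sum_i F i) = \sum_i Re (F i).
Proof. exact: (big_morph _ (@complex_ReD R) (erefl _)). Qed.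

Lemma dsum_sumE (J : Type) (r : seq J) (F : J -> dsum H) i :
  (\sum_(j <- r) F j) i = \sum_(j <- r) F j i.
Proof. by elim/big_rec2: _ => // j x y _ <-. Qed.

Lemma hsq_dsum x : hsq x = \sum_i hsq (x i).
Proof. exact: Re_sum. Qed.

Hypothesis hH : forall i, hilbert (H i).

Lemma hsq_dsum_ge x i : hsq (x i) <= hsq x.
Proof.
rewrite hsq_dsum (bigD1 i)//= lerDl sumr_ge0// => j _.
exact: hsq_ge0.
Qed.

Lemma hilbert_dsum : hilbert (dsum H).
Proof.
split.
- move=> x a y z; rewrite /= mulr_sumr -big_split/=.
  by apply: eq_bigr => i _; rewrite -innerZDr.
- move=> x y /=; rewrite (big_morph _ (@cjD R) (cj0 R)).
  by apply: eq_bigr => i _; rewrite -innerC.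
- move=> x /=; apply: sumr_ge0 => i _.
  by rewrite inner_hsq// ler0c hsq_ge0.
- move=> x h; have h0 : hsq x = 0 by rewrite /hsq h.
  apply: functional_extensionality_dep => i; apply: (hsq_eq0 (hH i)).
  apply/eqP; rewrite eq_le hsq_ge0// andbT.
  by rewrite -h0 hsq_dsum_ge.
apply: sq_complete_hnorm => u cu.
have /dependent_choice[l hl] i : exists l : H i, forall e : R, 0 < e -> exists M,
    forall n, (M <= n)%N -> hsq (u n i - l) <= e.
  have cH : sq_complete (H i) by apply: hnorm_sq_complete; case: (hH i).
  apply: (cH (fun n => u n i)) => e /cu[M hM]; exists M => m n Mm Mn.
  exact: le_trans (hsq_dsum_ge (u m - u n) i) (hM m n Mm Mn).
exists (l : dsum H) => e e0.
have e1 : 0 < e / #|I|.+1%:R by rewrite divr_gt0.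
have /choice[M hM] i := hl i _ e1.
exists (\sum_i M i)%N => n Mn; rewrite hsq_dsum.
apply: (@le_trans _ _ (\sum_(i : I) e / #|I|.+1%:R)).
  apply: ler_sum => i _; apply: hM; apply: leq_trans Mn.
  by rewrite (bigD1 i)//= leq_addr.
rewrite sumr_const cardT -cardE -[leLHS]mulr_natr mulrAC ler_pdivrMr//.
by rewrite ler_pM2l// ler_nat.
Qed.

Lemma hilbert_unitary_dsum (U : forall i, H i -> H i) :
  (forall i, unitary (U i)) -> unitary (dsum_op U).
Proof.
move=> hU; split.
- move=> a x y; apply: functional_extensionality_dep => i.
  by have [h _ _] := hU i; exact: h.
- by move=> x y; apply: eq_bigr => i _; have [_ h _] := hU i; exact: h.
- move=> y; have /dependent_choice[x hx] i : exists t : H i, U i t = y i.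
    by have [_ _ h] := hU i; exact: h.
  by exists (x : dsum H); apply: functional_extensionality_dep => i; exact: hx.
Qed.

Lemma bounded_dsum (S : forall i, H i -> H i) :
  (forall i, bounded_op (S i)) -> bounded_op (dsum_op S).
Proof.
move=> hS; split.
  move=> a x y; apply: functional_extensionality_dep => i.
  by have [h _] := hS i; exact: h.
have /choice[M hM] i : exists M : R, 0 <= M /\ forall t : H i, hsq (S i t) <= M * hsq t.
  by have [M M0 h] := bounded_hsq (hH i) (hS i); exists M.
have N0 : 0 <= \sum_i M i by apply: sumr_ge0 => i _; case: (hM i).
exists (Num.sqrt (\sum_i M i)) => x.
apply: (hnorm_le hilbert_dsum); first exact: sqrtr_ge0.
rewrite sqr_sqrtr// !hsq_dsum mulr_sumr; apply: ler_sum => i _.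
apply: (le_trans ((hM i).2 _)); rewrite ler_wpM2r ?hsq_ge0//.
by rewrite (bigD1 i)//= lerDl sumr_ge0// => j _; case: (hM j).
Qed.

Lemma star_representation_dsum (rep : forall i, (circle R -> R[i]) -> H i -> H i) :
  (forall i, star_representation (rep i)) ->
  star_representation (fun f => dsum_op (fun i => rep i f)).
Proof.
move=> h; split.
- by move=> f hf; apply: bounded_dsum => i; case: (h i) => + _ _ _ _; exact.
- move=> f g hf hg fg x; apply: functional_extensionality_dep => i.
  by case: (h i) => _ + _ _ _; exact.
- move=> a f g hf hg x; apply: functional_extensionality_dep => i.
  by case: (h i) => _ _ + _ _; exact.
- move=> f g hf hg x; apply: functional_extensionality_dep => i.
  by case: (h i) => _ _ _ + _; exact.
- split.
    move=> x; apply: functional_extensionality_dep => i.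
    by case: (h i) => _ _ _ _ [+ _]; exact.
  move=> f hf x y; apply: eq_bigr => i _.
  by case: (h i) => _ _ _ _ [_ /(_ f hf)]; exact.
Qed.

End DirectSumHilbert.

(** * Dilation and multiplication operators *)

Section Isometry.
Variables (R : realType) (H : ipspace R).
Hypothesis hH : hilbert H.
Local Notation Re := complex.Re.
Local Notation Im := complex.Im.

(** Polarization; the imaginary part of the inner product is the real part of its
    product with [-i]. *)
Lemma isometry_inner (U : H -> H) : linear U ->
  (forall x, hsq (U x) = hsq x) -> forall x y, inner (U x) (U y) = inner x y.
Proof.
move=> lU iU.
have rU x y : Re (inner (U x) (U y)) = Re (inner x y).
  have := iU (1 *: x + y); rewrite lU !scale1r !hsqD// !iU => /addrI.
  by apply: mulfI; rewrite pnatr_eq0.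
have U0 : U 0 = 0 by apply: (hsq_eq0 hH); rewrite iU hsq0.
have ImE (w : R[i]) : Im w = - Re ('i%C * w).
  by rewrite !ReImE /=; case: w => ? ? /=; rewrite mul0r mul1r sub0r opprK.
move=> x y; apply: complex_eq; first exact: rU.
rewrite !ImE -!innerZr//.
have -> : 'i%C *: U y = U ('i%C *: y) by rewrite -[in RHS](addr0 (_ *: y)) lU U0 addr0.
by rewrite rU.
Qed.

End Isometry.

Section Operators.
Variable R : realType.
Local Notation C := R[i].
Local Notation T := (circle R).
Local Notation mu := (@lebesgue_measure R).
Local Notation Re := complex.Re.
Local Notation Im := complex.Im.
Implicit Types (f g : T -> C) (x y : L2 R) (z : T).

Section Dilation.
Variable N : nat.
Hypothesis N_gt0 : (0 < N)%N.

Let N0 : 0 < N%:R :> R. Proof. by rewrite ltr0n. Qed.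

Lemma sqrtN_gt0 : 0 < Num.sqrt N%:R :> R.
Proof. by rewrite sqrtr_gt0. Qed.

Lemma ae_dilate (P : R -> Prop) :
  {ae mu, forall t, P t} -> {ae mu, forall t, P (N%:R * t)}.
Proof.
move=> h; have := @ae_affine R N%:R 0 P N0 h.
by apply: aeS => t; rewrite addr0.
Qed.

Lemma cmeasurable_dilate (h : R -> C) (a : R) : cmeasurable h ->
  cmeasurable (fun t => h (a * t)).
Proof.
move=> mh; have := cmeasurable_affine a 0 mh.
by congr (cmeasurable _); apply/funext => t; rewrite addr0.
Qed.

Lemma dilate_square_integrable x :
  (fun t => (Num.sqrt N%:R)%:C * x (N%:R * t)) \in @square_integrable R.
Proof.
have mx := cmeasurable_dilate N%:R (L2_cmeasurable x).
apply/square_integrableP; split.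
  by apply: cmeasurableM => //; exact: cmeasurable_cst.
rewrite energyZ// lte_mul_pinfty ?lee_fin ?sqmod_ge0//.
have := L2_energy x; rewrite (energy_affine 0 N0 (L2_cmeasurable x)).
under [X in energy X]eq_fun do rewrite addr0.
rewrite !ltey; apply: contra => /eqP ->.
by rewrite gt0_muley// lte_fin.
Qed.

Lemma U1_ae x : {ae mu, forall t,
  (U1 N x : L2 R) t = (Num.sqrt N%:R)%:C * x (N%:R * t)}.
Proof. exact: toL2K (dilate_square_integrable x). Qed.

Lemma energy_U1 x : energy (U1 N x : L2 R) = energy x.
Proof.
have mx := cmeasurable_dilate N%:R (L2_cmeasurable x).
rewrite (@ae_eq_energy _ _ (fun t => (Num.sqrt N%:R)%:C * x (N%:R * t))).
- rewrite energyZ// sqmodR sqr_sqrtr ?ltW//.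
  rewrite [RHS](energy_affine 0 N0 (L2_cmeasurable x)).
  by under [X in _ = (_ * energy X)%E]eq_fun do rewrite addr0.
- exact: L2_cmeasurable.
- by apply: cmeasurableM => //; exact: cmeasurable_cst.
- exact: U1_ae.
Qed.

Lemma hsq_energy x y : energy x = energy y ->
  @hsq R (L2space R) x = @hsq R (L2space R) y.
Proof.
rewrite -!hsq_L2 => -[/mulfI]; apply; exact/lt0r_neq0/twopi_gt0.
Qed.

Lemma hsq_U1 (x : L2space R) : hsq (U1 N x) = hsq x.
Proof. exact: (hsq_energy (energy_U1 x)). Qed.

Lemma U1_linear : linear (U1 N : L2space R -> L2space R).
Proof.
move=> a x y; apply: L2_eq.
have h1 := U1_ae (a *: x + y).
have h2 := ae_dilate (L2D_ae (a *: (x : L2 R)) y).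
have h3 := ae_dilate (L2Z_ae a x).
have h4 := L2D_ae (a *: (U1 N x : L2 R)) (U1 N y).
have h5 := L2Z_ae a (U1 N x).
have h6 := ae_and (U1_ae x) (U1_ae y).
have h := ae_and h1 (ae_and h2 (ae_and h3 (ae_and h4 (ae_and h5 h6)))).
apply: aeS h => t [-> [-> [-> [-> [-> [-> ->]]]]]].
by rewrite mulrDr mulrCA.
Qed.

Lemma U1_surj (y : L2space R) : exists x : L2space R, U1 N x = y.
Proof.
pose h t := (Num.sqrt N%:R)^-1%:C * (y : L2 R) (N%:R^-1 * t).
have mh : cmeasurable h.
  apply: cmeasurableM; first exact: cmeasurable_cst.
  exact: cmeasurable_dilate (L2_cmeasurable y).
have E t : (Num.sqrt N%:R)%:C * h (N%:R * t) = (y : L2 R) t.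
  rewrite /h mulrA -rmorphM mulfV ?lt0r_neq0 ?sqrtN_gt0// mul1r mulrA.
  by rewrite mulVf ?mul1r// lt0r_neq0.
have sh : h \in @square_integrable R.
  apply/square_integrableP; split=> //.
  have -> : energy h = energy (y : L2 R).
    rewrite (energy_affine 0 N0 mh).
    have -> : (fun t => h (N%:R * t + 0)) =
        (fun t => (Num.sqrt N%:R)^-1%:C * (y : L2 R) t).
      apply/funext => t; rewrite addr0 -[in RHS]E mulrA -rmorphM.
      by rewrite mulVf ?mul1r// lt0r_neq0// sqrtN_gt0.
    rewrite energyZ; last exact: L2_cmeasurable.
    rewrite sqmodR muleA -EFinM exprVn sqr_sqrtr ?ltW//.
    by rewrite mulfV ?mul1e// lt0r_neq0.
  exact: L2_energy.
exists (toL2 h); apply: L2_eq.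
apply: aeS2 (U1_ae (toL2 h)) (ae_dilate (toL2K sh)) => t -> ->.
exact: E.
Qed.

End Dilation.

Section Multiplication.

Lemma Linfty_rotate z f : Linfty f -> Linfty (alpha z f).
Proof.
move=> [mf [M hM]]; have [a az] := expi_surj z.
have E t : alpha z f (expi t) = f (expi (1 * t + a)).
  by rewrite /alpha -az -expiD mul1r addrC.
split.
  have -> : (fun t => alpha z f (expi t)) = (fun t => f (expi (1 * t + a))).
    by apply/funext => t; rewrite E.
  exact: cmeasurable_affine mf.
exists M; have := ae_affine a ltr01 hM.
by apply: aeS => t; rewrite E.
Qed.

Lemma Linfty_power (N : nat) f : (0 < N)%N -> Linfty f ->
  Linfty (fun w => f (w ^+ N)%g).
Proof.
move=> N0 [mf [M hM]]; have N0' : 0 < N%:R :> R by rewrite ltr0n.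
split.
  have := cmeasurable_dilate N%:R mf.
  by congr (cmeasurable _); apply/funext => t; rewrite expiMn.
exists M; have := ae_dilate N0 hM.
by apply: aeS => t; rewrite expiMn.
Qed.

Lemma LinftyM f g : Linfty f -> Linfty g -> Linfty (fun w => f w * g w).
Proof.
move=> [mf [M hM]] [mg [K hK]]; split; first exact: cmeasurableM.
exists (M * K); apply: aeS2 hM hK => t h1 h2.
by rewrite normrM rmorphM; apply: ler_pM.
Qed.

Lemma LinftyJ f : Linfty f -> Linfty (fun w => (f w)^*).
Proof.
move=> [mf [M hM]]; split; first exact: cmeasurableJ.
by exists M; apply: aeS hM => t; rewrite !normE_sqmod sqmodJ.
Qed.

Lemma LinftyZD (a : C) f g : Linfty f -> Linfty g ->
  Linfty (fun w => a * f w + g w).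
Proof.
move=> [mf [M hM]] [mg [K hK]]; split.
  apply: cmeasurableD => //; apply: cmeasurableM => //; exact: cmeasurable_cst.
exists (Num.sqrt (sqmod a) * M + K); apply: aeS2 hM hK => t h1 h2.
rewrite (le_trans (ler_normD _ _))// rmorphD rmorphM lerD// normrM normE_sqmod.
by rewrite ler_wpM2l// ler0c sqrtr_ge0.
Qed.

Lemma Linfty_cst (a : C) : Linfty (fun _ : T => a).
Proof.
split; first exact: cmeasurable_cst.
by exists (Num.sqrt (sqmod a)); apply: ae_all => t; rewrite normE_sqmod.
Qed.

Lemma pi1_bound f x (M : R) : Linfty f ->
  {ae mu, forall t, `|f (expi t)| <= M%:C} ->
  (energy (fun t => (f (expi t) * x t)%R) <= (M ^+ 2)%:E * energy x)%E.
Proof.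
move=> [mf _] hM; apply: le_energy; first exact: sqr_ge0.
- by apply: cmeasurableM => //; exact: L2_cmeasurable.
- exact: L2_cmeasurable.
- apply: aeS hM => t h; rewrite sqmodM ler_wpM2r ?sqmod_ge0//.
  exact: norm_le_sqmod.
Qed.

Lemma pi1_square_integrable f x : Linfty f ->
  (fun t => f (expi t) * x t) \in @square_integrable R.
Proof.
move=> hf; have [mf [M hM]] := hf; apply/square_integrableP; split.
  by apply: cmeasurableM => //; exact: L2_cmeasurable.
apply: (le_lt_trans (pi1_bound x hf hM)).
by rewrite lte_mul_pinfty ?lee_fin ?sqr_ge0// L2_energy.
Qed.

Lemma pi1_ae f x : Linfty f ->
  {ae mu, forall t, (pi1 f x : L2 R) t = f (expi t) * x t}.
Proof. by move=> hf; exact: toL2K (pi1_square_integrable x hf). Qed.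

Lemma hsq_pi1_le f (x : L2space R) (M : R) : Linfty f ->
  {ae mu, forall t, `|f (expi t)| <= M%:C} -> hsq (pi1 f x) <= M ^+ 2 * hsq x.
Proof.
move=> hf hM.
rewrite -(ler_pM2l (twopi_gt0 R)) mulrCA -lee_fin [X in (_ <= X)%E]EFinM !hsq_L2.
rewrite (@ae_eq_energy _ _ (fun t => f (expi t) * (x : L2 R) t)).
- exact: pi1_bound.
- exact: L2_cmeasurable.
- by apply: cmeasurableM; [exact: hf.1|exact: L2_cmeasurable].
- exact: pi1_ae.
Qed.

Lemma pi1_linear f : Linfty f -> linear (pi1 f : L2space R -> L2space R).
Proof.
move=> hf a x y; apply: L2_eq.
have h1 := pi1_ae (a *: x + y : L2 R) hf.
have h2 := L2D_ae (a *: (x : L2 R)) y.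
have h3 := L2Z_ae a x.
have h4 := L2D_ae (a *: (pi1 f x : L2 R)) (pi1 f y).
have h5 := L2Z_ae a (pi1 f x).
have h6 := ae_and (pi1_ae x hf) (pi1_ae y hf).
have h := ae_and h1 (ae_and h2 (ae_and h3 (ae_and h4 (ae_and h5 h6)))).
apply: aeS h => t [-> [-> [-> [-> [-> [-> ->]]]]]].
by rewrite mulrDr mulrCA.
Qed.

Lemma pi1_adjoint f : Linfty f ->
  adjoint (pi1 f : L2space R -> L2space R) (pi1 (fun w => (f w)^*)).
Proof.
move=> hf x y; rewrite !inner_L2E; congr (_ * _); apply: eq_cintegral.
- by apply: cmeasurableM; [apply: cmeasurableJ|]; exact: L2_cmeasurable.
- by apply: cmeasurableM; [apply: cmeasurableJ|]; exact: L2_cmeasurable.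
apply: aeS2 (pi1_ae x hf) (pi1_ae y (LinftyJ hf)) => t -> ->.
by rewrite cjM mulrCA mulrA.
Qed.

Lemma star_representation_pi1 (z : T) :
  star_representation (fun f => pi1 (alpha z f) : L2space R -> L2space R).
Proof.
split.
- move=> f /(Linfty_rotate z) hf; split; first exact: pi1_linear.
  have [_ [M hM]] := hf; exists `|M| => x.
  apply: (hnorm_le (@hilbert_L2 R)) => //.
  by rewrite real_normK ?num_real//; exact: hsq_pi1_le.
- move=> f g hf hg fg x; apply: L2_eq.
  have [a az] := expi_surj z.
  have fga : {ae mu, forall t, alpha z f (expi t) = alpha z g (expi t)}.
    have := ae_affine a ltr01 fg; apply: aeS => t.
    by rewrite /alpha -az -expiD mul1r addrC.
  apply: aeS3 (pi1_ae x (Linfty_rotate z hf)) (pi1_ae x (Linfty_rotate z hg)) fga.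
  by move=> t -> -> ->.
- move=> a f g hf hg x; apply: L2_eq.
  have hf' := Linfty_rotate z hf; have hg' := Linfty_rotate z hg.
  have h1 := pi1_ae x (Linfty_rotate z (LinftyZD a hf hg)).
  have h2 := L2D_ae (a *: (pi1 (alpha z f) x : L2 R)) (pi1 (alpha z g) x).
  have h3 := L2Z_ae a (pi1 (alpha z f) x).
  have h := ae_and h1 (ae_and h2 (ae_and h3 (ae_and (pi1_ae x hf') (pi1_ae x hg')))).
  apply: aeS h => t [-> [-> [-> [-> ->]]]].
  by rewrite /alpha mulrDl mulrA.
- move=> f g hf hg x; apply: L2_eq.
  have hf' := Linfty_rotate z hf; have hg' := Linfty_rotate z hg.
  have h1 := pi1_ae x (Linfty_rotate z (LinftyM hf hg)).
  have h2 := pi1_ae (pi1 (alpha z g) x) hf'.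
  apply: aeS3 h1 h2 (pi1_ae x hg') => t -> -> ->.
  by rewrite mulrA.
- split.
    move=> x; apply: L2_eq.
    apply: aeS (pi1_ae x (Linfty_rotate z (Linfty_cst 1))) => t ->.
    by rewrite mul1r.
  move=> f hf; exact: (pi1_adjoint (Linfty_rotate z hf)).
Qed.

Lemma U1_pi1 (N : nat) f g (x : L2space R) : (0 < N)%N ->
  Linfty f -> Linfty g -> (forall w, f (w ^+ N)%g = g w) ->
  U1 N (pi1 f x) = pi1 g (U1 N x).
Proof.
move=> N0 hf hg fg; apply: L2_eq.
have h1 := U1_ae N0 (pi1 f x).
have h2 := ae_dilate N0 (pi1_ae x hf).
have h := ae_and h1 (ae_and h2 (ae_and (pi1_ae (U1 N x) hg) (U1_ae N0 x))).
apply: aeS h => t [-> [-> [-> ->]]].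
by rewrite -fg expiMn mulrCA.
Qed.

End Multiplication.

End Operators.

(** * The operators attached to a cycle *)

Section CycleOperators.
Variables (R : realType) (N : nat) (p : nat) (z : 'I_p -> circle R).
Variable theta : 'I_p -> R.
Hypothesis N_gt0 : (0 < N)%N.

Lemma ordS_bij : bijective (@ordS p).
Proof. by exists (@ord_pred p); [exact: ordSK|exact: ord_predK]. Qed.

Lemma hilbert_cycle : hilbert (cycle_space R p).
Proof. by apply: hilbert_dsum => k; exact: hilbert_L2. Qed.

Lemma star_representation_cycle : star_representation (cycle_rep z).
Proof.
exact: (@star_representation_dsum R _ (fun=> L2space R) (fun=> @hilbert_L2 R)
  (fun k f => pi1 (alpha (z k) f)) (fun k => star_representation_pi1 (z k))).
Qed.

Lemma cycle_U_linear : linear (cycle_U N theta).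
Proof.
move=> a x y; apply: functional_extensionality_dep => k.
rewrite /cycle_U /= [X in U1 N X](_ : _ = a *: x (ordS k) + y (ordS k))//.
rewrite (U1_linear N_gt0) scalerDr scalerA mulrC -scalerA//.
Qed.

Lemma hsq_cycle_U x : hsq (cycle_U N theta x) = hsq x.
Proof.
rewrite !hsq_dsum [RHS](reindex (@ordS p)); last first.
  by apply: onW_bij; exact: ordS_bij.
apply: eq_bigr => k _; rewrite /cycle_U hsqZ; last exact: hilbert_L2.
by rewrite sqmod_circle mul1r hsq_U1.
Qed.

Lemma cycle_U_unitary : unitary (cycle_U N theta).
Proof.
split; first exact: cycle_U_linear.
  exact: (isometry_inner hilbert_cycle cycle_U_linear hsq_cycle_U).
move=> y.
have /choice[x hx] k : exists t : L2space R,
    val (expi (theta k)) *: U1 N t = y k.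
  have [t ht] := U1_surj N_gt0 ((val (expi (theta k)))^-1 *: y k).
  by exists t; rewrite ht scalerA mulfV ?scale1r// circle_val_neq0.
exists (fun k => x (ord_pred k)).
by apply: functional_extensionality_dep => k; rewrite /cycle_U ordSK hx.
Qed.

Lemma cycle_U_rep f : (forall k, (z k ^+ N)%g = z (ordS k)) -> Linfty f ->
  forall x, cycle_U N theta (cycle_rep z f x) =
    cycle_rep z (fun w => f (w ^+ N)%g) (cycle_U N theta x).
Proof.
move=> zS hf x; apply: functional_extensionality_dep => k.
have hfN := Linfty_power N_gt0 hf.
rewrite /cycle_U /cycle_rep.
have [h _ _ _ _] := star_representation_pi1 (z k).
have [l _] := h _ hfN.
rewrite -[in RHS](addr0 (_ *: _)) l.
rewrite (linear_0 l) addr0; congr (_ *: _); apply: U1_pi1 => //; try exact: Linfty_rotate.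
by move=> w; rewrite /alpha circle_expgMn zS.
Qed.

End CycleOperators.

(** * Backward orbits of the power map *)

Section Roots.
Variables (R : realType) (N : nat).
Local Notation T := (circle R).
Hypothesis N_gt0 : (0 < N)%N.

Let N0 : 0 < N%:R :> R. Proof. by rewrite ltr0n. Qed.

Definition nroot (x : R) (k : nat) : T := expi ((x + 2 * pi * k%:R) / N%:R).

Lemma nrootX x k : (nroot x k ^+ N)%g = expi x.
Proof.
rewrite /nroot -expiMn mulrC mulfVK ?lt0r_neq0//.
exact: (expi_periodic x k).
Qed.

Lemma nroot_inj x : injective (fun k : 'I_N => nroot x k).
Proof.
move=> k k' /expi_inj_lift[j]; rewrite /nroot => e.
have p0 := twopi_gt0 R.
have e2 : ((k : int)%:~R = (k' : int)%:~R + (N : int)%:~R * j%:~R :> R).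
  apply: (mulfI (lt0r_neq0 p0)); apply: (addrI x).
  have := congr1 (fun t => t * N%:R) e.
  rewrite /= [in RHS]mulrDl !mulfVK ?lt0r_neq0// -!pmulrn => ->.
  by ring.
have {e e2} e3 : (k : int) = (k' : int) + (N : int) * j.
  by apply/eqP; rewrite -(eqr_int R) intrD intrM; apply/eqP.
have kN := ltn_ord k; have k'N := ltn_ord k'.
apply: val_inj => /=.
have j0 : j = 0.
  apply/eqP; rewrite -absz_eq0; apply/negP => /negP; rewrite -lt0n => j1.
  have : (N%:Z * j)%R = (k : int) - (k' : int) by rewrite e3 addrAC subrr add0r.
  move/(congr1 absz); rewrite abszM /= => h.
  have : (`|k%:Z - k'%:Z| < N)%N by lia.
  by rewrite -h -[X in (_ < X)%N]muln1 ltn_pmul2l// ltnNge j1.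
by move: e3; rewrite j0 mulr0 addr0 => -[].
Qed.

(** Turning the angle of [w] by [2 pi] changes [j] by [N], so only the residue of
    [j] modulo [N] matters. *)
Lemma nroot_surj x (w : T) : (w ^+ N)%g = expi x -> exists k : 'I_N, w = nroot x k.
Proof.
have [b <-] := expi_surj w; rewrite -expiMn => /expi_inj_lift[j e].
have Nz : N%:Z != 0 :> int by rewrite eqz_nat -lt0n.
have m0 := modz_ge0 j Nz; have m1 := ltz_pmod j (_ : 0 < N%:Z).
pose k := `|(j %% N%:Z)%Z|%N.
have kE : (k : int) = (j %% N%:Z)%Z by rewrite /k gez0_abs.
have kN : (k < N)%N by rewrite -ltz_nat kE m1// ltz_nat.
exists (Ordinal kN); rewrite /nroot /=.
rewrite -[RHS](expi_periodic _ (j %/ N%:Z)%Z); congr expi.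
have -> : b = (x + 2 * pi * j%:~R) / N%:R by rewrite -e mulrAC mulfV ?mul1r// lt0r_neq0.
have -> : j%:~R = (j %/ N%:Z)%Z%:~R * N%:R + k%:R :> R.
  by rewrite {1}(divz_eq j N%:Z) -kE intrD intrM -!pmulrn.
have n0 := lt0r_neq0 N0; move: ((j %/ N%:Z)%Z%:~R : R) => q.
by field.
Qed.

End Roots.

Section BackwardClosed.
Variables (R : realType) (N : nat).
Local Notation T := (circle R).
Hypothesis N_ge2 : (2 <= N)%N.
Variables (W : T -> R) (M : set T) (cyc : set T).
Hypothesis W_sum : forall x, \sum_(k < N) W (nroot N x k) = N%:R.
Hypothesis W_zeros : finite_set [set w | W w = 0].
(** When [W] is the squared modulus of a filter, these orbits are its cycles. *)
Hypothesis W_cycle : forall y m, (0 < m)%N -> (y ^+ (N ^ m) = y)%g ->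
  (forall j, W (y ^+ (N ^ j))%g = N%:R) -> cyc y.
Hypothesis M_closed : closed [set x | M (expi x)].
Hypothesis M_back : forall w, M (w ^+ N)%g -> W w != 0 -> M w.

Let N_gt0 : (0 < N)%N. Proof. exact: ltnW. Qed.
Let N0 : 0 < N%:R :> R. Proof. by rewrite ltr0n. Qed.

Definition periodic_point (y : T) : Prop :=
  exists2 m, (0 < m)%N & (y ^+ (N ^ m) = y)%g.

Lemma expg_pow (y : T) a b : ((y ^+ (N ^ a)) ^+ (N ^ b) = y ^+ (N ^ (a + b)))%g.
Proof. by rewrite expnD expgnA. Qed.

Lemma period_mul (y : T) m k : (y ^+ (N ^ m) = y)%g -> (y ^+ (N ^ (m * k)) = y)%g.
Proof.
move=> h; elim: k => [|k IH]; first by rewrite muln0 expn0 expg1.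
by rewrite mulnS -expg_pow h.
Qed.

(** After a common period both points are the same power of [w1 ^+ N = w2 ^+ N]. *)
Lemma periodic_unique w1 w2 : periodic_point w1 -> periodic_point w2 ->
  (w1 ^+ N = w2 ^+ N)%g -> w1 = w2.
Proof.
move=> [m1 m10 h1] [m2 m20 h2] e.
have r0 : (0 < m1 * m2)%N by rewrite muln_gt0 m10.
have H (w : T) : (w ^+ (N ^ (m1 * m2)) = w)%g ->
    w = ((w ^+ N) ^+ (N ^ (m1 * m2).-1))%g.
  by move=> hw; rewrite -expgnA -expnS prednK.
have /H e1 : (w1 ^+ (N ^ (m1 * m2)) = w1)%g by exact: period_mul.
have /H e2 : (w2 ^+ (N ^ (m1 * m2)) = w2)%g by rewrite mulnC; exact: period_mul.
by apply: (etrans e1); rewrite e; exact: esym e2.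
Qed.

Lemma preimage_mass y : exists2 w, (w ^+ N = y)%g & W w != 0.
Proof.
have [x <-] := expi_surj y; apply/not_exists2P => h.
have := W_sum x; rewrite big1 => [/esym/eqP|k _].
  by rewrite gt_eqF.
by have [|/negP] := h (nroot N x k); [rewrite nrootX|rewrite negbK => /eqP].
Qed.

Lemma backward_point y L : M y -> exists2 w, M w & (w ^+ (N ^ L) = y)%g.
Proof.
move=> My; elim: L => [|L [w Mw wy]]; first by exists y => //; rewrite expn0 expg1.
have [v vw Wv] := preimage_mass w; exists v.
  by apply: M_back => //; rewrite vw.
by rewrite expnS expgnA vw.
Qed.

(** The backward orbit of a point which is not periodic never returns to a
    point, so it meets the finitely many zeros of the weight at finitely many
    levels. *)
Lemma zero_levels y : ~ periodic_point y ->
  exists L, forall w a, (L <= a)%N -> (w ^+ (N ^ a) = y)%g -> W w != 0.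
Proof.
move=> np; have /finite_seqP[s sE] := W_zeros.
have H w : exists l, forall a, (w ^+ (N ^ a) = y)%g -> (a < l)%N.
  have [[b hb]|nb] := pselect (exists b, (w ^+ (N ^ b) = y)%g); last first.
    by exists 0%N => a ha; exfalso; apply: nb; exists a.
  exists b.+1 => a ha; rewrite ltnS leqNgt; apply/negP => ba; apply: np.
  exists (a - b)%N; first by rewrite subn_gt0.
  by rewrite -{1}hb expg_pow subnKC// ltnW.
(* beyond the sum of the levels of all zeros, no zero is left *)
have [l hl] := choice H.
exists (\sum_(w <- s) l w)%N => w a La wy; apply/eqP => Ww.
have ws : w \in s by have : [set w | W w = 0] w by []; rewrite sE.
have := hl w a wy; rewrite ltnNge => /negP; apply; apply: leq_trans La.
by rewrite (big_rem w)//= leq_addr.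
Qed.

(** The [N^m]-th roots of [y] are spaced by [2 pi / N^m], and [M] is closed. *)
Lemma backward_dense y : (forall m w, (w ^+ (N ^ m) = y)%g -> M w) ->
  forall x, M (expi x).
Proof.
move=> My x; apply: contrapT => nMx.
have : open (~` [set x | M (expi x)]) by rewrite openC.
rewrite openE => /(_ x nMx) /nbhs_ballP[d /= d0 hd].
have [b hb] := expi_surj y.
have p0 := twopi_gt0 R.
have [m hm] : exists m, 2 * pi / (N ^ m)%:R < d.
  have [m hm] : exists m : nat, 2 * pi / d < m%:R.
    exists (Num.truncn (2 * pi / d)).+1; exact: truncnS_gt.
  exists m; rewrite ltr_pdivrMr ?ltr0n ?expn_gt0 ?N_gt0// [d * _]mulrC.
  rewrite -ltr_pdivrMr//; apply: lt_trans hm _.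
  by rewrite ltr_nat ltn_expl.
have Nm0 : 0 < (N ^ m)%:R :> R by rewrite ltr0n expn_gt0 N_gt0.
pose k := Num.floor ((x * (N ^ m)%:R - b) / (2 * pi)).
pose t := (b + 2 * pi * k%:~R) / (N ^ m)%:R.
have tM : M (expi t).
  apply: (My m); rewrite -expiMn /t mulrC mulfVK ?lt0r_neq0//.
  by rewrite expi_periodic.
apply: (hd t) => //; rewrite /ball/=.
have /andP[] := floor_itv ((x * (N ^ m)%:R - b) / (2 * pi)).
rewrite ler_pdivlMr// ltr_pdivrMr// intrD -/k => h1 h2.
apply: le_lt_trans hm; rewrite /t.
rewrite ler_norml; apply/andP; split.
  rewrite -subr_ge0 opprK; apply: addr_ge0; last by rewrite divr_ge0 ?ltW.
  by rewrite subr_ge0 ler_pdivrMr//; lra.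
rewrite lerBlDr -mulrDl ler_pdivlMr//; lra.
Qed.

(** A non-periodic point of [M] has, far enough back, a preimage whose whole
    backward orbit avoids the zeros of [W]; then [M] is everything.  If all points
    of [M] are periodic, each of them has a single preimage in [M], which carries
    the whole mass [N], so their orbits are in [cyc]. *)
Lemma backward_closed_meets : (exists y, M y) -> (exists u, cyc u) ->
  exists2 u, cyc u & M u.
Proof.
move=> [y0 My0] [u0 cu0].
have [[y My np]|allp] := pselect (exists2 y, M y & ~ periodic_point y).
  have [L hL] := zero_levels np.
  have [y' My' y'y] := backward_point L My.
  have D m w : (w ^+ (N ^ m) = y')%g -> M w.
    elim: m w => [|m IH] w; first by rewrite expn0 expg1 => ->.
    rewrite expnS expgnA => hw; apply: M_back; first exact: IH.
    apply: (hL _ (m.+1 + L)%N); first exact: leq_addl.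
    by rewrite -expg_pow expnS expgnA hw.
  have [x xu] := expi_surj u0.
  by exists u0 => //; rewrite -xu; apply: backward_dense D x.
have pM y : M y -> periodic_point y.
  by move=> My; apply: contrapT => np; apply: allp; exists y.
have [m m0 hm] := pM y0 My0.
have step y : periodic_point y -> M (y ^+ N)%g -> M y /\ W y = N%:R.
  move=> py MyN; have [w wN Ww] := preimage_mass (y ^+ N)%g.
  have Mw : M w by apply: M_back => //; rewrite wN.
  have wy : w = y by apply: periodic_unique => //; exact: pM.
  rewrite wy in Mw; split=> //.
  have [x hx] := expi_surj (y ^+ N)%g.
  have [k yk] := nroot_surj N_gt0 (esym hx).
  rewrite -(W_sum x) (bigD1 k)//= -yk big1 ?addr0// => j jk.
  apply/eqP; apply: contraNT jk => Wj.
  have Mj : M (nroot N x j) by apply: M_back => //; rewrite nrootX// hx.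
  apply/eqP/(nroot_inj N_gt0 (x := x)); rewrite -yk.
  apply: periodic_unique => //; first exact: pM.
  by rewrite nrootX.
have pj j : periodic_point (y0 ^+ (N ^ j))%g.
  by exists m => //; rewrite expg_pow addnC -expg_pow hm.
have D j K : M (y0 ^+ (N ^ (j + K)))%g -> M (y0 ^+ (N ^ j))%g.
  elim: K => [|K IH]; first by rewrite addn0.
  move=> h; apply: IH.
  have hN : M ((y0 ^+ (N ^ (j + K))) ^+ N)%g.
    by rewrite -expgnA mulnC -expnS -addnS.
  exact: (step _ (pj _) hN).1.
have Mj j : M (y0 ^+ (N ^ j))%g.
  apply: (D _ (m * j - j)%N); rewrite subnKC ?leq_pmull//.
  by rewrite period_mul.
exists y0 => //; apply: (W_cycle m0 hm) => j.
have hN : M ((y0 ^+ (N ^ j)) ^+ N)%g by rewrite -expgnA mulnC -expnS.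
exact: (step _ (pj j) hN).2.
Qed.

End BackwardClosed.

(** * The harmonic function of the cycles *)

Section EsumFacts.
Variable R : realType.
Local Open Scope ereal_scope.

Lemma esum_finType (I : finType) (a : I -> \bar R) : (forall i, 0 <= a i) ->
  \esum_(i in [set: I]) a i = \sum_i a i.
Proof.
move=> a0; rewrite esum_fset//; last exact: finite_finset.
rewrite (fsbigE (enum I)) ?enum_uniq//; last by move=> i _; rewrite mem_enum.
by rewrite big_enum_cond/=; apply: eq_bigl => i; rewrite in_setT.
Qed.

Lemma esumZl (I : choiceType) (A : set I) (k : R) (a : I -> \bar R) :
  (0 <= k)%R -> (forall i, 0 <= a i) ->
  \esum_(i in A) (k%:E * a i) = k%:E * \esum_(i in A) a i.
Proof.
have H (r : R) (b : I -> \bar R) : (0 <= r)%R -> (forall i, 0 <= b i) ->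
    \esum_(i in A) (r%:E * b i) <= r%:E * \esum_(i in A) b i.
  move=> r0 b0; apply: ge_ereal_sup => _ [F [finF FA] <-].
  rewrite fsbig_finite//= -ge0_sume_distrr//.
  rewrite lee_wpmul2l ?lee_fin// -fsbig_finite//.
  by apply: ereal_sup_ubound; exists F.
move=> k0 a0; apply/eqP; rewrite eq_le H//=.
have [->|kn0] := eqVneq k 0%R.
  by rewrite mul0e esum_ge0// => i _; rewrite mul0e.
have kp : (0 < k)%R by rewrite lt_neqAle eq_sym kn0.
have h : \esum_(i in A) a i <= k^-1%:E * \esum_(i in A) (k%:E * a i).
  apply: (@le_trans _ _ (\esum_(i in A) (k^-1%:E * (k%:E * a i)))).
    by apply: le_esum => i _; rewrite muleA -EFinM mulVf// mul1e.
  apply: H; first by rewrite invr_ge0.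
  by move=> i; rewrite mule_ge0.
have := @lee_pmul2l _ k%:E isT _ (\esum_(i in A) a i)
  (k^-1%:E * \esum_(i in A) (k%:E * a i)).
rewrite lte_fin kp => /(_ isT); rewrite h => /idP.
by rewrite muleA -EFinM mulfV// mul1e.
Qed.

End EsumFacts.

Lemma continuous_sum (R : realType) (I : Type) (r : seq I) (f : I -> R -> R) :
  (forall i, continuous (f i)) -> continuous (fun x => \sum_(i <- r) f i x).
Proof.
move=> fc; elim: r => [|i r IH] x.
  by under eq_fun do rewrite big_nil; exact: cvg_cst.
by under eq_fun do rewrite big_cons; apply: cvgD; [exact: fc|exact: IH].
Qed.

Section Harmonic.
Variables (R : realType) (N : nat) (P : finType).
Local Notation T := (circle R).
Local Notation mu := (@lebesgue_measure R).
Hypothesis N_ge2 : (2 <= N)%N.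
Variables (Z : P -> T) (s : P -> P) (W : T -> R) (q : P -> R -> R).
Hypothesis Z_inj : injective Z.
Hypothesis s_bij : bijective s.
Hypothesis Z_succ : forall u, (Z u ^+ N)%g = Z (s u).
Hypothesis W_ge0 : forall z, 0 <= W z.
Hypothesis W_sum : forall x, \sum_(k < N) W (nroot N x k) = N%:R.
Hypothesis W_zeros : finite_set [set w | W w = 0].
Hypothesis W_cycle : forall y m, (0 < m)%N -> (y ^+ (N ^ m) = y)%g ->
  (forall j, W (y ^+ (N ^ j))%g = N%:R) -> exists u, y = Z u.
Hypothesis P_ex : exists u : P, True.
Hypothesis q_ge0 : forall u t, 0 <= q u t.
Hypothesis q_le1 : forall u t, q u t <= 1.
Hypothesis q_0 : forall u, q u 0 = 1.
Hypothesis q_cont : forall u, continuous (q u).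
Hypothesis q_scaling : forall u t,
  W (Z u * expi t)%g * q u t = N%:R * q (s u) (N%:R * t).

Let N_gt0 : (0 < N)%N. Proof. exact: ltnW. Qed.
Let N0 : 0 < N%:R :> R. Proof. by rewrite ltr0n. Qed.

Definition lifts (D : set R) (z : T) : set (P * R) :=
  [set v | D v.2 /\ (Z v.1 * expi v.2)%g = z].

Definition lift_sum (D : set R) (z : T) : \bar R :=
  (\esum_(v in lifts D z) (q v.1 v.2)%:E)%E.

Lemma lift_sum_ge0 D z : (0 <= lift_sum D z)%E.
Proof. by apply: esum_ge0 => v _; rewrite lee_fin. Qed.

(** The map [(u, t) |-> (s u, N t)] is a bijection from the lifts of the [N]-th
    roots of [expi x] onto the lifts of [expi x]; [q_scaling] compares the
    densities along it. *)
Lemma lift_sum_transfer (D : set R) (x : R) :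
  (N%:R%:E * lift_sum [set t : R | D (t / N%:R)%R] (expi x) =
  \sum_(k < N) (W (nroot N x k))%:E * lift_sum D (nroot N x k))%E.
Proof.
have q0 v : (0 <= (q v.1 v.2)%:E :> \bar R)%E by rewrite lee_fin.
have E (k : 'I_N) : ((W (nroot N x k))%:E * lift_sum D (nroot N x k) =
    \esum_(v in lifts D (nroot N x k)) (N%:R * q (s v.1) (N%:R * v.2)%R)%:E)%E.
  rewrite -esumZl//; apply: eq_esum => -[u t] [_ /= <-].
  by rewrite -EFinM q_scaling.
under eq_bigr do rewrite E.
have nq0 (v : P * R) : (0 <= (N%:R * q (s v.1) (N%:R * v.2)%R)%:E :> \bar R)%E.
  by rewrite lee_fin mulr_ge0// ltW.
rewrite -(esum_finType (a := fun k : 'I_N => \esum_(v in lifts D (nroot N x k))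
   (N%:R * q (s v.1) (N%:R * v.2)%R)%:E)%E); last first.
  by move=> k; apply: esum_ge0.
rewrite esum_esum// -esumZl ?ltW//.
have [s' sK s'K] := s_bij.
rewrite (reindex_esum ([set: 'I_N] `*`` (fun k : 'I_N => lifts D (nroot N x k)))
   _ (fun kv => (s kv.2.1, N%:R * kv.2.2)))//=.
split.
- move=> [k [u t]] /= [_ [Dt e]]; split => /=.
    by rewrite mulrAC mulfV ?mul1r// lt0r_neq0.
  by rewrite -Z_succ expiMn -circle_expgMn e nrootX.
- move=> [k [u t]] [k' [u' t']]; rewrite !inE /= => -[_ [_ e]] [_ [_ e']] [uu' tt'].
  have uu : u = u' by exact: (can_inj sK).
  have tt : t = t' by apply: mulfI tt'; exact: lt0r_neq0.
  by subst; congr (_, _); apply: (nroot_inj N_gt0 (x := x)); rewrite -e -e'.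
- move=> [v y] /= [Dy e].
  have [k hk] : exists k : 'I_N, (Z (s' v) * expi (y / N%:R))%g = nroot N x k.
    apply: nroot_surj => //.
    by rewrite circle_expgMn Z_succ s'K -expiMn mulrC mulfVK// lt0r_neq0.
  exists (k, (s' v, y / N%:R)) => /=; first by split.
  by rewrite s'K mulrC mulfVK// lt0r_neq0.
Qed.

(** Two lifts near [0] of the same point would come from two points [Z u] and
    [Z u'] too close to each other, unless [u = u']. *)
Lemma lifts_separated : exists2 e : R, 0 < e & forall u t u' t',
  `|t| <= e -> `|t'| <= e -> (Z u * expi t = Z u' * expi t')%g ->
  u = u' /\ t = t'.
Proof.
have p0 := pi_gt0 R.
pose dist u u' : R := Num.sqrt (sqmod (val (Z u) - val (Z u'))).
have dist_gt0 u u' : u != u' -> 0 < dist u u'.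
  move=> uu'; rewrite sqrtr_gt0 lt_neqAle sqmod_ge0 andbT eq_sym.
  apply: contra uu' => /eqP/sqmod_eq0/eqP; rewrite subr_eq0 => /eqP h.
  by apply/eqP/Z_inj/val_inj.
(* a third of the distances, so that two errors [e] do not fill them; at most
   [1] so that [t] and [t'] cannot differ by a multiple of [2 pi] *)
pose e : R := \big[Num.min/1]_(v : P * P | v.1 != v.2) (dist v.1 v.2 / 3).
have e0 : 0 < e.
  rewrite /e; apply: (big_ind (fun x : R => 0 < x)) => //.
    by move=> x y x0 y0; rewrite lt_min x0.
  by move=> v v12; rewrite divr_gt0// dist_gt0.
have e1 : e <= 1.
  by rewrite /e; elim/big_rec: _ => // v y _ y1; rewrite ge_min y1 orbT.
exists e => // u t u' t' te te' h.
have uu' : u = u'.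
  apply/eqP/negPn/negP => uu'.
  have : e <= dist u u' / 3 by apply: (bigmin_inf (u, u')).
  have : dist u u' <= `|t - t'|.
    rewrite -lecR /dist -normE_sqmod.
    have -> : val (Z u) - val (Z u') = val (Z u') * (val (expi (t' - t)) - val (1%g : T)).
      rewrite mulrBr circle_val1 mulr1; congr (_ - _).
      rewrite expiD -circle_valM; congr val.
      have -> : expi (- t) = ((expi t)^-1)%g.
        by apply: (@circle_mulgI _ (expi t)); rewrite -expiD subrr expi0 mulgV.
      by rewrite mulgA -h mulgK.
    rewrite normrM circle_norm mul1r -expi0 (le_trans (expi_lip _ _))//.
    by rewrite subr0 lecR distrC.
  have : `|t - t'| <= `|t| + `|t'| by exact: ler_normB.
  by have := dist_gt0 _ _ uu'; move: te te'; lra.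
split=> //; move: h; rewrite uu' => /circle_mulgI /expi_inj_lift[j tj].
have j0 : j = 0.
  apply/eqP; rewrite -absz_eq0; apply/negP => /negP; rewrite -lt0n => j1.
  have : `|t - t'| <= `|t| + `|t'| by exact: ler_normB.
  rewrite {1}tj addrAC subrr add0r normrM (ger0_norm (ltW (twopi_gt0 R))).
  have : 1 <= `|j%:~R : R| by rewrite -intr_norm -[1]/(1%:~R) ler_int; lia.
  have := pi_ge2 R; move: te te' e1; nra.
by rewrite tj j0 mulr0 addr0.
Qed.

(** A single lift lies in the window [|t| <= e].  Averaging over the [N]-th roots
    with total weight [N] carries the bound to the window [|t| <= e N], and so on;
    a finite set of lifts lies in one of these windows. *)
Lemma lift_sum_le1 z : (lift_sum setT z <= 1)%E.
Proof.
have [e e0 he] := lifts_separated.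
pose D n : set R := [set t | `|t| <= e * N%:R ^+ n].
have H n : forall z, (lift_sum (D n) z <= 1)%E.
  elim: n => [|n IH] {}z.
    have [[v0 v0z]|nv] := pselect (exists v0, lifts (D 0%N) z v0); last first.
      rewrite /lift_sum (_ : lifts _ _ = set0) ?esum_set0 ?lee_fin//.
      by rewrite -subset0 => v hv; apply: nv; exists v.
    rewrite /lift_sum (_ : lifts _ _ = [set v0]) ?esum_set1 ?lee_fin//.
    apply/seteqP; split=> [[u t] h|v -> //].
    case: v0 v0z h => u0 t0; rewrite /lifts /D /= expr0 mulr1 => -[t0e e0z] [te ez].
    by have [] := he u t u0 t0 te t0e; [rewrite ez e0z|move=> -> ->].
  have [x <-] := expi_surj z.
  rewrite -(@lee_pmul2l _ N%:R%:E)// ?lte_fin// mule1.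
  have -> : D n.+1 = [set t | D n (t / N%:R)].
    apply/seteqP; split => t; rewrite /D /= normrM normfV (ger0_norm (ltW N0));
      by rewrite ler_pdivrMr// exprSr mulrA.
  rewrite lift_sum_transfer -(W_sum x) -sumEFin; apply: lee_sum => k _.
  by rewrite -[leRHS]mule1 lee_wpmul2l ?lee_fin.
apply: ge_ereal_sup => _ [F [finF FL] <-].
have [n hn] : exists n, F `<=` lifts (D n) z.
  have /finite_seqP[r rF] := finF.
  have [n hn] : exists n, (\sum_(v <- r) `|v.2|) / e < n%:R :> R.
    by exists (Num.truncn ((\sum_(v <- r) `|v.2|) / e)).+1; exact: truncnS_gt.
  exists n => v Fv; split; last by have [] := FL v Fv.
  have vr : v \in r by move: Fv; rewrite rF.
  rewrite /D /= (@le_trans _ _ (\sum_(v <- r) `|v.2|))//.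
    by rewrite (big_rem v)//= lerDl sumr_ge0.
  move: hn; rewrite ltr_pdivrMr// mulrC => /ltW h; apply: le_trans h _.
  by rewrite ler_pM2l// -natrX ler_nat ltnW// ltn_expl.
apply: le_trans (H n z); apply: ereal_sup_ubound; exists F => //.
Qed.

Lemma lift_sum_fin z : lift_sum setT z \is a fin_num.
Proof.
by rewrite ge0_fin_numE ?lift_sum_ge0// (le_lt_trans (lift_sum_le1 z))// ltry.
Qed.

Definition harm (z : T) : R := fine (lift_sum setT z).

Lemma harmE z : lift_sum setT z = (harm z)%:E.
Proof. by rewrite fineK// lift_sum_fin. Qed.

Lemma harm_le1 z : harm z <= 1.
Proof. by rewrite -lee_fin -harmE lift_sum_le1. Qed.

Lemma harm_ge0 z : 0 <= harm z.
Proof. by rewrite -lee_fin -harmE lift_sum_ge0. Qed.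

Lemma harm_transfer x :
  N%:R * harm (expi x) = \sum_(k < N) W (nroot N x k) * harm (nroot N x k).
Proof.
apply: EFin_inj; rewrite EFinM -harmE.
have := lift_sum_transfer setT x.
rewrite (_ : [set t | _] = setT); last by apply/seteqP.
move=> ->; rewrite -sumEFin; apply: eq_bigr => k _.
by rewrite EFinM -harmE.
Qed.

Lemma harm_cycle u : 1 <= harm (Z u).
Proof.
rewrite -lee_fin -harmE -(q_0 u); apply: (@esum_ge _ _ _ _ _).
exists [set (u, 0)]; first split.
- exact: finite_set1.
- by move=> v ->; split=> //=; rewrite expi0 mulg1.
- by rewrite fsbig_set1.
Qed.

Variable a : P -> R.
Hypothesis Z_arg : forall u, expi (a u) = Z u.

Definition translate (u : P) (n : nat) (x : R) : R :=
  x - a u + 2 * pi * (zenum n)%:~R.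

Lemma lift_sum_series x : lift_sum setT (expi x) =
  (\sum_(n <oo) (\sum_u q u (translate u n x))%:E)%E.
Proof.
rewrite nneseries_esumT; last by move=> n; rewrite lee_fin sumr_ge0.
have -> : (fun n => (\sum_u q u (translate u n x))%:E) =
    (fun n => \esum_(u in [set: P]) (q u (translate u n x))%:E)%E.
  apply/funext => n; rewrite esum_finType ?sumEFin// => u.
  by rewrite lee_fin.
rewrite (esum_esum (a := fun n u => (q u (translate u n x))%:E))//; last first.
  by move=> n u; rewrite lee_fin.
rewrite /lift_sum (reindex_esum ([set: nat] `*`` (fun=> [set: P])) _
   (fun nu => (nu.2, translate nu.2 nu.1 x)))//=.
have p0 := twopi_gt0 R.
split.
- move=> [n u] _; split=> //=.
  rewrite -Z_arg -expiD /translate addrA [a u + _]addrC subrK.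
  exact: expi_periodic.
- move=> [n u] [n' u'] _ _ /= [uu' e]; move: e; rewrite -uu' => /addrI/mulfI e.
  have {}e : zenum n = zenum n'.
    by apply/eqP; rewrite -(eqr_int R); apply/eqP/e/lt0r_neq0.
  by rewrite -(zenumK n) e zenumK.
- move=> [u t] [_ /=]; rewrite -Z_arg -expiD => /expi_inj_lift[j e].
  exists (zrank j, u) => //=; congr (_, _).
  by rewrite /translate zrankK; lra.
Qed.

(** The sums are cut in this enumeration to have an increasing sequence of
    continuous functions. *)
Definition partial (M : nat) (x : R) : R :=
  \sum_(n < M) \sum_u q u (translate u n x).

Lemma partial_cont M : continuous (partial M).
Proof.
apply: continuous_sum => n; apply: continuous_sum => u x.
apply: (@continuous_comp _ _ _ (translate u n) (q u)); last exact: q_cont.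
by apply: cvgD; [apply: cvgB; [exact: cvg_id|exact: cvg_cst]|exact: cvg_cst].
Qed.

Lemma partial_harm (x c : R) :
  (forall M, partial M x <= c) <-> harm (expi x) <= c.
Proof.
rewrite -lee_fin -harmE lift_sum_series; split=> h.
  apply: lime_le.
    by apply: is_cvg_nneseries => n _ _; rewrite lee_fin sumr_ge0.
  by apply: nearW => M; rewrite big_mkord sumEFin lee_fin; exact: h.
move=> M; rewrite -lee_fin; apply: le_trans h.
rewrite /partial -sumEFin -(big_mkord xpredT (fun n => (\sum_u q u (translate u n x))%:E)).
by apply: nneseries_lim_ge => n _; rewrite lee_fin sumr_ge0.
Qed.

Lemma partial_mono x M K : (M <= K)%N -> partial M x <= partial K x.
Proof.
move=> MK; rewrite /partial -!(big_mkord xpredT (fun n => \sum_u q u (translate u n x))).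
rewrite (big_cat_nat (leq0n M) MK)/= lerDl sumr_ge0// => n _.
by rewrite sumr_ge0.
Qed.

(** The partial sums [partial M] are continuous and increase to [harm]: any
    cluster point of their minimizers over a period minimizes [harm]. *)
Lemma harm_min : exists x0, forall z, harm (expi x0) <= harm z.
Proof.
pose A : set R := range harm.
have A0 : A !=set0 by exists (harm 1%g), 1%g.
have Alb : has_lbound A by exists 0 => _ [z _ <-]; exact: harm_ge0.
pose c := inf A.
have ch z : c <= harm z by apply: ge_inf => //; exists z.
have p0 := twopi_gt0 R.
have /choice[x_ hx_] (M : nat) : exists x : R,
    x \in `[0, 2 * pi] /\ partial M x <= c.
  have [] := @EVT_min _ (partial M) 0 (2 * pi) (ltW p0).
    by apply: continuous_subspaceT; exact: partial_cont.
  move=> x xI hx; exists x; split=> //.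
  apply: lb_le_inf => // _ [z _ <-].
  have [y yz] := expi_surj z.
  pose y' := y - 2 * pi * (Num.floor (y / (2 * pi)))%:~R.
  have y'I : y' \in `[0, 2 * pi].
    have /andP[] := floor_itv (y / (2 * pi)).
    rewrite ler_pdivlMr// ltr_pdivrMr// intrD /y' in_itv/= => h1 h2.
    by apply/andP; split; lra.
  have y'z : expi y' = z by rewrite /y' -mulrN -mulrNz expi_periodic.
  apply: (le_trans (hx _ y'I)); rewrite -y'z.
  exact: (partial_harm y' _).2 (lexx _) M.
have [x [_ xcl]] : `[0, 2 * pi]%classic `&` cluster (x_ @ \oo) !=set0.
  apply: (@segment_compact R 0 (2 * pi)).
  by exists 0%N => // M _; have [] := hx_ M.
exists x => z; apply: le_trans (ch z).
apply/partial_harm => K; rewrite leNgt; apply/negP => cK.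
have : nbhs x [set t | c < partial K t].
  have := @partial_cont K x; move=> /cvgr_gt; apply; exact: cK.
move=> nx; have := xcl [set t | partial K t <= c] [set t | c < partial K t].
case=> //.
  exists K => // M /= KM; apply: le_trans (hx_ M).2; exact: partial_mono.
by move=> t [/= h1 h2]; move: h1; rewrite leNgt h2.
Qed.

(** By harmonicity, a root of positive weight of a minimizer is a minimizer; the
    set of minimizers, being closed, contains some [Z u], where [harm >= 1]. *)
Lemma harm1 z : harm z = 1.
Proof.
apply/eqP; rewrite eq_le harm_le1/=.
have [x0 hmin] := harm_min.
apply: le_trans (hmin z).
pose c := harm (expi x0).
have hc w : harm w <= c -> harm w = c.
  by move=> h; apply/eqP; rewrite eq_le h hmin.
have [u [u' uu'] hu] : exists2 y, (exists u, y = Z u) & harm y <= c.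
  apply: (@backward_closed_meets R N N_ge2 W [set y | harm y <= c]
    [set y | exists u, y = Z u]) => //.
  - rewrite (_ : [set x | _] = \bigcap_M [set x | partial M x <= c]).
      apply: closed_bigI => M _.
      have := @closed_comp _ _ (partial M) [set t | t <= c].
      apply; last exact: closed_le.
      by move=> x _; exact: partial_cont.
    apply/seteqP; split => x /=; first by move=> /partial_harm h M _; exact: h.
    by move=> h; apply/partial_harm => M; exact: h.
  - move=> w /= hw Ww; have [x ex] := expi_surj (w ^+ N)%g.
    have [k wk] := nroot_surj N_gt0 (esym ex).
    have : \sum_(k < N) W (nroot N x k) * (harm (nroot N x k) - c) = 0.
      under eq_bigr do rewrite mulrBr.
      rewrite sumrB -harm_transfer -mulr_suml W_sum ex (hc _ hw) subrr//.
    move=> /eqP; rewrite psumr_eq0; last first.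
      by move=> j _; rewrite mulr_ge0// subr_ge0 hmin.
    move=> /allP/(_ k); rewrite mem_index_enum => /(_ isT) /=.
    by rewrite -wk mulf_eq0 (negbTE Ww)/= subr_eq0 => /eqP ->.
  - by exists (expi x0) => /=.
  - by have [u _] := P_ex; exists (Z u), u.
by apply: le_trans hu; rewrite uu' harm_cycle.
Qed.

Theorem translates_sum1 x : (\sum_(n <oo) (\sum_u q u (translate u n x))%:E = 1)%E.
Proof. by rewrite -lift_sum_series harmE harm1. Qed.

End Harmonic.

(** * The scaling functions *)

Section ComplexLimits.
Variable R : realType.
Local Notation C := R[i].
Local Notation Re := complex.Re.
Local Notation Im := complex.Im.
Implicit Types (a b c : C) (v w : nat -> C).

(** Real-valued, for use in real limits and Lipschitz bounds; the norm of a complex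
    number is itself complex. *)
Definition cabs a : R := Num.sqrt (sqmod a).

Lemma cabs_norm a : `|a| = (cabs a)%:C.
Proof. exact: normE_sqmod. Qed.

Lemma cabs_ge0 a : 0 <= cabs a.
Proof. exact: sqrtr_ge0. Qed.

Lemma cabs_sq a : cabs a ^+ 2 = sqmod a.
Proof. by rewrite sqr_sqrtr// sqmod_ge0. Qed.

Lemma cabsM a b : cabs (a * b) = cabs a * cabs b.
Proof. by rewrite /cabs sqmodM sqrtrM// sqmod_ge0. Qed.

Lemma cabs1 : cabs 1 = 1.
Proof. by rewrite /cabs sqmod1 sqrtr1. Qed.

Lemma cabsD a b : cabs (a + b) <= cabs a + cabs b.
Proof. by have := ler_normD a b; rewrite !cabs_norm -rmorphD lecR. Qed.

Lemma cabsR (r : R) : 0 <= r -> cabs r%:C = r.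
Proof. by move=> r0; rewrite /cabs sqmodR sqrtr_sqr ger0_norm. Qed.

Lemma cabs_circle (z : circle R) : cabs (val z) = 1.
Proof. by rewrite /cabs sqmod_circle sqrtr1. Qed.

Lemma cabs_prod (I : Type) (r : seq I) (F : I -> C) :
  (forall i, cabs (F i) <= 1) -> cabs (\prod_(i <- r) F i) <= 1.
Proof.
move=> F1; elim/big_ind: _ => [|x y x1 y1|i _]; rewrite ?cabs1//.
by rewrite cabsM mulr_ile1// cabs_ge0.
Qed.

(** Telescoping: the factors are exchanged one at a time, the others having
    modulus at most [1]. *)
Lemma cabs_prodB (I : Type) (r : seq I) (F G : I -> C) :
  (forall i, cabs (F i) <= 1) -> (forall i, cabs (G i) <= 1) ->
  cabs (\prod_(i <- r) F i - \prod_(i <- r) G i) <= \sum_(i <- r) cabs (F i - G i).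
Proof.
move=> F1 G1; elim: r => [|i r IH].
  by rewrite !big_nil subrr /cabs sqmod0 sqrtr0.
rewrite !big_cons.
set f := \prod_(_ <- r) _ in IH *; set g := \prod_(_ <- r) _ in IH *.
have -> : F i * f - G i * g = (F i - G i) * f + G i * (f - g) by ring.
apply: le_trans (cabsD _ _) _; rewrite !cabsM lerD//.
  by rewrite ler_piMr ?cabs_ge0//; exact: cabs_prod.
by apply: le_trans IH; rewrite ler_piMl ?cabs_ge0.
Qed.

Definition ccvg v a : Prop :=
  (fun n => Re (v n)) @ \oo --> Re a /\ (fun n => Im (v n)) @ \oo --> Im a.

Lemma ccvgM v w a b : ccvg v a -> ccvg w b -> ccvg (fun n => v n * w n) (a * b).
Proof.
move=> [v1 v2] [w1 w2]; split.
  by rewrite ReM; under eq_fun do rewrite ReM; apply: cvgB; apply: cvgM.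
by rewrite ImM; under eq_fun do rewrite ImM; apply: cvgD; apply: cvgM.
Qed.

Lemma ccvgB v w a b : ccvg v a -> ccvg w b -> ccvg (fun n => v n - w n) (a - b).
Proof.
move=> [v1 v2] [w1 w2]; split.
  rewrite complex_ReD ReN; under eq_fun do rewrite complex_ReD ReN.
  exact: cvgB.
rewrite complex_ImD ImN; under eq_fun do rewrite complex_ImD ImN.
exact: cvgB.
Qed.

Lemma ccvg_cst a : ccvg (fun=> a) a.
Proof. by split; exact: cvg_cst. Qed.

Lemma ccvg_unique v a b : ccvg v a -> ccvg v b -> a = b.
Proof.
move=> [v1 v2] [w1 w2].
by apply: complex_eq; [exact: cvg_unique v1 w1|exact: cvg_unique v2 w2].
Qed.

Lemma ccvg_sqmod v a : ccvg v a -> (fun n => sqmod (v n)) @ \oo --> sqmod a.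
Proof.
move=> [v1 v2]; rewrite /sqmod; apply: cvgD.
  by under eq_fun do rewrite expr2; rewrite expr2; apply: cvgM.
by under eq_fun do rewrite expr2; rewrite expr2; apply: cvgM.
Qed.

Lemma ccvg_cabs_le v a (e : R) : 0 <= e -> ccvg v a ->
  (forall n, cabs (v n) <= e) -> cabs a <= e.
Proof.
move=> e0 /ccvg_sqmod va ve.
rewrite -(ger0_norm e0) -sqrtr_sqr ler_sqrt ?sqr_ge0//.
rewrite -(cvg_lim (@Rhausdorff R) va); apply: limr_le.
  by apply/cvg_ex; exists (sqmod a).
apply: nearW => n; rewrite -cabs_sq lerXn2r ?nnegrE ?cabs_ge0//.
Qed.

Lemma cabs_Re_le a : `|Re a| <= cabs a.
Proof. by rewrite -sqrtr_sqr ler_sqrt ?sqmod_ge0// Re_le_sqmod. Qed.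

Lemma cabs_Im_le a : `|Im a| <= cabs a.
Proof. by rewrite -sqrtr_sqr ler_sqrt ?sqmod_ge0// Im_le_sqmod. Qed.

Lemma ccvg_cabs v a : (fun n => cabs (v n - a)) @ \oo --> (0 : R) -> ccvg v a.
Proof.
move=> h; have h' : (fun n => - cabs (v n - a)) @ \oo --> (0 : R).
  by rewrite -oppr0; exact: cvgN.
have H (g : C -> R) : (forall x y, g (x - y) = g x - g y) ->
    (forall x, `|g x| <= cabs x) -> (fun n => g (v n)) @ \oo --> g a.
  move=> gB gle; apply/cvgrPdist_lt => e e0; move/cvgrPdist_lt : h => /(_ e e0).
  apply: filterS => n; rewrite sub0r normrN ger0_norm ?cabs_ge0//.
  by apply: le_lt_trans; rewrite distrC -gB.
split; apply: H.
- by move=> x y; rewrite complex_ReD ReN.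
- exact: cabs_Re_le.
- by move=> x y; rewrite complex_ImD ImN.
- exact: cabs_Im_le.
Qed.

Lemma ccvg_lim v a : ccvg v a -> limn (v : nat -> C^o) = a.
Proof.
move=> /ccvgB /(_ (ccvg_cst a)) /ccvg_sqmod; rewrite subrr sqmod0 => h.
apply: (cvg_lim (@norm_hausdorff _ C^o)); apply/cvgrPdist_lt => -[e e'].
rewrite ltcE /= => /andP[/eqP -> e0].
move/cvgrPdist_lt : h => /(_ (e ^+ 2)); rewrite exprn_gt0// => /(_ isT).
apply: filterS => n; rewrite sub0r normrN ger0_norm ?sqmod_ge0// => h.
rewrite distrC cabs_norm -[X in _ < X]/(e%:C) ltcR -(ger0_norm (ltW e0)).
by rewrite -sqrtr_sqr ltr_sqrt// exprn_gt0.
Qed.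

Lemma ccvg_geometric v (b : R) : 0 <= b ->
  (forall k, cabs (v k.+1 - v k) <= b * 2^-1 ^+ k) ->
  ccvg v (limn (v : nat -> C^o)).
Proof.
move=> b0 h.
have vc : ccvg v (Complex (limn (fun k => Re (v k))) (limn (fun k => Im (v k)))).
  split; apply: (geometric_cvg b0) => k; apply: le_trans (h k).
    by rewrite -ReN -complex_ReD; exact: cabs_Re_le.
  by rewrite -ImN -complex_ImD; exact: cabs_Im_le.
by rewrite (ccvg_lim vc).
Qed.

End ComplexLimits.

Section Filter.
Variables (R : realType) (N : nat) (m0 : circle R -> R[i]).
Local Notation C := R[i].
Local Notation T := (circle R).
Hypothesis N_ge2 : (2 <= N)%N.
Hypothesis m0_lip : lipschitz_circle m0.
Hypothesis m0_ruelle : forall z, ruelle N m0 (fun=> 1) z = 1.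

Let N_gt0 : (0 < N)%N. Proof. exact: ltnW. Qed.
Let N0 : 0 < N%:R :> R. Proof. by rewrite ltr0n. Qed.

(** This is [R_{m0,m0} 1 = 1] written over an explicit list of roots. *)
Lemma filter_sum (x : R) : \sum_(k < N) sqmod (m0 (nroot N x k)) = N%:R.
Proof.
have := m0_ruelle (expi x); rewrite /ruelle.
rewrite (fsbigE (map (fun k : 'I_N => nroot N x k) (enum 'I_N))); last 3 first.
- by rewrite map_inj_uniq ?enum_uniq//; exact: nroot_inj.
- by move=> w /= /mapP[k _ ->]; exact: nrootX.
- move=> w /= /(nroot_surj N_gt0)[k ->] /mapP[]; exists k => //.
  by rewrite mem_enum.
rewrite big_map big_mkcond big_enum/=.
have -> : \sum_(k < N) (if nroot N x k \in [set w | (w ^+ N)%g = expi x]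
    then `|m0 (nroot N x k)| ^+ 2 * 1 else 0) =
    (\sum_(k < N) sqmod (m0 (nroot N x k)))%:C.
  rewrite rmorph_sum; apply: eq_bigr => k _.
  by rewrite ifT ?mulr1 ?[RHS]sqmod_norm// inE /= nrootX.
have n0 : (N%:R : C) != 0 by rewrite pnatr_eq0 -lt0n.
move=> h; apply: complexI.
by apply: (mulfI (invr_neq0 n0)); rewrite h rmorph_nat mulVf.
Qed.

Lemma filter_bound z : cabs (m0 z) <= Num.sqrt N%:R.
Proof.
have [x hx] := expi_surj (z ^+ N)%g.
have [k zk] := nroot_surj N_gt0 (esym hx).
rewrite ler_sqrt ?(ltW N0)// -(filter_sum x) (bigD1 k)//= -zk lerDl sumr_ge0// => j _.
exact: sqmod_ge0.
Qed.

Lemma filter_lip : exists2 K : R, 0 <= K &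
  forall (w : T) x y, cabs (m0 (w * expi x)%g - m0 (w * expi y)%g) <= K * `|x - y|.
Proof.
have [K hK] := m0_lip; exists `|K| => // w x y.
rewrite -lecR -cabs_norm; apply: le_trans (hK _ _) _.
rewrite !circle_valM -mulrBr normrM circle_norm mul1r rmorphM.
apply: (@le_trans _ _ (`|K|%:C * `|val (expi x) - val (expi y)|)).
  by rewrite ler_wpM2r// lecR ler_norm.
by rewrite ler_wpM2l ?ler0c// expi_lip.
Qed.

End Filter.

Section CycleScaling.
Variables (R : realType) (N : nat) (m0 : circle R -> R[i]).
Local Notation C := R[i].
Local Notation T := (circle R).
Hypothesis N_ge2 : (2 <= N)%N.
Hypothesis m0_lip : lipschitz_circle m0.
Hypothesis m0_ruelle : forall z, ruelle N m0 (fun=> 1) z = 1.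
Variables (p : nat) (z : 'I_p -> T) (theta : 'I_p -> R).
Hypothesis z_cycle : is_cycle N m0 z.
Hypothesis z_angles : cycle_angles N m0 z theta.

Let N_gt0 : (0 < N)%N. Proof. exact: ltnW. Qed.
Let N0 : 0 < N%:R :> R. Proof. by rewrite ltr0n. Qed.
Let p_gt0 : (0 < p)%N. Proof. by case: z_cycle. Qed.
Let sN : R := Num.sqrt N%:R.
Let sN0 : 0 < sN. Proof. exact: sqrtN_gt0. Qed.
Let sNC : sN%:C != 0 :> C.
Proof. by rewrite (inj_eq (@complexI R)) lt0r_neq0. Qed.

Lemma cycle_succ k : (z k ^+ N)%g = z (ordS k).
Proof. by case: z_cycle. Qed.

Lemma cycle_iter k j : (z k ^+ (N ^ j))%g = z (iter j (@ordS p) k).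
Proof.
elim: j => [|j IH]; first by rewrite expn0 expg1.
by rewrite expnSr expgnA IH cycle_succ.
Qed.

Lemma val_iter_ordS (k : 'I_p) j : (iter j (@ordS p) k : nat) = ((k + j) %% p)%N.
Proof.
elim: j => [|j IH]; first by rewrite addn0 modn_small.
by rewrite /= IH addnS -addn1 modnDml addn1.
Qed.

Lemma iter_ordS_inj (k : 'I_p) : injective (fun j : 'I_p => iter j (@ordS p) k).
Proof.
move=> j j' /(congr1 (@nat_of_ord p)); rewrite !val_iter_ordS => /eqP.
by rewrite eqn_modDl !modn_small// => /eqP/val_inj.
Qed.

Lemma iter_ordS_period (k : 'I_p) : iter p (@ordS p) k = k.
Proof. by apply: val_inj; rewrite /= val_iter_ordS modnDr modn_small. Qed.

(** One turn around the cycle: the normalization makes it equal to [1] at [0], so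
    that the infinite product over shrinking arguments converges. *)
Definition turn (k : 'I_p) (t : R) : C :=
  val (expi (- \sum_j theta j)) *
  alpha (z k) (miter N p m0) (expi t) / (Num.sqrt (N%:R ^+ p))%:C.

Definition unit_filter (w : T) : C := m0 w / sN%:C.

Lemma cabs_unit_filter w : cabs (unit_filter w) <= 1.
Proof.
rewrite /unit_filter cabsM -[_^-1]/(sN%:C)^-1 -fmorphV/= cabsR ?invr_ge0 ?(ltW sN0)//.
by rewrite ler_pdivrMr// mul1r; exact: filter_bound.
Qed.

Lemma sqrtX (n : nat) : Num.sqrt (N%:R ^+ n) = sN ^+ n :> R.
Proof.
elim: n => [|n IH]; first by rewrite !expr0 sqrtr1.
by rewrite !exprS sqrtrM ?IH// (ltW N0).
Qed.

Lemma turnE k t : turn k t = val (expi (- \sum_j theta j)) *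
  \prod_(j < p) unit_filter ((z k * expi t) ^+ (N ^ j))%g.
Proof.
rewrite /turn /alpha /miter sqrtX rmorphXn -mulrA; congr (_ * _).
by rewrite /unit_filter prodf_div prodr_const card_ord.
Qed.

Lemma cabs_turn k t : cabs (turn k t) <= 1.
Proof.
rewrite turnE cabsM cabs_circle mul1r; apply: cabs_prod => j.
exact: cabs_unit_filter.
Qed.

Lemma unit_filter_cycle k : unit_filter (z k) = val (expi (theta k)).
Proof. by rewrite /unit_filter z_angles mulrAC mulfV ?mul1r. Qed.

Lemma expi_sum (I : finType) (f : I -> R) :
  val (expi (\sum_i f i)) = \prod_i val (expi (f i)).
Proof.
apply: (big_morph (fun t => val (expi t))); last by rewrite expi0.
by move=> x y; rewrite expiD.
Qed.

Lemma turn0 k : turn k 0 = 1.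
Proof.
rewrite turnE.
have -> : \prod_(j < p) unit_filter ((z k * expi 0) ^+ (N ^ j))%g =
    \prod_(j < p) val (expi (theta (iter j (@ordS p) k))).
  apply: eq_bigr => j _.
  by rewrite expi0 mulg1 cycle_iter unit_filter_cycle.
rewrite -(reindex_inj (@iter_ordS_inj k) (P := xpredT)
  (F := fun j => val (expi (theta j)))) -expi_sum.
by rewrite -circle_valM -expiD addNr expi0.
Qed.

Lemma turn_lip k : exists2 K : R, 0 <= K &
  forall t t', cabs (turn k t - turn k t') <= K * `|t - t'|.
Proof.
have [K K0 hK] := filter_lip m0_lip.
exists (\sum_(j < p) K * (N ^ j)%:R / sN).
  by apply: sumr_ge0 => j _; rewrite divr_ge0 ?mulr_ge0// (ltW sN0).
move=> t t'; rewrite !turnE -mulrBr cabsM cabs_circle mul1r.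
apply: le_trans (cabs_prodB _ _ _) _; try by move=> j; exact: cabs_unit_filter.
rewrite mulr_suml; apply: ler_sum => j _.
rewrite !circle_expgMn -!expiMn /unit_filter -mulrBl cabsM.
rewrite -[_^-1]/(sN%:C)^-1 -fmorphV/= cabsR ?invr_ge0 ?(ltW sN0)// mulrAC.
rewrite ler_pM2r ?invr_gt0//; apply: le_trans (hK _ _ _) _.
by rewrite -mulrBr normrM normr_nat mulrA.
Qed.

(** Both sides are the product of [m0] over [p + 1] consecutive powers of
    [z k * expi t]: the shift exchanges the first factor for the last one. *)
Lemma turn_shift k t :
  m0 (z k * expi t)%g * turn (ordS k) (N%:R * t) =
  turn k t * m0 (z k * expi ((N ^ p)%:R * t))%g.
Proof.
pose G j := unit_filter ((z k * expi t) ^+ (N ^ j))%g.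
have E0 : m0 (z k * expi t)%g = sN%:C * G 0%N.
  by rewrite /G /unit_filter expn0 expg1 [RHS]mulrC mulfVK.
have Ep : m0 (z k * expi ((N ^ p)%:R * t))%g = sN%:C * G p.
  rewrite /G /unit_filter circle_expgMn -expiMn cycle_iter iter_ordS_period.
  by rewrite [RHS]mulrC mulfVK.
have ES : turn (ordS k) (N%:R * t) =
    val (expi (- \sum_j theta j)) * \prod_(j < p) G j.+1.
  rewrite turnE; congr (_ * _); apply: eq_bigr => j _.
  by rewrite -cycle_succ expiMn -circle_expgMn -expgnA -expnS.
rewrite E0 Ep ES turnE.
have h : G 0%N * \prod_(j < p) G j.+1 = \prod_(j < p) G j * G p.
  transitivity (\prod_(j < p.+1) G j); first by rewrite big_ord_recl.
  by rewrite big_ord_recr.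
move: (\prod_(j < p) G j.+1) (\prod_(j < p) G j) h => A B h.
set c := val _.
transitivity (sN%:C * c * (G 0%N * A)); first by ring.
by rewrite h; ring.
Qed.

Definition turns (k : 'I_p) (n : nat) (x : R) : C :=
  \prod_(1 <= l < n.+1) turn k (x / N%:R ^+ (l * p)).

Lemma turnsS k n x :
  turns k n.+1 x = turns k n x * turn k (x / N%:R ^+ (n.+1 * p)).
Proof. by rewrite /turns big_nat_recr. Qed.

Lemma turns0 k x : turns k 0 x = 1.
Proof. by rewrite /turns big_geq. Qed.

Lemma cabs_turns k n x : cabs (turns k n x) <= 1.
Proof. by apply: cabs_prod => l; exact: cabs_turn. Qed.

(** [N^(l p) >= 2^l]: all the products of turns converge geometrically. *)
Lemma turns_decay (x : R) l : `|x / N%:R ^+ (l * p)| <= `|x| * 2^-1 ^+ l.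
Proof.
rewrite normrM ler_wpM2l// normfV ger0_norm ?exprn_ge0// exprVn.
rewrite lef_pV2 ?posrE ?exprn_gt0// -!natrX ler_nat.
apply: (@leq_trans (N ^ l)); first by case: l => // l; rewrite leq_exp2r.
by rewrite leq_exp2l// leq_pmulr.
Qed.

Lemma scaling_cvg k x :
  ccvg (fun n => turns k n x) (scaling_fun N m0 z theta k x).
Proof.
have [K K0 hK] := turn_lip k.
apply: (@ccvg_geometric _ (fun n => turns k n x) (K * `|x|)).
  by rewrite mulr_ge0.
move=> n; rewrite turnsS -{2}[turns k n x]mulr1 -mulrBr cabsM.
apply: (@le_trans _ _ (1 * (K * (`|x| * 2^-1 ^+ n)))); last by rewrite mul1r mulrA.
apply: ler_pM; rewrite ?cabs_ge0 ?cabs_turns//.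
rewrite -(turn0 k); apply: le_trans (hK _ _) _.
rewrite ler_wpM2l// subr0; apply: le_trans (turns_decay _ _) _.
by rewrite ler_wpM2l// exprS ler_piMl ?exprn_ge0 ?invr_ge0// invf_le1// ler1n.
Qed.

Lemma cabs_scaling k x : cabs (scaling_fun N m0 z theta k x) <= 1.
Proof. exact: ccvg_cabs_le (scaling_cvg k x) (fun n => cabs_turns k n x). Qed.

Lemma scaling0 k : scaling_fun N m0 z theta k 0 = 1.
Proof.
apply: ccvg_unique (scaling_cvg k 0) _.
have -> : (fun n => turns k n 0) = fun=> 1; last exact: ccvg_cst.
apply/funext => n; rewrite /turns big1// => l _.
by rewrite mul0r turn0.
Qed.

(** The [l]-th factor contributes at most [K |x - y| 2^-l], and [sum 2^-l <= 1]. *)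
Lemma scaling_lip k : exists2 K : R, 0 <= K & forall x y,
  cabs (scaling_fun N m0 z theta k x - scaling_fun N m0 z theta k y) <= K * `|x - y|.
Proof.
have [K K0 hK] := turn_lip k; exists K => // x y.
apply: (ccvg_cabs_le _ (ccvgB (scaling_cvg k x) (scaling_cvg k y))).
  by rewrite mulr_ge0.
move=> n; apply: le_trans (cabs_prodB _ _ _) _; try by move=> l; exact: cabs_turn.
have geo : \sum_(1 <= l < n.+1) 2^-1 ^+ l = 1 - 2^-1 ^+ n :> R.
  elim: n => [|n IH]; first by rewrite big_geq// expr0 subrr.
  by rewrite big_nat_recr//= IH exprS; field.
apply: (@le_trans _ _ (\sum_(1 <= l < n.+1) K * `|x - y| * 2^-1 ^+ l)).
  apply: ler_sum => l _; apply: le_trans (hK _ _) _.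
  by rewrite -mulrBl -mulrA ler_wpM2l// turns_decay.
by rewrite -mulr_sumr geo ler_piMr ?mulr_ge0// gerDl oppr_le0.
Qed.

(** [turn_shift] in each factor telescopes: the value of [m0] left over sits at a
    point tending to [z k]. *)
Lemma scaling_refine k x :
  m0 (z k * expi x)%g * scaling_fun N m0 z theta k x =
  m0 (z k) * scaling_fun N m0 z theta (ordS k) (N%:R * x).
Proof.
have step n : m0 (z k * expi (x / N%:R ^+ (n * p)))%g * turns (ordS k) n (N%:R * x) =
    turns k n x * m0 (z k * expi x)%g.
  elim: n => [|n IH]; first by rewrite mul0n expr0 divr1 !turns0 mul1r mulr1.
  rewrite !turnsS.
  set t := x / N%:R ^+ (n.+1 * p).
  have e1 : N%:R * x / N%:R ^+ (n.+1 * p) = N%:R * t by rewrite /t mulrA.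
  have e2 : (N ^ p)%:R * t = x / N%:R ^+ (n * p).
    have a0 : N%:R ^+ p != 0 :> R by rewrite expf_neq0// lt0r_neq0.
    have b0 : N%:R ^+ (n * p) != 0 :> R by rewrite expf_neq0// lt0r_neq0.
    rewrite /t mulSn exprD natrX.
    move: (N%:R ^+ p) (N%:R ^+ (n * p)) a0 b0 => a b a0 b0.
    by field; apply/andP.
  have := turn_shift k t; rewrite e2 e1; move: IH.
  move: (turns (ordS k) n _) (turn (ordS k) _) (turns k n x) (turn k t) (m0 _)
    (m0 _) (m0 _) => E B F C A G D IH h.
  transitivity (C * (D * E)); last by rewrite IH; ring.
  by transitivity ((A * B) * E); [ring|rewrite h; ring].
apply: ccvg_unique; last first.
  apply: ccvgM (scaling_cvg (ordS k) (N%:R * x)).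
  instantiate (1 := fun n => m0 (z k * expi (x / N%:R ^+ (n * p)))%g).
  have [K K0 hK] := filter_lip m0_lip.
  apply: ccvg_cabs; apply: (@squeeze_cvgr _ _ _ _ (fun=> 0)
    (fun n => (K * `|x|) * 2^-1 ^+ n)).
  - apply: nearW => n; rewrite cabs_ge0/=.
    have := hK (z k) (x / N%:R ^+ (n * p)) 0; rewrite expi0 mulg1 subr0.
    move=> h; apply: le_trans h _; rewrite -mulrA ler_wpM2l//.
    exact: turns_decay.
  - exact: cvg_cst.
  - have -> : (0 : R) = K * `|x| * 0 by rewrite mulr0.
    apply: cvgM; first exact: cvg_cst.
    by apply: cvg_expr; rewrite ger0_norm ?invr_ge0// invf_lt1// ltr1n.
under eq_fun do rewrite step mulrC.
exact: ccvgM (ccvg_cst _) (scaling_cvg k x).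
Qed.

End CycleScaling.

(** * Localization *)

Section Continuity.
Variable R : realType.
Local Notation Re := complex.Re.
Local Notation Im := complex.Im.

Lemma lipschitz_continuous (g : R -> R) (K : R) : 0 <= K ->
  (forall x y, `|g x - g y| <= K * `|x - y|) -> continuous g.
Proof.
move=> K0 hK x; apply/cvgrPdist_le => e e0.
have K1 : 0 < K + 1 by rewrite ltr_wpDl.
have : \forall y \near x, `|x - y| <= e / (K + 1).
  have /cvgrPdist_le : (id : R -> R) @ x --> x by exact: cvg_id.
  by apply; rewrite divr_gt0.
apply: filterS => y; rewrite ler_pdivlMr// => h; apply: le_trans (hK _ _) _.
by apply: le_trans h; rewrite mulrC ler_wpM2l// lerDl.
Qed.

Lemma clipschitz_continuous (f : R -> R[i]) (K : R) : 0 <= K ->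
  (forall x y, cabs (f x - f y) <= K * `|x - y|) ->
  continuous (fun x => Re (f x)) /\ continuous (fun x => Im (f x)).
Proof.
move=> K0 hK; split; apply: (lipschitz_continuous K0) => x y;
  apply: le_trans (hK x y).
  by rewrite -ReN -complex_ReD cabs_Re_le.
by rewrite -ImN -complex_ImD cabs_Im_le.
Qed.

End Continuity.

Lemma ltr_norm_itv (R : realType) (t d b : R) : `|t| <= d -> d < b -> - b < t < b.
Proof. by move=> td db; rewrite -ltr_norml (le_lt_trans td). Qed.

Lemma ler_1B (R : realType) (r c d : R) : `|r - 1| <= c -> c <= d -> 1 - d <= r.
Proof. by rewrite ler_norml => /andP[h _] cd; lra. Qed.

Section Localization.
Variable R : realType.
Local Notation C := R[i].
Local Notation T := (circle R).
Local Notation mu := (@lebesgue_measure R).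
Local Notation Re := complex.Re.
Local Notation Im := complex.Im.

Definition cut (D : set R) (f : R -> C) (t : R) : C := (\1_D t : R)%:C * f t.

Lemma cmeasurable_cut D f : measurable D -> cmeasurable f -> cmeasurable (cut D f).
Proof.
move=> mD mf; apply: cmeasurableM => //; split; last exact: measurable_cst.
exact: measurable_indic.
Qed.

Lemma cutT D f t : D t -> cut D f t = f t.
Proof. by move=> Dt; rewrite /cut indicE mem_set// mul1r. Qed.

Lemma cutF D f t : ~ D t -> cut D f t = 0.
Proof. by move=> Dt; rewrite /cut indicE memNset// mul0r. Qed.

Lemma cut_cases D f t : cut D f t = f t \/ cut D f t = 0.
Proof.
by have [Dt|Dt] := pselect (D t); [left; exact: cutT|right; exact: cutF].
Qed.

(** Dominated convergence, as the sets [D j] eventually leave every point. *)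
Lemma energy_cut_cvg0 (D : nat -> set R) (f : R -> C) :
  (forall j, measurable (D j)) -> cmeasurable f -> (energy f < +oo)%E ->
  (forall t, exists M, forall j, (M <= j)%N -> ~ D j t) ->
  forall e : R, 0 < e -> exists M, forall j, (M <= j)%N ->
    (energy (cut (D j) f) < e%:E)%E.
Proof.
move=> mD mf ef hD e e0.
have ms j : measurable_fun [set: R] (fun t => (sqmod (cut (D j) f t))%:E).
  by apply: measurable_esqmod; exact: cmeasurable_cut.
have le j t : sqmod (cut (D j) f t) <= sqmod (f t).
  by have [->|->] := cut_cases (D j) f t; rewrite ?sqmod0 ?sqmod_ge0.
have := @dominated_convergence _ _ _ mu setT measurableT
  (fun j t => (sqmod (cut (D j) f t))%:E) (cst 0%E) (fun t => (sqmod (f t))%:E) ms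
  (measurable_cst _).
case.
- apply: ae_all => t _; have [M hM] := hD t.
  apply: cvg_near_cst; exists M => // j /= Mj.
  by rewrite cutF ?sqmod0//; exact: hM.
- apply/integrableP; split; first exact: measurable_esqmod.
  by under eq_integral do rewrite gee0_abs ?lee_fin ?sqmod_ge0//.
- by apply: ae_all => t j _; rewrite gee0_abs lee_fin ?sqmod_ge0.
move=> _ _; rewrite integral0 => /fine_cvgP[_].
move=> /cvgrPdist_lt /(_ e e0) [M _ hM]; exists M => j Mj.
have := hM j Mj; rewrite /= sub0r normrN -/(energy (cut (D j) f)).
have fe : energy (cut (D j) f) \is a fin_num.
  rewrite ge0_fin_numE ?energy_ge0//; apply: le_lt_trans ef.
  apply: ge0_le_integral => //.
  - by move=> t _; rewrite lee_fin sqmod_ge0.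
  - exact: ms.
  - exact: measurable_esqmod.
  - by move=> t _; rewrite lee_fin.
move=> h; rewrite -(fineK fe) lte_fin; apply: le_lt_trans h; exact: ler_norm.
Qed.

Definition far (A : R) : set R := [set t | A < `|t|].

Lemma measurable_far A : measurable (far A).
Proof.
have -> : far A = [set: R] `&` (fun t : R => `|t|) @^-1` `]A, +oo[%classic.
  by rewrite setTI; apply/seteqP; split=> t /=; rewrite /far /= in_itv/= andbT.
exact: (@normr_measurable R setT measurableT).
Qed.

(** [f] reads [y] at the angle of [v] relative to [w], on the open half circle
    centred at [w], and is [0] elsewhere. *)
Lemma arc_lift (w : T) (y : R -> C) (B : R) :
  cmeasurable y -> (forall t, sqmod (y t) <= B) ->
  exists f : T -> C, [/\ Linfty f,
    forall t, - (pi / 2) < t < pi / 2 -> f (w * expi t)%g = y t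
  & forall v, f v = 0 \/ exists2 t, v = (w * expi t)%g & f v = y t].
Proof.
move=> my yB.
pose co (v : T) : R := Re (val (w^-1 * v)%g).
pose si (v : T) : R := Im (val (w^-1 * v)%g).
(* the angle as an arctangent; [co v `^ (-1)] is a measurable function of [co v]
   which is the inverse where [co v] is positive *)
pose an (v : T) : R := atan (si v * (co v `^ (-1))).
pose f v : C := cut [set v | 0 < v] (fun=> 1) (co v) * y (an v).
have fP v : 0 < co v -> f v = y (atan (si v / co v)).
  by move=> c0; rewrite /f cutT// mul1r /an powR_inv1// ltW.
have fN v : ~ 0 < co v -> f v = 0.
  by move=> c0; rewrite /f cutF// mul0r.
exists f; split.
- have [b hb] := expi_surj w.
  have E x : (w^-1 * expi x)%g = expi (x - b).
    apply: (@circle_mulgI _ w); rewrite mulgA mulgV mul1g -hb -expiD.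
    by rewrite addrC subrK.
  have mco : measurable_fun [set: R] (fun x => co (expi x)).
    have h := continuous_measurable_fun (@continuous_cos R).
    have := measurable_fun_shift (- b) h.
    by congr measurable_fun; apply/funext => x; rewrite /co E.
  have msi : measurable_fun [set: R] (fun x => si (expi x)).
    have h := continuous_measurable_fun (@continuous_sin R).
    have := measurable_fun_shift (- b) h.
    by congr measurable_fun; apply/funext => x; rewrite /si E.
  have man : measurable_fun [set: R] (fun x => an (expi x)).
    apply: measurableT_comp.
      by apply: continuous_measurable_fun => x; exact: continuous_atan.
    apply: measurable_funM; first exact: msi.
    exact: (measurableT_comp (measurable_powR (-1)) mco).
  split.
    apply: cmeasurableM.
      have mI : measurable_fun [set: R] (\1_[set v : R | 0 < v] : R -> R).
        apply: measurable_indic.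
        rewrite (_ : [set v | _] = `]0, +oo[%classic); first exact: measurable_itv.
        by apply/seteqP; split=> t /=; rewrite in_itv/= andbT.
      split; rewrite /cut.
        under eq_fun do rewrite mulr1 ReR.
        exact: (measurableT_comp mI mco).
      by under eq_fun do rewrite mulr1 ImR; exact: measurable_cst.
    split; [exact: (measurableT_comp my.1 man)|exact: (measurableT_comp my.2 man)].
  have B0 : 0 <= B by apply: le_trans (yB 0); exact: sqmod_ge0.
  exists (Num.sqrt B); apply: ae_all => x.
  apply: sqmod_le_norm; first exact: sqrtr_ge0.
  rewrite sqr_sqrtr//; have [c0|c0] := pselect (0 < co (expi x)).
    by rewrite fP.
  by rewrite fN// sqmod0.
- move=> t tpi; have co0 : co (w * expi t)%g = cos t by rewrite /co mulKg.
  have si0 : si (w * expi t)%g = sin t by rewrite /si mulKg.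
  by rewrite fP ?co0 ?cos_gt0_pihalf// si0 -[_ / _]/(tan t) tanK// in_itv.
- move=> v; have [c0|c0] := pselect (0 < co v); last by left; exact: fN.
  right; exists (atan (si v / co v)); last exact: fP.
  have cs : co v ^+ 2 + si v ^+ 2 = 1.
    by have := sqmod_circle (w^-1 * v)%g; rewrite /sqmod.
  have ce : cos (atan (si v / co v)) = co v.
    rewrite cos_atan expr_div_n.
    have -> : 1 + si v ^+ 2 / co v ^+ 2 = (co v)^-1 ^+ 2.
      have c2 : co v ^+ 2 != 0 by rewrite expf_neq0// lt0r_neq0.
      by rewrite -{1}(mulfV c2) -mulrDl cs mul1r exprVn.
    by rewrite sqrtr_sqr ger0_norm ?invr_ge0 ?(ltW c0)// invrK.
  have se : sin (atan (si v / co v)) = si v.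
    have := atanK (si v / co v); rewrite /tan ce => /divIf; apply.
    exact: lt0r_neq0.
  have -> : expi (atan (si v / co v)) = (w^-1 * v)%g.
    by apply: val_inj => /=; rewrite ce se; apply: complex_eq.
  by rewrite mulgA mulgV mul1g.
Qed.

Variable N : nat.
Hypothesis N_gt0 : (0 < N)%N.
Let N0 : 0 < N%:R :> R. Proof. by rewrite ltr0n. Qed.

Lemma far_dilate A t : far (A / N%:R) t <-> far A (N%:R * t).
Proof.
rewrite /far /= normrM (ger0_norm (ltW N0)); split=> h.
  by move: h; rewrite ltr_pdivrMr// mulrC.
by rewrite ltr_pdivrMr// mulrC.
Qed.

(** Dilation shrinks supports by [N] and preserves energy. *)
Lemma energy_far_U1 A (x : L2space R) :
  energy (cut (far (A / N%:R)) (U1 N x : L2 R)) = energy (cut (far A) (x : L2 R)).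
Proof.
have mx := cmeasurable_cut (measurable_far A) (L2_cmeasurable x).
rewrite [RHS](energy_affine 0 N0 mx).
have -> : (fun t => cut (far A) (x : L2 R) (N%:R * t + 0)) =
    (fun t => cut (far A) (x : L2 R) (N%:R * t)).
  by apply/funext => t; rewrite addr0.
have md := cmeasurable_dilate N%:R mx.
rewrite (@ae_eq_energy _ _
    (fun t => (Num.sqrt N%:R)%:C * cut (far A) (x : L2 R) (N%:R * t))).
- by rewrite energyZ// sqmodR sqr_sqrtr ?(ltW N0).
- by apply: cmeasurable_cut; [exact: measurable_far|exact: L2_cmeasurable].
- by apply: cmeasurableM => //; exact: cmeasurable_cst.
- apply: aeS (U1_ae N_gt0 x) => t.
  have [h|h] := pselect (far A (N%:R * t)).
    by rewrite (cutT _ h) cutT//; exact/far_dilate.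
  by move=> _; rewrite (cutF _ h) cutF ?mulr0// => /far_dilate.
Qed.

End Localization.

Section CycleTails.
Variables (R : realType) (N : nat) (p : nat) (z : 'I_p -> circle R).
Variable theta : 'I_p -> R.
Local Notation C := R[i].
Hypothesis N_ge2 : (2 <= N)%N.
Let N_gt0 : (0 < N)%N. Proof. exact: ltnW. Qed.
Let N0 : 0 < N%:R :> R. Proof. by rewrite ltr0n. Qed.

Definition tail (A : R) (x : cycle_space R p) : \bar R :=
  (\sum_k energy (cut (far A) (x k : L2 R)))%E.

Lemma tail_U A x : tail (A / N%:R) (cycle_U N theta x) = tail A x.
Proof.
rewrite /tail [RHS](reindex (@ordS p)); last by apply: onW_bij; exact: ordS_bij.
apply: eq_bigr => k _; rewrite -[RHS](energy_far_U1 N_gt0).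
have mU := cmeasurable_cut (measurable_far (A / N%:R)) (L2_cmeasurable (U1 N (x (ordS k)))).
rewrite (@ae_eq_energy _ _ (fun t => val (expi (theta k)) *
   cut (far (A / N%:R)) (U1 N (x (ordS k)) : L2 R) t)).
- by rewrite energyZ// sqmod_circle mul1e.
- by apply: cmeasurable_cut; [exact: measurable_far|exact: L2_cmeasurable].
- by apply: cmeasurableM => //; exact: cmeasurable_cst.
- apply: aeS (L2Z_ae (val (expi (theta k))) (U1 N (x (ordS k)))) => t e.
  by rewrite /cut /cycle_U e mulrCA.
Qed.

Lemma tail_iter A j x : tail A (iter j (cycle_U N theta) x) = tail (A * N%:R ^+ j) x.
Proof.
elim: j A => [|j IH] A; first by rewrite expr0 mulr1.
rewrite -{1}(mulfK (lt0r_neq0 N0) A) /= tail_U IH exprS mulrA //.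
Qed.

(** With [tail_iter] this says that iterating [U] gathers the mass near [0]. *)
Lemma tail_cvg0 (A : R) x : 0 < A -> forall e : R, 0 < e ->
  exists M, forall j, (M <= j)%N -> (tail (A * N%:R ^+ j) x <= e%:E)%E.
Proof.
move=> A0 e e0.
have e1 : 0 < e / p.+1%:R by rewrite divr_gt0.
have /choice[M hM] k : exists M, forall j, (M <= j)%N ->
    (energy (cut (far (A * N%:R ^+ j)) (x k : L2 R)) < (e / p.+1%:R)%:E)%E.
  apply: (energy_cut_cvg0 (D := fun j => far (A * N%:R ^+ j))) => //.
  - by move=> j; exact: measurable_far.
  - exact: L2_cmeasurable.
  - exact: L2_energy.
  - move=> t; exists (Num.truncn (`|t| / A)).+1 => j hj; rewrite /far/= => h.
    have : `|t| / A < j%:R.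
      by apply: lt_le_trans (truncnS_gt _) _; rewrite ler_nat.
    rewrite ltr_pdivrMr// ltNge => /negP; apply; apply: le_trans (ltW h).
    by rewrite mulrC ler_pM2l// -natrX ler_nat ltnW// ltn_expl.
exists (\sum_k M k)%N => j hj; rewrite /tail.
apply: (@le_trans _ _ (\sum_(k < p) (e / p.+1%:R)%:E)%E).
  apply: lee_sum => k _; apply/ltW/hM; apply: leq_trans hj.
  by rewrite (bigD1 k)//= leq_addr.
rewrite sumEFin lee_fin sumr_const card_ord -[leLHS]mulr_natr mulrAC ler_pdivrMr//.
by rewrite ler_pM2l// ler_nat.
Qed.

(** [g] vanishes on the part of [x] near [0] in every component, and is at most
    [1] on the rest. *)
Lemma cycle_rep_tail (g : circle R -> C) (A : R) x : Linfty g ->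
  (forall v, sqmod (g v) <= 1) ->
  (forall k t, `|t| <= A -> g (z k * expi t)%g = 0) ->
  ((2 * pi * hsq (cycle_rep z g x))%:E <= tail A x)%E.
Proof.
move=> hg g1 gA; rewrite hsq_dsum mulr_sumr -sumEFin; apply: lee_sum => k _.
rewrite [(_ * _)%:E](hsq_L2 _).
have hgk := Linfty_rotate (z k) hg.
rewrite (@ae_eq_energy _ _ (fun t => alpha (z k) g (expi t) * (x k : L2 R) t)).
- rewrite -[leRHS]mul1e; apply: le_energy => //.
  + by apply: cmeasurableM; [exact: hgk.1|exact: L2_cmeasurable].
  + by apply: cmeasurable_cut; [exact: measurable_far|exact: L2_cmeasurable].
  apply: ae_all => t; rewrite mul1r.
  have [h|h] := pselect (far A t).
    by rewrite cutT// sqmodM ler_piMl ?sqmod_ge0// /alpha.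
  rewrite cutF// sqmod0 /alpha gA ?mul0r ?sqmod0//.
  by move/negP: h; rewrite -leNgt.
- exact: L2_cmeasurable.
- by apply: cmeasurableM; [exact: hgk.1|exact: L2_cmeasurable].
- exact: pi1_ae.
Qed.

End CycleTails.

(** * The scaling functions of all cycles *)

Section System.
Variables (R : realType) (N : nat) (m0 : circle R -> R[i]).
Local Notation C := R[i].
Local Notation T := (circle R).
Local Notation mu := (@lebesgue_measure R).
Local Notation Re := complex.Re.
Local Notation Im := complex.Im.
Hypothesis N_ge2 : (2 <= N)%N.
Hypothesis m0_lip : lipschitz_circle m0.
Hypothesis m0_zeros : finite_set [set z | m0 z = 0].
Hypothesis m0_ruelle : forall z, ruelle N m0 (fun=> 1) z = 1.
Hypothesis m0_1 : m0 1%g = (Num.sqrt N%:R)%:C.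
Variables (n : nat) (p : 'I_n -> nat) (z : forall i, 'I_(p i) -> T).
Variable theta : forall i, 'I_(p i) -> R.
Arguments z : clear implicits.
Arguments theta : clear implicits.
Hypothesis z_cycle : forall i, is_cycle N m0 (z i).
Hypothesis z_distinct : forall i j, range (z i) = range (z j) -> i = j.
Hypothesis z_all : forall (r : nat) (w : 'I_r -> T), is_cycle N m0 w ->
  exists i, range w = range (z i).
Hypothesis z_angles : forall i, cycle_angles N m0 (z i) (theta i).

Let N_gt0 : (0 < N)%N. Proof. exact: ltnW. Qed.
Let N0 : 0 < N%:R :> R. Proof. by rewrite ltr0n. Qed.

(** All cycle points together: the identity [h = 1] holds only for the sum over
    all cycles. *)
Definition cpoint := {i : 'I_n & 'I_(p i)}.
Definition cval (u : cpoint) : T := z _ (tagged u).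
Definition csucc (u : cpoint) : cpoint :=
  Tagged (fun i => 'I_(p i)) (ordS (tagged u)).
Definition cscaling (u : cpoint) : R -> C :=
  scaling_fun N m0 (z (tag u)) (theta (tag u)) (tagged u).
Definition cdensity (u : cpoint) (t : R) : R := sqmod (cscaling u t).
Definition cweight (w : T) : R := sqmod (m0 w).

Lemma csucc_bij : bijective csucc.
Proof.
exists (fun u => Tagged (fun i => 'I_(p i)) (ord_pred (tagged u))).
  by case=> i k; rewrite /csucc /= ordSK.
by case=> i k; rewrite /csucc /= ord_predK.
Qed.

Lemma cval_succ u : (cval u ^+ N)%g = cval (csucc u).
Proof. by rewrite /cval (cycle_succ (z_cycle _)). Qed.

Lemma cycle_range i (k : 'I_(p i)) :
  range (z i) = range (fun j => (z i k ^+ (N ^ j))%g).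
Proof.
apply/seteqP; split=> w.
  move=> [l _ <-].
  have inj := @iter_ordS_inj (p i) k.
  have [g gK Kg] := injF_bij inj.
  by exists (g l) => //; rewrite (cycle_iter (z_cycle i)) -[in RHS](Kg l).
by move=> [j _ <-]; exists (iter j (@ordS (p i)) k) => //;
  rewrite (cycle_iter (z_cycle i)).
Qed.

(** A cycle is the forward orbit of each of its points, so distinct cycles are
    disjoint. *)
Lemma cval_inj : injective cval.
Proof.
move=> [i k] [j l]; rewrite /cval /= => e.
have ij : i = j by apply: z_distinct; rewrite (cycle_range k) (cycle_range l) e.
subst j; congr existT.
by have [_ + _ _] := z_cycle i; apply.
Qed.

(** The orbit of [y] over its least period is a cycle, hence among the given
    ones. *)
Lemma cweight_cycle y m : (0 < m)%N -> (y ^+ (N ^ m) = y)%g ->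
  (forall j, cweight (y ^+ (N ^ j))%g = N%:R) -> exists u, y = cval u.
Proof.
move=> m_gt0 ym yW.
have ex : exists m, (0 < m)%N && ((y ^+ (N ^ m))%g == y).
  by exists m; rewrite m_gt0 ym eqxx.
case: (ex_minnP ex) => {m_gt0 ym}{}m /andP[m_gt0 /eqP ym] mmin.
pose w (k : 'I_m) : T := (y ^+ (N ^ k))%g.
have wc : is_cycle N m0 w.
  split=> //.
  - have H (a b : 'I_m) : (a < b)%N -> w a <> w b.
      move=> ab e.
      have : (y ^+ (N ^ (a + (m - b))))%g = y.
        rewrite -expg_pow -[(y ^+ (N ^ a))%g]/(w a) e /w expg_pow.
        by rewrite subnKC// ltnW.
      have bm := ltn_ord b.
      move=> /eqP h; have := mmin (a + (m - b))%N.
      by rewrite h andbT => /(_ _); lia.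
    move=> a b e; apply/val_inj; case: (ltngtP a b) => // ab.
      by case: (H a b ab).
    by case: (H b a ab).
  - move=> k; rewrite /w -expgnA mulnC -expnS /=.
    have := ltn_ord k; rewrite leq_eqVlt => /orP[/eqP km|km].
      by rewrite km modnn expn0 expg1 ym.
    by rewrite modn_small.
  - by move=> k; rewrite normE_sqmod; congr (Num.sqrt _)%:C; exact: yW.
have [i wi] := z_all wc.
have : range w y by exists (Ordinal m_gt0) => //; rewrite /w /= expn0 expg1.
by rewrite wi => -[k _ zk]; exists (Tagged (fun i => 'I_(p i)) k).
Qed.

(** [m0 1 = sqrt N] makes [{1}] a cycle. *)
Lemma cpoint_ex : exists u : cpoint, True.
Proof.
have one k : ((1%g : T) ^+ k = 1)%g by exact: expg1n.
have [|j|u _] := @cweight_cycle 1%g 1 (ltnSn 0).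
- exact: one.
- by rewrite one /cweight m0_1 sqmodR sqr_sqrtr ?(ltW N0).
- by exists u.
Qed.

Lemma cweight_zeros : finite_set [set w | cweight w = 0].
Proof.
apply: sub_finite_set m0_zeros => w /=; exact: sqmod_eq0.
Qed.

Lemma cscaling0 u : cscaling u 0 = 1.
Proof. exact: scaling0. Qed.

Lemma cscaling_le1 u t : cabs (cscaling u t) <= 1.
Proof. exact: cabs_scaling. Qed.

Lemma cscaling_lip u : exists2 K : R, 0 <= K & forall x y,
  cabs (cscaling u x - cscaling u y) <= K * `|x - y|.
Proof. exact: scaling_lip. Qed.

Lemma cscaling_refine u x :
  m0 (cval u * expi x)%g * cscaling u x =
  m0 (cval u) * cscaling (csucc u) (N%:R * x).
Proof. exact: scaling_refine. Qed.

Lemma cscaling_continuous u :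
  continuous (fun t => Re (cscaling u t)) /\ continuous (fun t => Im (cscaling u t)).
Proof. by have [K K0 hK] := cscaling_lip u; exact: clipschitz_continuous hK. Qed.

Lemma cscaling_measurable u : cmeasurable (cscaling u).
Proof.
by have [c1 c2] := cscaling_continuous u; split; exact: continuous_measurable_fun.
Qed.

Lemma cdensity_continuous u : continuous (cdensity u).
Proof.
have [c1 c2] := cscaling_continuous u => x.
rewrite /cdensity /sqmod; apply: cvgD.
  by under eq_fun do rewrite expr2; rewrite expr2; apply: cvgM; exact: c1.
by under eq_fun do rewrite expr2; rewrite expr2; apply: cvgM; exact: c2.
Qed.

Lemma cdensity_scaling u t :
  cweight (cval u * expi t)%g * cdensity u t = N%:R * cdensity (csucc u) (N%:R * t).
Proof.
rewrite /cweight /cdensity -sqmodM cscaling_refine sqmodM.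
by rewrite /cval z_angles sqmodM sqmodR sqmod_circle mulr1 sqr_sqrtr.
Qed.

Lemma cval_arg : exists a : cpoint -> R, forall u, expi (a u) = cval u.
Proof. by have [a ha] := choice (fun u => expi_surj (cval u)); exists a. Qed.

Lemma cdensity_sum1 (a : cpoint -> R) : (forall u, expi (a u) = cval u) ->
  forall x, (\sum_(j <oo) (\sum_u cdensity u (translate a u j x))%:E = 1)%E.
Proof.
move=> ha x; apply: (@translates_sum1 R N cpoint N_ge2 cval csucc cweight) => //.
- exact: cval_inj.
- exact: csucc_bij.
- exact: cval_succ.
- by move=> w; exact: sqmod_ge0.
- exact: filter_sum.
- exact: cweight_zeros.
- exact: cweight_cycle.
- exact: cpoint_ex.
- by move=> u t; exact: sqmod_ge0.
- by move=> u t; rewrite /cdensity -cabs_sq expr_le1 ?cabs_ge0// cscaling_le1.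
- by move=> u; rewrite /cdensity cscaling0 sqmod1.
- exact: cdensity_continuous.
- exact: cdensity_scaling.
Qed.

Lemma rotate_expi (w : T) d (S : measurableType d) (g : T -> S) :
  measurable_fun [set: R] (fun x => g (expi x)) ->
  measurable_fun [set: R] (fun x => g (w * expi x)%g).
Proof.
have [b <-] := expi_surj w => /(measurable_fun_shift b).
by congr measurable_fun; apply/funext => x; rewrite addrC expiD.
Qed.

(** Each integral over the line is unfolded into a period; the translates of all
    densities then appear together and add up to [1]. *)
Lemma periodization (g : T -> R) :
  measurable_fun [set: R] (fun x => g (expi x)) -> (forall w, 0 <= g w) ->
  (\sum_u \int[mu]_t (g (cval u * expi t)%g * cdensity u t)%:E =
   \int[mu]_(x in `[0%R, (2 * pi)%R]) (g (expi x))%:E)%E.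
Proof.
move=> mg g0; have [a ha] := cval_arg.
have mq u : measurable_fun [set: R] (cdensity u).
  by apply: continuous_measurable_fun; exact: cdensity_continuous.
have q0 u t : 0 <= cdensity u t by exact: sqmod_ge0.
have E u : (\int[mu]_t (g (cval u * expi t)%g * cdensity u t)%:E =
    \int[mu]_(x in `[0%R, (2 * pi)%R])
      \sum_(j <oo) (g (expi x) * cdensity u (translate a u j x))%:E)%E.
  rewrite (ge0_integral_shift (- a u)); last 2 first.
  - by apply/measurable_EFinP/measurable_funM; [exact: rotate_expi|exact: mq].
  - by move=> t; rewrite lee_fin mulr_ge0.
  rewrite ge0_integral_unfold; last 2 first.
  - apply: (measurable_fun_shift (- a u)
      (g := fun t => (g (cval u * expi t)%g * cdensity u t)%:E)).
    by apply/measurable_EFinP/measurable_funM; [exact: rotate_expi|exact: mq].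
  - by move=> t; rewrite lee_fin mulr_ge0.
  apply: eq_integral => x _; apply: eq_eseriesr => j _.
  congr ((g _ * cdensity u _)%:E).
    rewrite -ha -expiD addrCA subrr addr0; exact: expi_periodic.
  by rewrite /translate addrAC.
under eq_bigr do rewrite E.
have mt u j : measurable_fun [set: R]
    (fun x => (g (expi x) * cdensity u (translate a u j x))%:E).
  apply/measurable_EFinP/measurable_funM => //.
  have := measurable_fun_shift (- a u + 2 * pi * (zenum j)%:~R) (mq u).
  by congr measurable_fun; apply/funext => x; rewrite /translate addrA.
have t0 u j x : (0 <= (g (expi x) * cdensity u (translate a u j x))%:E :> \bar R)%E.
  by rewrite lee_fin mulr_ge0.
rewrite -ge0_integral_sum//; last 2 first.
- move=> u; apply: measurable_funTS.
  by apply: ge0_emeasurable_sum => [j x _ _|j _]; [exact: t0|exact: mt].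
- by move=> u x _; apply: nneseries_ge0 => j _ _; exact: t0.
apply: eq_integral => x _.
rewrite -nneseries_sum; last by move=> *; exact: t0.
rewrite -[RHS]mule1 -(cdensity_sum1 ha x) -nneseriesZl//; last first.
  by move=> j _; rewrite lee_fin sumr_ge0.
apply: eq_eseriesr => j _; rewrite -EFinM mulr_sumr -sumEFin.
by [].
Qed.

(** The case [g = 1] of [periodization] bounds the total energy by [2 pi]. *)
Lemma cscaling_energy u : (energy (cscaling u) < +oo)%E.
Proof.
have := @periodization (fun=> 1) (measurable_cst _) (fun=> ler01).
rewrite (bigD1 u)//=.
under eq_integral do rewrite mul1r.
rewrite -/(energy (cscaling u)) => h.
apply: (@le_lt_trans _ _ (\int[mu]_(x in `[0%R, (2 * pi)%R]) 1)%E).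
  rewrite -h leeDl// sume_ge0// => v _; apply: integral_ge0 => t _.
  by rewrite lee_fin mul1r sqmod_ge0.
rewrite integral_cst// mul1e.
rewrite [X in (X < _)%E](lebesgue_measure_itv `[0%R, (2 * pi)%R])/=.
by case: ifP => _; rewrite ltry.
Qed.

Lemma cscaling_square_integrable u : cscaling u \in @square_integrable R.
Proof.
apply/square_integrableP; split; first exact: cscaling_measurable.
exact: cscaling_energy.
Qed.

Lemma periodization_bounded (g : T -> R) (M : R) :
  measurable_fun [set: R] (fun x => g (expi x)) -> (forall w, 0 <= g w) ->
  {ae mu, forall x, g (expi x) <= M} ->
  [/\ forall u, mu.-integrable setT
        (EFin \o (fun t => g (cval u * expi t)%g * cdensity u t)),
      mu.-integrable `[0, 2 * pi]%classic (EFin \o (fun x => g (expi x)))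
    & \sum_u \int[mu]_t (g (cval u * expi t)%g * cdensity u t) =
      \int[mu]_(x in `[0, 2 * pi]%classic) g (expi x)].
Proof.
move=> mg g0 gM; have per := periodization mg g0.
have mI : measurable (`[0, 2 * pi]%classic : set R) by exact: measurable_itv.
have Ify : (\int[mu]_(x in `[0%R, (2 * pi)%R]) (g (expi x))%:E < +oo)%E.
  apply: (@le_lt_trans _ _ (\int[mu]_(x in `[0%R, (2 * pi)%R]) (`|M|)%:E)%E).
    apply: ae_ge0_le_integral => //.
    - by move=> x _; rewrite lee_fin.
    - by apply/measurable_EFinP; exact: measurable_funTS.
    - apply: aeS gM => x gx _; rewrite lee_fin.
      exact: le_trans gx (ler_norm _).
  rewrite integral_cst//.
  rewrite [X in (_ * X < _)%E](lebesgue_measure_itv `[0%R, (2 * pi)%R])/=.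
  by case: ifP => _; rewrite ?mule0 ?ltry// -EFinB -EFinM ltry.
have q0 u t : 0 <= g (cval u * expi t)%g * cdensity u t.
  by rewrite mulr_ge0// sqmod_ge0.
have mgq u : measurable_fun [set: R] (fun t => g (cval u * expi t)%g * cdensity u t).
  apply: measurable_funM; first exact: rotate_expi.
  by apply: continuous_measurable_fun; exact: cdensity_continuous.
have t0 u : (0 <= \int[mu]_t (g (cval u * expi t)%g * cdensity u t)%:E)%E.
  by apply: integral_ge0 => t _; rewrite lee_fin.
have tfy u : (\int[mu]_t (g (cval u * expi t)%g * cdensity u t)%:E < +oo)%E.
  by apply: le_lt_trans Ify; rewrite -per (bigD1 u)//= leeDl// sume_ge0.
have I0 : (0 <= \int[mu]_(x in `[0%R, (2 * pi)%R]) (g (expi x))%:E)%E.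
  by apply: integral_ge0 => x _; rewrite lee_fin.
split.
- move=> u; apply/integrableP; split; first by apply/measurable_EFinP; exact: mgq.
  by under eq_integral do rewrite /= ger0_norm//.
- apply/integrableP; split.
    by apply/measurable_EFinP; exact: measurable_funTS.
  by under eq_integral do rewrite /= ger0_norm//.
- apply: EFin_inj; rewrite /Rintegral -sumEFin fineK ?ge0_fin_numE//.
  rewrite -per; apply: eq_bigr => u _.
  by rewrite fineK// ge0_fin_numE.
Qed.

Lemma periodization_signed (g : T -> R) (M : R) :
  measurable_fun [set: R] (fun x => g (expi x)) ->
  {ae mu, forall x, `|g (expi x)| <= M} ->
  \sum_u \int[mu]_t (g (cval u * expi t)%g * cdensity u t) =
  \int[mu]_(x in `[0, 2 * pi]%classic) g (expi x).
Proof.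
move=> mg gM.
pose gp w := Num.max (g w) 0; pose gn w := Num.max (- g w) 0.
have gE w : g w = gp w - gn w.
  rewrite /gp /gn; case: (leP (g w) 0) => h.
    by rewrite max_l ?oppr_ge0// opprK add0r.
  by rewrite max_r ?subr0// oppr_le0 ltW.
have mgp : measurable_fun [set: R] (fun x => gp (expi x)).
  by apply: measurable_maxr => //; exact: measurable_cst.
have mgn : measurable_fun [set: R] (fun x => gn (expi x)).
  by apply: measurable_maxr; [exact: measurable_funN|exact: measurable_cst].
have gpM : {ae mu, forall x, gp (expi x) <= M}.
  apply: aeS gM => x h; rewrite ge_max (le_trans (ler_norm _) h)/=.
  exact: le_trans (normr_ge0 _) h.
have gnM : {ae mu, forall x, gn (expi x) <= M}.
  apply: aeS gM => x h; rewrite ge_max (le_trans (normr_ge0 _) h) andbT.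
  by apply: le_trans h; rewrite -normrN ler_norm.
have gp0 w : 0 <= gp w by rewrite le_max lexx orbT.
have gn0 w : 0 <= gn w by rewrite le_max lexx orbT.
have [pi1_ pi2_ pE] := periodization_bounded mgp gp0 gpM.
have [ni1_ ni2_ nE] := periodization_bounded mgn gn0 gnM.
transitivity (\sum_u (\int[mu]_t (gp (cval u * expi t)%g * cdensity u t) -
    \int[mu]_t (gn (cval u * expi t)%g * cdensity u t))).
  apply: eq_bigr => u _; rewrite -RintegralB//.
  by apply: eq_Rintegral => t _; rewrite gE mulrBl.
rewrite sumrB pE nE -RintegralB//.
by apply: eq_Rintegral => x _; rewrite [RHS]gE.
Qed.

(** ** The representation *)

Definition sysH : ipspace R := dsum (fun i => cycle_space R (p i)).
Definition sysU : sysH -> sysH := dsum_op (fun i => cycle_U N (theta i)).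
Definition sysrep (f : T -> C) : sysH -> sysH :=
  dsum_op (fun i => cycle_rep (z i) f).
Definition sysphi : sysH := fun i => cycle_phi N m0 (z i) (theta i).

Definition comp (X : sysH) (u : cpoint) : L2space R := X (tag u) (tagged u).

Lemma hilbert_sys : hilbert sysH.
Proof. by apply: hilbert_dsum => i; exact: hilbert_cycle. Qed.

Lemma inner_sys (X Y : sysH) : inner X Y = \sum_u inner (comp X u) (comp Y u).
Proof.
rewrite /= (sig_big_dep _ _ (fun i k => inner (X i k : L2space R) (Y i k : L2space R))).
by apply: eq_bigl.
Qed.

Lemma hsq_sys (X : sysH) : hsq X = \sum_u hsq (comp X u).
Proof. by rewrite /hsq inner_sys Re_sum. Qed.

Lemma sys_ext (X Y : sysH) : (forall u, comp X u = comp Y u) -> X = Y.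
Proof.
move=> h; apply: functional_extensionality_dep => i.
apply: functional_extensionality_dep => k.
exact: (h (Tagged (fun i => 'I_(p i)) k)).
Qed.

Lemma sysU_unitary : unitary sysU.
Proof. by apply: hilbert_unitary_dsum => i; exact: cycle_U_unitary. Qed.

Lemma hsq_sysU X : hsq (sysU X) = hsq X.
Proof. by rewrite /hsq; have [_ -> _] := sysU_unitary. Qed.

Lemma sysrep_star : star_representation sysrep.
Proof.
exact: (@star_representation_dsum R _ (fun i => cycle_space R (p i))
  (fun i => hilbert_cycle R (p i)) (fun i => cycle_rep (z i))
  (fun i => star_representation_cycle (z i))).
Qed.

Lemma sysU_rep f : Linfty f ->
  forall X, sysU (sysrep f X) = sysrep (fun w => f (w ^+ N)%g) (sysU X).
Proof.
move=> hf X; apply: functional_extensionality_dep => i.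
by apply: (cycle_U_rep (theta i) N_gt0) => // k; exact: cycle_succ.
Qed.

Lemma comp_phi u : {ae mu, forall t, (comp sysphi u : L2 R) t = cscaling u t}.
Proof. exact: toL2K (cscaling_square_integrable u). Qed.

Lemma comp_rep f X u : Linfty f -> {ae mu, forall t,
  (comp (sysrep f X) u : L2 R) t = f (cval u * expi t)%g * (comp X u : L2 R) t}.
Proof. by move=> hf; exact: pi1_ae (Linfty_rotate _ hf). Qed.

Lemma rotate_cmeasurable f u : Linfty f ->
  cmeasurable (fun t => f (cval u * expi t)%g).
Proof. by move=> hf; case: (Linfty_rotate (cval u) hf). Qed.

Lemma Linfty_filter : Linfty m0.
Proof.
split.
  have [K K0 hK] := filter_lip m0_lip.
  have [|c1 c2] := @clipschitz_continuous R (fun x => m0 (expi x)) K K0.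
    by move=> x y; have := hK 1%g x y; rewrite !mul1g.
  by split; exact: continuous_measurable_fun.
exists (Num.sqrt N%:R); apply: ae_all => x.
by rewrite cabs_norm lecR; exact: filter_bound.
Qed.

(** The refinement equation in each component, the phase of [U] being that of
    [m0] at the cycle point. *)
Lemma sysU_phi : sysU sysphi = sysrep m0 sysphi.
Proof.
apply: sys_ext => u; apply: L2_eq.
have h1 := comp_rep sysphi u Linfty_filter.
have h2 := L2Z_ae (val (expi (theta (tag u) (tagged u)))) (U1 N (comp sysphi (csucc u))).
have h3 := U1_ae N_gt0 (comp sysphi (csucc u)).
have h4 := ae_dilate N_gt0 (comp_phi (csucc u)).
have h := ae_and h1 (ae_and h2 (ae_and h3 (ae_and h4 (comp_phi u)))).
apply: aeS h => t [-> [e2 [e3 [e4 ->]]]].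
transitivity ((val (expi (theta (tag u) (tagged u))) *:
  (U1 N (comp sysphi (csucc u)) : L2 R) : L2 R) t); first by [].
rewrite e2 e3 e4 cscaling_refine /cval z_angles mulrA.
by congr (_ * _); rewrite mulrC.
Qed.

Lemma inner_phi_rep f : Linfty f ->
  inner sysphi (sysrep f sysphi) = haar_integral (fun w => f w * (1 : R)%:C).
Proof.
move=> hf; have [mf [M hM]] := hf.
have E u : inner (comp sysphi u) (comp (sysrep f sysphi) u) = ((2 * pi)^-1)%:C *
    cintegral setT (fun t => f (cval u * expi t)%g * (cdensity u t)%:C).
  rewrite inner_L2E; congr (_ * _); apply: eq_cintegral.
  - by apply: cmeasurableM; [apply: cmeasurableJ|]; exact: L2_cmeasurable.
  - apply: cmeasurableM; first exact: rotate_cmeasurable.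
    split; last exact: measurable_cst.
    by apply: continuous_measurable_fun; exact: cdensity_continuous.
  - apply: aeS2 (comp_phi u) (comp_rep sysphi u hf) => t e1 ->.
    by rewrite e1 mulrCA conj_mulE.
rewrite inner_sys; under eq_bigr do rewrite E.
rewrite -mulr_sumr; congr (_ * _).
have bnd (G : C -> R) : (forall c, `|G c| <= cabs c) ->
    {ae mu, forall x, `|G (f (expi x))| <= M}.
  move=> hG; apply: aeS hM => x; rewrite cabs_norm lecR => h.
  exact: le_trans (hG _) h.
have RR : \sum_u \int[mu]_t (Re (f (cval u * expi t)%g) * cdensity u t) =
    \int[mu]_(x in `[0, 2 * pi]%classic) Re (f (expi x)).
  apply: (@periodization_signed (fun w => Re (f w)) M); first exact: mf.1.
  by apply: bnd; exact: cabs_Re_le.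
have II : \sum_u \int[mu]_t (Im (f (cval u * expi t)%g) * cdensity u t) =
    \int[mu]_(x in `[0, 2 * pi]%classic) Im (f (expi x)).
  apply: (@periodization_signed (fun w => Im (f w)) M); first exact: mf.2.
  by apply: bnd; exact: cabs_Im_le.
apply: complex_eq; rewrite /cintegral.
  rewrite Re_sum [RHS]/=; under [RHS]eq_Rintegral do rewrite mulr1.
  rewrite -RR; apply: eq_bigr => u _ /=; apply: eq_Rintegral => t _.
  by rewrite mulrC ReZ mulrC.
rewrite (big_morph _ (@complex_ImD R) (erefl _)) [RHS]/=.
under [RHS]eq_Rintegral do rewrite mulr1.
rewrite -II; apply: eq_bigr => u _ /=; apply: eq_Rintegral => t _.
by rewrite mulrC ImZ mulrC.
Qed.

(** ** Cyclicity *)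

Definition embed (u : cpoint) (x : L2space R) : sysH :=
  fun i k => if Tagged (fun i => 'I_(p i)) k == u then x else 0.

Lemma comp_embed u x v : comp (embed u x) v = if v == u then x else 0.
Proof. by case: v. Qed.

Lemma hsq_L2_0 : @hsq R (L2space R) 0 = 0.
Proof. exact: hsq0 (@hilbert_L2 R). Qed.

Lemma hsq_embed u x : hsq (embed u x) = hsq x.
Proof.
rewrite hsq_sys (bigD1 u)//= comp_embed eqxx big1 ?addr0// => v vu.
by rewrite comp_embed (negbTE vu) hsq_L2_0.
Qed.

Lemma embedB u x y : embed u x - embed u y = embed u (x - y).
Proof.
apply: sys_ext => v; rewrite comp_embed.
rewrite [LHS](_ : _ = comp (embed u x) v - comp (embed u y) v)// !comp_embed.
by case: ifP => // _; rewrite subr0.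
Qed.

Lemma inner_embed X u x : inner X (embed u x) = inner (comp X u) x.
Proof.
rewrite inner_sys (bigD1 u)//= comp_embed eqxx big1 ?addr0// => v vu.
by rewrite comp_embed (negbTE vu); exact: (inner0r (@hilbert_L2 R)).
Qed.

Lemma U1_0 : U1 N (0 : L2space R) = 0.
Proof. exact: linear_0 (U1_linear N_gt0). Qed.

Lemma sysU_embed v x : sysU (embed (csucc v) x) =
  embed v (val (expi (theta (tag v) (tagged v))) *: U1 N x).
Proof.
apply: sys_ext => u; rewrite comp_embed.
transitivity (val (expi (theta (tag u) (tagged u))) *:
    U1 N (comp (embed (csucc v) x) (csucc u))); first by [].
rewrite comp_embed (inj_eq (bij_inj csucc_bij)); case: eqP => [->//|_].
by rewrite U1_0 scaler0.
Qed.

Lemma sysU_lin : linear sysU.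
Proof. by have [] := sysU_unitary. Qed.

Lemma sysUB X Y : sysU (X - Y) = sysU X - sysU Y.
Proof. by rewrite addrC -scaleN1r sysU_lin scaleN1r addrC. Qed.

Lemma sysU_iterB j X Y : iter j sysU (X - Y) = iter j sysU X - iter j sysU Y.
Proof. by elim: j => //= j ->; rewrite sysUB. Qed.

Lemma hsq_iter j X : hsq (iter j sysU X) = hsq X.
Proof. by elim: j => //= j IH; rewrite hsq_sysU. Qed.

Lemma sysU_iter_surj j Y : exists X, iter j sysU X = Y.
Proof.
elim: j Y => [|j IH] Y; first by exists Y.
have [_ _ sU] := sysU_unitary; have [Y' hY'] := sU Y.
by have [X hX] := IH Y'; exists X; rewrite /= hX.
Qed.

(** Boundedness is what allows the coefficient read off the arc to be in [Linfty]. *)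
Definition concentrated (A B : R) (x : L2space R) : Prop :=
  {ae mu, forall t, far A t -> (x : L2 R) t = 0} /\
  {ae mu, forall t, sqmod ((x : L2 R) t) <= B}.

Lemma concentrated_U1 (A B : R) (c : circle R) x : concentrated A B x ->
  concentrated (A / N%:R) (N%:R * B) (val c *: U1 N x).
Proof.
move=> [xA xB]; have h1 := L2Z_ae (val c) (U1 N x); have h2 := U1_ae N_gt0 x.
split.
  have h := ae_and h1 (ae_and h2 (ae_dilate N_gt0 xA)).
  apply: aeS h => t [-> [-> e]] /(far_dilate N_gt0) /e ->.
  by rewrite !mulr0.
have h := ae_and h1 (ae_and h2 (ae_dilate N_gt0 xB)).
apply: aeS h => t [-> [-> e]].
rewrite !sqmodM sqmod_circle mul1r sqmodR sqr_sqrtr ?(ltW N0)//.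
by rewrite ler_pM2l.
Qed.

Lemma sysU_iter_embed (A B : R) u x j : concentrated A B x ->
  exists v y B', iter j sysU (embed u x) = embed v y /\
    concentrated (A / N%:R ^+ j) B' y.
Proof.
move=> xAB; elim: j => [|j [v [y [B' [e cy]]]]].
  by exists u, x, B; rewrite expr0 divr1.
have [s' sK s'K] := csucc_bij.
exists (s' v), (val (expi (theta (tag (s' v)) (tagged (s' v)))) *: U1 N y), (N%:R * B').
split; first by rewrite /= e -{1}(s'K v) sysU_embed.
by rewrite exprSr invfM mulrA; exact: concentrated_U1.
Qed.

Lemma hsq_sysrep_phi f : Linfty f -> ((2 * pi * hsq (sysrep f sysphi))%:E =
  \int[mu]_(x in `[0%R, (2 * pi)%R]) (sqmod (f (expi x)))%:E)%E.
Proof.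
move=> hf; have [mf _] := hf.
rewrite -(@periodization (fun w => sqmod (f w))); last 2 first.
- exact: measurable_sqmod.
- by move=> w; exact: sqmod_ge0.
rewrite hsq_sys mulr_sumr -sumEFin; apply: eq_bigr => u _.
rewrite [(_ * _)%:E](hsq_L2 _).
rewrite (@ae_eq_energy _ _ (fun t => f (cval u * expi t)%g * cscaling u t)).
- by apply: eq_integral => t _; rewrite sqmodM.
- exact: L2_cmeasurable.
- by apply: cmeasurableM; [exact: rotate_cmeasurable|exact: cscaling_measurable].
- by apply: aeS2 (comp_rep sysphi u hf) (comp_phi u) => t -> ->.
Qed.

(** Let [f] be [y] read off a short arc around [cval v].  By [h = 1] the vector
    [sysrep f sysphi] has at most the norm of [y], and its component [v] is [y]
    times a factor within [K d] of [1]; so its inner product with [embed v y] is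
    almost the square of this common norm, which leaves no room for the other
    components. *)
Lemma local_approximation v (y : L2space R) (d B K : R) :
  0 <= K -> (forall t, cabs (cscaling v t - 1) <= K * `|t|) ->
  0 <= d -> d < pi / 2 -> concentrated d B y ->
  exists f, Linfty f /\ hsq (sysrep f sysphi - embed v y) <= 2 * (K * d) * hsq y.
Proof.
move=> K0 hK d0 dpi [yd yB].
have pp := twopi_gt0 R.
(* the bounds hold only almost everywhere, so [y] is first corrected on a null
   set *)
pose D : set R := ~` far d `&` [set t | sqmod ((y : L2 R) t) <= B].
have mD : measurable D.
  apply: measurableI; first by apply: measurableC; exact: measurable_far.
  have := measurable_sqmod (L2_cmeasurable (y : L2 R)).
  move=> /(_ measurableT `]-oo, B]%classic (measurable_itv _)); rewrite setTI.
  by congr measurable; apply/seteqP; split=> t /=; rewrite in_itv.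
pose y' := cut D (y : L2 R).
have my' : cmeasurable y' by exact: cmeasurable_cut (L2_cmeasurable _).
have y'y : {ae mu, forall t, y' t = (y : L2 R) t}.
  apply: aeS2 yd yB => t h1 h2; have [Dt|Dt] := pselect (D t); first exact: cutT.
  rewrite /y' cutF//; have [ft|ft] := pselect (far d t); first by rewrite h1.
  by exfalso; apply: Dt.
have B0 : 0 <= `|B| by [].
have y'B t : sqmod (y' t) <= `|B|.
  have [Dt|Dt] := pselect (D t); last by rewrite /y' cutF// sqmod0.
  by rewrite /y' cutT//; apply: le_trans (ler_norm _); case: Dt.
have y'd t : far d t -> y' t = 0 by move=> ft; rewrite /y' cutF// => -[].
have Ey : energy y' = energy (y : L2 R).
  by apply: ae_eq_energy => //; exact: L2_cmeasurable.
have [f [hf fy f0]] := arc_lift (cval v) my' y'B.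
exists f; split=> //.
(* the arc is covered once, so the integral of [sqmod f] over a period is at most
   the energy of [y] *)
have hA : hsq (sysrep f sysphi) <= hsq y.
  rewrite -(ler_pM2l pp) -lee_fin hsq_sysrep_phi// hsq_L2 -Ey /energy.
  have [b hb] := expi_surj (cval v).
  have my2 := measurable_esqmod my'.
  have y20 t : (0 <= (sqmod (y' t))%:E :> \bar R)%E by rewrite lee_fin sqmod_ge0.
  rewrite (ge0_integral_shift (- b) my2 y20).
  have ms := measurable_fun_shift (- b) my2.
  rewrite (ge0_integral_unfold ms); last by move=> t; exact: y20.
  have mss j := measurable_fun_shift (2 * pi * (zenum j)%:~R) ms.
  apply: ge0_le_integral => //.
  - by move=> x _; rewrite lee_fin sqmod_ge0.
  - by apply: measurable_funTS; apply: measurable_esqmod; case: hf.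
  - apply: measurable_funTS; apply: ge0_emeasurable_sum => [j x _ _|j _].
      exact: y20.
    exact: mss.
  - move=> x _; have [->|[t tx ->]] := f0 (expi x).
      by rewrite sqmod0 nneseries_ge0// => j _ _; exact: y20.
    move: tx; rewrite -hb -expiD => /expi_inj_lift[j xj].
    have -> : t = x + 2 * pi * (zenum (zrank (- j)))%:~R - b.
      by rewrite zrankK xj mulrNz; lra.
    rewrite (@nneseriesD1 _ _ (zrank (- j)))//.
    by apply: leeDl; apply: nneseries_ge0 => *; exact: y20.
(* only the component [v] of [sysrep f sysphi] meets [embed v y] *)
have hAB : (1 - K * d) * hsq y <= Re (inner (sysrep f sysphi) (embed v y)).
  rewrite inner_embed inner_L2E ReZ.
  have -> : hsq y = (2 * pi)^-1 * \int[mu]_t sqmod (y' t).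
    by rewrite /hsq inner_L2_sq ReR -Ey.
  have ei : (energy y' < +oo)%E by rewrite Ey; exact: L2_energy.
  have iy : mu.-integrable setT (EFin \o (fun t => sqmod (y' t))).
    apply/integrableP; split; first exact: measurable_esqmod.
    by under eq_integral do rewrite /= ger0_norm ?sqmod_ge0//.
  have mc := cscaling_measurable v.
  have iyc : mu.-integrable setT
      (EFin \o (fun t => sqmod (y' t) * Re (cscaling v t))).
    apply: le_integrable iy => //.
      apply/measurable_EFinP/measurable_funM; last exact: mc.1.
      exact: measurable_sqmod.
    move=> t _; rewrite lee_fin normrM ler_piMr//.
    by apply: le_trans (cabs_Re_le _) _; exact: cscaling_le1.
  have -> : cintegral setT (fun t => ((comp (sysrep f sysphi) v : L2 R) t)^* *
      (y : L2 R) t) = cintegral setT (fun t => (sqmod (y' t))%:C * (cscaling v t)^*).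
    apply: eq_cintegral.
    - by apply: cmeasurableM; [apply: cmeasurableJ|]; exact: L2_cmeasurable.
    - apply: cmeasurableM; last exact: cmeasurableJ.
      by split; [exact: measurable_sqmod|exact: measurable_cst].
    - have h := ae_and (comp_rep sysphi v hf) (ae_and (comp_phi v) y'y).
      apply: aeS h => t [-> [-> <-]].
      have [ft|/negP] := pselect (far d t).
        by rewrite y'd// sqmod0 mulr0 mul0r.
      rewrite -leNgt => td; rewrite fy.
        by rewrite cjM mulrAC conj_mulE.
      exact: ltr_norm_itv td dpi.
  rewrite [X in _ <= _ * X](_ : _ = \int[mu]_t (sqmod (y' t) * Re (cscaling v t))).
    rewrite mulrCA ler_pM2l ?invr_gt0// -RintegralZl//.
    apply: le_Rintegral => //.
      by have := integrableZl measurableT (1 - K * d) iy.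
    move=> t _; rewrite mulrC.
    have [ft|/negP] := pselect (far d t); first by rewrite y'd// sqmod0 !mul0r.
    rewrite -leNgt => td; rewrite ler_wpM2l ?sqmod_ge0//.
    have h1 := cabs_Re_le (cscaling v t - 1).
    rewrite complex_ReD ReN /= in h1; apply: ler_1B h1 _.
    by apply: le_trans (hK t) _; rewrite ler_wpM2l.
  by apply: eq_Rintegral => t _; rewrite ReZ ReJ.
rewrite hsqB; last exact: hilbert_sys.
rewrite hsq_embed; move: hA hAB; lra.
Qed.

(** Restrict [x] to the set where [|t|] and [sqmod (x t)] are at most a large
    integer. *)
Lemma hsq_trunc (x : L2space R) (e : R) : 0 < e ->
  exists A B x', concentrated A B x' /\ 0 <= A /\ hsq (x - x') < e.
Proof.
move=> e0; have pp := twopi_gt0 R.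
pose D (j : nat) : set R := far j%:R `|` [set t | j%:R < sqmod ((x : L2 R) t)].
have mx := L2_cmeasurable (x : L2 R).
have mD j : measurable (D j).
  apply: measurableU; first exact: measurable_far.
  have := measurable_sqmod mx.
  move=> /(_ measurableT `]j%:R, +oo[%classic (measurable_itv _)); rewrite setTI.
  by congr measurable; apply/seteqP; split=> t /=; rewrite in_itv/= andbT.
have [||M hM] := @energy_cut_cvg0 R D (x : L2 R) mD mx (L2_energy _) _ (2 * pi * e).
- move=> t; exists (Num.truncn (`|t| + sqmod ((x : L2 R) t))).+1 => j hj.
  have h : `|t| + sqmod ((x : L2 R) t) < j%:R.
    by apply: lt_le_trans (truncnS_gt _) _; rewrite ler_nat.
  case=> /=; rewrite /far/=; apply/negP; rewrite -leNgt;
    apply: le_trans (ltW h); first by rewrite lerDl sqmod_ge0.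
  by rewrite lerDr.
- by rewrite mulr_gt0.
pose g := cut (~` D M) (x : L2 R).
have mg : cmeasurable g by apply: cmeasurable_cut => //; exact: measurableC.
have sg : g \in @square_integrable R.
  apply/square_integrableP; split=> //; apply: le_lt_trans (L2_energy (x : L2 R)).
  rewrite -[leRHS]mul1e; apply: le_energy => //.
  apply: ae_all => t; rewrite mul1r /g.
  by have [->|->] := cut_cases (~` D M) (x : L2 R) t; rewrite ?sqmod0 ?sqmod_ge0.
have gx := toL2K sg.
exists M%:R, M%:R, (toL2 g); split; first split.
- apply: aeS gx => t -> ft; rewrite /g cutF// => nD; apply: nD; by left.
- apply: aeS gx => t ->; have [Dt|Dt] := pselect ((~` D M) t); last first.
    by rewrite /g cutF// sqmod0.
  by rewrite /g cutT// leNgt; apply/negP => h; apply: Dt; right.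
- split=> //; rewrite -(ltr_pM2l pp) -lte_fin hsq_L2 energyB_L2.
  rewrite (@ae_eq_energy _ _ (cut (D M) (x : L2 R))); first exact: hM.
  + by apply: cmeasurableB => //; exact: L2_cmeasurable.
  + exact: cmeasurable_cut.
  + apply: aeS gx => t ->; have [Dt|Dt] := pselect (D M t).
      by rewrite [cut (D M) _ _]cutT// /g cutF ?subr0// => nD; exact: nD.
    by rewrite [cut (D M) _ _]cutF// /g cutT ?subrr.
Qed.

(** The vectors [U^-j pi(f) phi] without inverting [U]. *)
Definition cyclic_set : set sysH :=
  [set v | exists j f, Linfty f /\ iter j sysU v = sysrep f sysphi].

(** A truncation of [x] is moved by a high power of [U] into a window so small
    that [local_approximation] applies; pulling back by a unitary does not change
    the error. *)
Lemma embed_approx u (x : L2space R) (e : R) : 0 < e ->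
  exists2 v, cyclic_set v & hsq (embed u x - v) < e.
Proof.
move=> e0; have hS := hilbert_sys.
have e4 : 0 < e / 4 by rewrite divr_gt0.
have [A [B [x' [cx' [A0 hx']]]]] := hsq_trunc x e4.
have [K hK] : exists K : R, 0 <= K /\
    forall v t, cabs (cscaling v t - 1) <= K * `|t|.
  have /choice[K hK] v : exists K : R, 0 <= K /\
      forall t, cabs (cscaling v t - 1) <= K * `|t|.
    have [K K0 hK] := cscaling_lip v; exists K; split=> // t.
    by have := hK t 0; rewrite cscaling0 subr0.
  exists (\sum_v K v); split; first by apply: sumr_ge0 => v _; case: (hK v).
  move=> v t; apply: le_trans ((hK v).2 t) _; rewrite ler_wpM2r//.
  by rewrite (bigD1 v)//= lerDl sumr_ge0// => w _; case: (hK w).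
case: hK => K0 hK.
(* [c < N^j] gives both conditions on the window [d = A / N^j]: it is less than
   [1 < pi / 2], and the error [2 K d |x'|^2] is less than [e / 4] *)
pose c := 2 * K * A * hsq x' / (e / 4) + A.
have [j hj] : exists j : nat, c < j%:R.
  by exists (Num.truncn c).+1; exact: truncnS_gt.
have Nj : c < N%:R ^+ j.
  by apply: lt_le_trans hj _; rewrite -natrX ler_nat ltnW// ltn_expl.
have x'0 := hsq_ge0 (@hilbert_L2 R) x'.
have Njp : 0 < N%:R ^+ j :> R by rewrite exprn_gt0.
have c0 : 0 <= 2 * K * A * hsq x' / (e / 4).
  by rewrite divr_ge0 ?(ltW e4)// !mulr_ge0.
have d0 : 0 <= A / N%:R ^+ j by rewrite divr_ge0// ltW.
have d1 : A / N%:R ^+ j < pi / 2.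
  apply: lt_le_trans (pihalf_ge1 R); rewrite ltr_pdivrMr// mul1r.
  by apply: le_lt_trans Nj; rewrite lerDr.
have [v [y [B' [Ue cy]]]] := sysU_iter_embed u j cx'.
have [f [hf ha]] := local_approximation K0 (hK v) d0 d1 cy.
have [V hV] := sysU_iter_surj j (sysrep f sysphi).
exists V; first by exists j, f.
have hy : hsq y = hsq x' by rewrite -(hsq_embed v) -Ue hsq_iter hsq_embed.
have -> : embed u x - V = (embed u x - embed u x') + (embed u x' - V).
  by rewrite addrA subrK.
apply: le_lt_trans (hsqD_le hS _ _) _.
rewrite embedB hsq_embed.
have : hsq (embed u x' - V) < e / 4.
  rewrite -(hsq_iter j) sysU_iterB Ue hV -hsqN// opprB.
  apply: le_lt_trans ha _; rewrite hy.
  have : 2 * K * A * hsq x' / (e / 4) < N%:R ^+ j.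
    by apply: le_lt_trans Nj; rewrite lerDl.
  rewrite ltr_pdivrMr// [X in _ < X]mulrC => h.
  rewrite (_ : 2 * (K * (A / N%:R ^+ j)) * hsq x' =
    2 * K * A * hsq x' / N%:R ^+ j); last by rewrite !mulrA; ring.
  by rewrite ltr_pdivrMr.
by move: hx'; lra.
Qed.

Lemma comp_sum (r : seq cpoint) (F : cpoint -> sysH) v :
  comp (\sum_(u <- r) F u) v = \sum_(u <- r) comp (F u) v.
Proof. by elim/big_rec2: _ => // u x y _ <-. Qed.

Lemma sum_embed X : X = \sum_u embed u (comp X u).
Proof.
apply: sys_ext => v; rewrite comp_sum (bigD1 v)//= comp_embed eqxx.
rewrite big1 ?addr0// => u uv.
by rewrite comp_embed eq_sym (negbTE uv).
Qed.

Lemma sysphi_cyclic : hdense (Defs.span cyclic_set).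
Proof.
have hS := hilbert_sys; apply: span_dense => X e e0; rewrite [X]sum_embed.
elim: (index_enum _) e e0 => [|u r IH] e e0.
  exists 0; first exact: span0.
  by rewrite big_nil subr0 hsq0.
have e4 : 0 < e / 4 by rewrite divr_gt0.
have [v cv hv] := embed_approx u (comp X u) e4.
have [w cw hw] := IH _ e4.
exists (v + w); first by apply: spanD => //; exact: span_mem.
rewrite big_cons.
have -> : embed u (comp X u) + \sum_(j <- r) embed j (comp X j) - (v + w) =
    (embed u (comp X u) - v) + (\sum_(j <- r) embed j (comp X j) - w).
  by rewrite opprD addrACA.
apply: le_lt_trans (hsqD_le hS _ _) _.
by move: hv hw; lra.
Qed.

Lemma sys_cyclic_representation :
  cyclic_representation N m0 (fun=> 1) sysU sysrep sysphi.
Proof.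
split.
- exact: hilbert_sys.
- exact: sysU_unitary.
- exact: sysrep_star.
- exact: sysU_rep.
- split; [exact: sysU_phi|exact: inner_phi_rep|exact: sysphi_cyclic].
Qed.

(** ** The commutant *)

(** Iterating [U] gathers the mass near the cycle, where [g] vanishes. *)
Lemma cycle_rep_decay i (g : T -> C) (A : R) (x : cycle_space R (p i)) :
  Linfty g -> (forall v, sqmod (g v) <= 1) -> 0 < A ->
  (forall k t, `|t| <= A -> g (z i k * expi t)%g = 0) ->
  forall e : R, 0 < e -> exists M, forall j, (M <= j)%N ->
    hsq (cycle_rep (z i) g (iter j (cycle_U N (theta i)) x)) <= e.
Proof.
move=> hg g1 A0 gA e e0; have pp := twopi_gt0 R.
have [|M hM] := @tail_cvg0 R N (p i) N_ge2 A x A0 (2 * pi * e).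
  by rewrite mulr_gt0.
exists M => j /hM; rewrite -(tail_iter (theta i) N_ge2) => h.
have := le_trans (cycle_rep_tail (iter j (cycle_U N (theta i)) x) hg g1 gA) h.
by rewrite lee_fin ler_pM2l.
Qed.

Definition near_cycle i (e : R) : set T :=
  [set w | exists k t, `|t| <= e /\ w = (z i k * expi t)%g].

Lemma measurable_near_cycle i e :
  measurable [set x : R | near_cycle i e (expi x)].
Proof.
have /choice[a ha] k : exists a, expi a = z i k by exact: expi_surj.
have -> : [set x : R | near_cycle i e (expi x)] =
    \bigcup_(kn : 'I_(p i) * nat)
      `[a kn.1 + 2 * pi * (zenum kn.2)%:~R - e, a kn.1 + 2 * pi * (zenum kn.2)%:~R + e]%classic.
  apply/seteqP; split=> x /=.
    move=> [k [t [te]]]; rewrite -ha -expiD => /expi_inj_lift[j xj].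
    exists (k, zrank j) => //=; rewrite zrankK in_itv/=.
    by move: te; rewrite ler_norml xj => /andP[h1 h2]; apply/andP; split; lra.
  move=> [[k m] _ /=]; rewrite in_itv/= => /andP[h1 h2].
  exists k, (x - (a k + 2 * pi * (zenum m)%:~R)); split.
    by rewrite ler_norml; apply/andP; split; lra.
  rewrite -ha -expiD -(expi_periodic (_ + _) (zenum m)); congr expi; ring.
apply: countable_bigcupT_measurable => [|kn]; first exact: countableP.
exact: measurable_itv.
Qed.

(** The neighbourhoods of the cycles are disjoint by [lifts_separated]. *)
Lemma cycle_indicator i : exists (f : T -> C) (e : R),
  [/\ 0 < e, Linfty f, forall w, f w = 0 \/ f w = 1,
      forall k t, `|t| <= e -> f (z i k * expi t)%g = 1
    & forall j k t, j != i -> `|t| <= e -> f (z j k * expi t)%g = 0].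
Proof.
have [e e0 he] := lifts_separated N_ge2 cval_inj.
exists (fun w => (\1_(near_cycle i e) w : R)%:C), e; split=> //.
- split.
    split; last exact: measurable_cst.
    have := @measurable_indic _ R R setT _ (measurable_near_cycle i e).
    by congr measurable_fun; apply/funext => x; rewrite !indicE; congr (_%:R).
  exists 1; apply: ae_all => x; rewrite cabs_norm lecR indicE.
  by rewrite cabsR//; case: (_ \in _).
- by move=> w; rewrite indicE; case: (_ \in _); [right|left].
- by move=> k t te; rewrite indicE mem_set//; exists k, t.
- move=> j k t ji te; rewrite indicE memNset// => -[l [s [se ejs]]].
  have [] := he (Tagged (fun i => 'I_(p i)) k) t (Tagged (fun i => 'I_(p i)) l) s
    te se ejs.
  by move=> /(congr1 tag) /= ij; move: ji; rewrite ij eqxx.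
Qed.

Definition cinj i (x : cycle_space R (p i)) : sysH :=
  @dfwith _ (fun j => cycle_space R (p j)) (fun=> 0) i x.
Arguments cinj {i} x _ : rename.

Lemma cinj_in i (x : cycle_space R (p i)) : cinj x i = x.
Proof. exact: dfwith_in. Qed.

Lemma cinj_out i (x : cycle_space R (p i)) j : i != j -> cinj x j = 0.
Proof. by move=> ij; exact: dfwith_out. Qed.

Lemma cinj_ext i (X : sysH) : (forall j, i != j -> X j = 0) -> X = cinj (X i).
Proof.
move=> h; apply: functional_extensionality_dep => j.
by have [<-|ij] := eqVneq i j; [rewrite cinj_in|rewrite cinj_out// h].
Qed.

Lemma hsq_cinj i (x : cycle_space R (p i)) : hsq (cinj x) = hsq x.
Proof.
rewrite hsq_dsum (bigD1 i)//= cinj_in big1 ?addr0// => j ji.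
by rewrite cinj_out ?(hsq0 (hilbert_cycle R (p j)))// eq_sym.
Qed.

Lemma cycle_U_0 i : cycle_U N (theta i) 0 = 0.
Proof. exact: linear_0 (cycle_U_linear (theta i) N_gt0). Qed.

Lemma cycle_rep_0 i f : Linfty f -> cycle_rep (z i) f 0 = 0.
Proof.
move=> hf; have [h _ _ _ _] := star_representation_cycle (z i).
by have [l _] := h f hf; exact: linear_0 l.
Qed.

Lemma sysU_cinj i (x : cycle_space R (p i)) :
  sysU (cinj x) = cinj (cycle_U N (theta i) x).
Proof.
rewrite [LHS](@cinj_ext i) => [|j ij].
  by congr cinj; rewrite /sysU /dsum_op cinj_in.
by rewrite /sysU /dsum_op cinj_out// cycle_U_0.
Qed.

Lemma sysrep_cinj f i (x : cycle_space R (p i)) : Linfty f ->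
  sysrep f (cinj x) = cinj (cycle_rep (z i) f x).
Proof.
move=> hf; rewrite [LHS](@cinj_ext i) => [|j ij].
  by congr cinj; rewrite /sysrep /dsum_op cinj_in.
by rewrite /sysrep /dsum_op cinj_out// cycle_rep_0.
Qed.

Lemma iter_sysU_at j (X : sysH) i :
  iter j sysU X i = iter j (cycle_U N (theta i)) (X i).
Proof. by elim: j => //= j IH; rewrite /sysU /dsum_op -/sysU IH. Qed.

Lemma iter_sysU_cinj j i (x : cycle_space R (p i)) :
  iter j sysU (cinj x) = cinj (iter j (cycle_U N (theta i)) x).
Proof. by elim: j => //= j ->; rewrite sysU_cinj. Qed.

Lemma hsq_cycle_iter i j (x : cycle_space R (p i)) :
  hsq (iter j (cycle_U N (theta i)) x) = hsq x.
Proof. by elim: j => //= j IH; rewrite hsq_cycle_U. Qed.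

Lemma commutant_iter (S : sysH -> sysH) j X : commutant sysU sysrep S ->
  S (iter j sysU X) = iter j sysU (S X).
Proof. by move=> [_ SU _ _]; elim: j => //= j <-; rewrite SU. Qed.

(** High powers of the dilation concentrate the [i]-th summand near the [i]-th
    cycle, where the indicator [f] separates it from every other summand. *)
Lemma commutant_block (S : sysH -> sysH) i j (x : cycle_space R (p i)) :
  commutant sysU sysrep S -> i != j -> S (cinj x) j = 0.
Proof.
move=> hS ij; have [bS SU _ Srep] := hS.
have hj := hilbert_cycle R (p j).
have [M M0 hM] := bounded_hsq hilbert_sys bS.
have [f [e [e0 hf f01 fi fj]]] := cycle_indicator i.
pose g w := -1 * f w + 1.
have hg : Linfty g by apply: LinftyZD => //; exact: Linfty_cst.
have f1 w : sqmod (f w) <= 1 by case: (f01 w) => ->; rewrite ?sqmod0 ?sqmod1.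
have g1 w : sqmod (g w) <= 1.
  by rewrite /g; case: (f01 w) => ->; rewrite ?mulr0 ?add0r ?mulr1 ?addNr
    ?sqmod0 ?sqmod1.
have gi k t : `|t| <= e -> g (z i k * expi t)%g = 0.
  by move=> te; rewrite /g fi// mulr1 addNr.
have fj' k t : `|t| <= e -> f (z j k * expi t)%g = 0.
  by move=> te; apply: fj; rewrite // eq_sym.
set y := S (cinj x).
apply: (hsq_eq0 hj); apply/eqP; rewrite eq_le hsq_ge0// andbT.
apply/ler_addgt0Pr => d d0; rewrite add0r.
have d1 : 0 < d / 4 by rewrite divr_gt0.
have d2 : 0 < d / 4 / (M + 1) by rewrite divr_gt0// ltr_wpDl.
have [n1 hn1] := cycle_rep_decay x hg g1 e0 gi d2.
have [n2 hn2] := cycle_rep_decay (y j) hf f1 e0 fj' d1.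
pose m := maxn n1 n2.
have a1 := hn1 m (leq_maxl _ _); have a2 := hn2 m (leq_maxr _ _).
pose Y := iter m (cycle_U N (theta j)) (y j).
have YE : Y = cycle_rep (z j) f Y + cycle_rep (z j) g Y.
  have [_ _ lin _ [one _]] := star_representation_cycle (z j).
  by rewrite (lin (-1) f (fun=> 1) hf (Linfty_cst 1)) one scaleN1r addrA subrr add0r.
(* [S] commutes with [g] and with powers of [U], so that [g] acts before [S], on
   the [i]-th summand *)
have a3 : hsq (cycle_rep (z j) g Y) <= d / 4.
  have -> : cycle_rep (z j) g Y = S (sysrep g (iter m sysU (cinj x))) j.
    by rewrite Srep// commutant_iter// /sysrep /dsum_op iter_sysU_at.
  apply: le_trans (hsq_dsum_ge (fun i => hilbert_cycle R (p i)) _ j) _.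
  apply: le_trans (hM _) _; rewrite iter_sysU_cinj sysrep_cinj// hsq_cinj.
  apply: (@le_trans _ _ (M * (d / 4 / (M + 1)))); first by rewrite ler_wpM2l.
  rewrite mulrA ler_pdivrMr ?ltr_wpDl// mulrC ler_wpM2l ?(ltW d1)//.
  by rewrite lerDl.
rewrite -(hsq_cycle_iter m) -/Y YE.
apply: le_trans (hsqD_le hj _ _) _.
by move: a2 a3; rewrite -/Y; lra.
Qed.

Definition block (S : sysH -> sysH) i (x : cycle_space R (p i)) :
  cycle_space R (p i) := S (cinj x) i.
Arguments block : clear implicits.

Lemma cinj_linear i (a : C) (x y : cycle_space R (p i)) :
  cinj (a *: x + y) = a *: cinj x + cinj y.
Proof.
rewrite [RHS](@cinj_ext i) => [|j ij].
  congr cinj; rewrite [RHS](_ : _ = a *: cinj x i + cinj y i)//.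
  by rewrite !cinj_in.
rewrite [LHS](_ : _ = a *: cinj x j + cinj y j)//.
by rewrite !cinj_out// scaler0 addr0.
Qed.

Lemma sum_cinj (X : sysH) : X = \sum_i cinj (X i).
Proof.
apply: functional_extensionality_dep => j.
rewrite dsum_sumE (bigD1 j)//= cinj_in big1 ?addr0// => i ij.
by rewrite cinj_out.
Qed.

Lemma commutant_dsum (S : sysH -> sysH) : commutant sysU sysrep S ->
  S = dsum_op (block S).
Proof.
move=> hS; have [[lS _] _ _ _] := hS; apply/funext => X.
have S0 := linear_0 lS.
have SD : {morph S : x y / x + y}.
  by move=> x y; have := lS 1 x y; rewrite !scale1r.
apply: functional_extensionality_dep => j.
rewrite {1}(sum_cinj X) (big_morph S SD S0).
rewrite dsum_sumE (bigD1 j)//= big1 ?addr0// => i ij.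
exact: commutant_block.
Qed.

Lemma commutant_block_commutant (S : sysH -> sysH) i :
  commutant sysU sysrep S ->
  commutant (cycle_U N (theta i)) (cycle_rep (z i)) (block S i).
Proof.
move=> hS; have [bS SU _ Srep] := hS.
have bU x : block S i (cycle_U N (theta i) x) = cycle_U N (theta i) (block S i x).
  by rewrite /block -sysU_cinj SU.
split=> //.
- split.
    have [lS _] := bS; move=> a x y.
    by rewrite /block cinj_linear lS.
  have [M M0 hM] := bounded_hsq hilbert_sys bS.
  exists (Num.sqrt M) => x; apply: hnorm_le; first exact: hilbert_cycle.
    exact: sqrtr_ge0.
  rewrite sqr_sqrtr//.
  apply: le_trans (hsq_dsum_ge (fun i => hilbert_cycle R (p i)) _ i) _.
  by apply: le_trans (hM _) _; rewrite hsq_cinj.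
- move=> V adjV x.
  have [_ iU sU] := cycle_U_unitary (theta i) N_gt0.
  (* an adjoint of a unitary is its inverse *)
  have VU y : V (cycle_U N (theta i) y) = y.
    apply: (inner_ext (hilbert_cycle R (p i))) => w.
    by rewrite -adjV iU.
  have [y <-] := sU x.
  by rewrite VU bU VU.
- by move=> f hf x; rewrite /block -sysrep_cinj// Srep.
Qed.

End System.

Theorem theorem2p16 (R : realType) (N : nat) (m0 : circle R -> R[i])
  (hN : (2 <= N)%N)
  (hlip : lipschitz_circle m0)
  (hzeros : finite_set [set z | m0 z = 0])
  (hR1 : forall z, ruelle N m0 (fun=> 1) z = 1)
  (hm01 : m0 1%g = (Num.sqrt N%:R)%:C)
  (* the distinct m0-cycles C_i = {z i k : k < p i}, with angles theta i k *)
  (n : nat) (p : 'I_n -> nat) (z : forall i, 'I_(p i) -> circle R)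
  (theta : forall i, 'I_(p i) -> R)
  (hcycle : forall i, is_cycle N m0 (z i))
  (hdistinct : forall i j, range (z i) = range (z j) -> i = j)
  (hall : forall (q : nat) (w : 'I_q -> circle R), is_cycle N m0 w ->
     exists i, range w = range (z i))
  (htheta : forall i, cycle_angles N m0 (z i) (theta i)) :
  let H := dsum (fun i => cycle_space R (p i)) in
  let U : H -> H := dsum_op (fun i => cycle_U N (theta i)) in
  let rep (f : circle R -> R[i]) : H -> H :=
    dsum_op (fun i => cycle_rep (z i) f) in
  let phi : H := fun i => cycle_phi N m0 (z i) (theta i) in
  [/\ forall i k, scaling_fun N m0 (z i) (theta i) k \in @square_integrable R,
      cyclic_representation N m0 (fun=> 1) U rep phi
    & forall S : H -> H, commutant U rep S ->
        exists SC : forall i, cycle_space R (p i) -> cycle_space R (p i),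
          (forall i,
             commutant (cycle_U N (theta i)) (cycle_rep (z i)) (SC i)) /\
          S = dsum_op SC].
Proof.
move=> H U rep phi; split.
- move=> i k.
  exact: (@cscaling_square_integrable R N m0 hN hlip hzeros hR1 hm01 n p z theta
    hcycle hdistinct hall htheta (Tagged (fun i => 'I_(p i)) k)).
- exact: sys_cyclic_representation.
- move=> S hS; exists (@block R n p S); split.
    by move=> i; exact: commutant_block_commutant.
  exact: (commutant_dsum hN hcycle hdistinct hS).
Qed.
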